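(* Let $G$ be a commutative topological group. The following assertions hold. (i) Two ergodic measure-preserving systems $(\mathrm{X}_1,T_1)$ and $(\mathrm{X}_2,T_2)$ (with acting group $G$) with discrete spectrum are isomorphic if and only if $\sigma_{\mathrm{p}}(\mathrm{X}_1,T_1)=\sigma_{\mathrm{p}}(\mathrm{X}_2,T_2)$. (ii) For every subgroup $\sigma\subset G^*$ there is an ergodic measure-preserving system $(\mathrm{X},T)$ with discrete spectrum such that $\sigma_{\mathrm{p}}(\mathrm{X},T)=\sigma$. (iii) For every ergodic measure-preserving system $(\mathrm{X},T)$ with discrete spectrum there is a group compactification $(H,c)$ of $G$ such that $(\mathrm{X},T)$ is isomorphic to the rotation $(H,m_H,T^{\varphi_c})$.
   Context: Compact spaces are Hausdorff; vector spaces are complex. $\mathbb{T}$ is the complex unit circle and $G^*$ is the group of continuous group homomorphisms $\chi\colon G\to\mathbb{T}$. A measure-preserving system $(\mathrm{X},T)$ is a probability space $\mathrm{X}$ (no separability assumed) with a strongly continuous group representation $T\colon G\to\mathscr{L}(\mathrm{L}^1(\mathrm{X}))$, $t\mapsto T_t$, by Markov isomorphisms, i.e., each $T_t$ is an invertible linear isometry with $|T_tf|=T_t|f|$ for all $f\in\mathrm{L}^1(\mathrm{X})$ and $T_t\mathbb{1}=\mathbb{1}$. It is ergodic if $\{f\in\mathrm{L}^1(\mathrm{X})\mid T_tf=f\ \forall t\in G\}$ is one-dimensional. It has discrete spectrum if the union of all finite-dimensional $T$-invariant subspaces of $\mathrm{L}^1(\mathrm{X})$ is dense in $\mathrm{L}^1(\mathrm{X})$.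 Its point spectrum is $$\sigma_{\mathrm{p}}(\mathrm{X},T)=\{\chi\in G^*\mid\exists f\in\mathrm{L}^1(\mathrm{X})\setminus\{0\}\text{ with }T_tf=\chi(t)f\text{ for every }t\in G\}.$$ Two systems $(\mathrm{Y},S)$, $(\mathrm{X},T)$ are isomorphic if there is a bijective linear isometry $J\colon\mathrm{L}^1(\mathrm{Y})\to\mathrm{L}^1(\mathrm{X})$ with $|Jf|=J|f|$ for all $f$, $J\mathbb{1}=\mathbb{1}$ and $JS_t=T_tJ$ for all $t\in G$. A group compactification of $G$ is a pair $(H,c)$ of a compact group $H$ and a continuous group homomorphism $c\colon G\to H$ with dense range. The associated (measure-preserving) rotation $(H,m_H,T^{\varphi_c})$ is the system on $H$ with its normalized Haar measure $m_H$ given by $(T^{\varphi_c}_tf)(x)=f(c(t)^{-1}x)$ for $f\in\mathrm{L}^1(H,m_H)$, $t\in G$. *)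

(* Defs.v *)
From HB Require Import structures.
From mathcomp Require Import all_boot all_order all_algebra.
From mathcomp Require Import complex.
From mathcomp Require Import all_classical all_reals all_analysis.
From mathcomp Require Import measurable_realfun.

Set Implicit Arguments.
Unset Strict Implicit.
Unset Printing Implicit Defensive.

Import Order.TTheory GRing.Theory Num.Theory.
Import numFieldNormedType.Exports.
Import ComplexField.Normc.

Local Open Scope classical_set_scope.
Local Open Scope ring_scope.
Local Open Scope quotient_scope.

(* Complex numbers are [R[i]]; the alias [R[i]^o] is the one that carries the
   topology and the [R[i]]-module structure. *)

Section complex_integrable.
Context {d : measure_display} {X : measurableType d} {R : realType}.
Variable mu : {measure set X -> \bar R}.
Implicit Types f g : X -> R[i]^o.

Definition cintegrable f : Prop :=
  mu.-integrable setT (EFin \o (@complex.Re R \o f)) /\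
  mu.-integrable setT (EFin \o (@complex.Im R \o f)).

(* The space of integrable functions [L1fun] is an [R[i]]-module, and [L1] is its
   quotient by the submodule [L1null] of functions vanishing almost everywhere. *)
Definition L1pred : {pred X -> R[i]^o} := mem [set f | cintegrable f].

Lemma L1predP f : reflect (cintegrable f) (f \in L1pred).
Proof. by apply: (iffP idP); rewrite inE. Qed.

Lemma Re_linear_comb (a y z : R[i]) : complex.Re (a * y + z) =
  complex.Re a * complex.Re y - complex.Im a * complex.Im y + complex.Re z.
Proof. by case: a y z => [? ?] [? ?] [? ?]. Qed.

Lemma Im_linear_comb (a y z : R[i]) : complex.Im (a * y + z) =
  complex.Re a * complex.Im y + complex.Im a * complex.Re y + complex.Im z.
Proof. by case: a y z => [? ?] [? ?] [? ?]. Qed.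

Lemma L1pred_submod_closed : submod_closed L1pred.
Proof.
split=> [|a f g /L1predP[fr fi] /L1predP[gr gi]]; apply/L1predP.
  by split; exact: integrable0.
split.
- rewrite (_ : _ \o _ = ((fun x => (complex.Re a)%:E * (complex.Re (f x))%:E) \-
    (fun x => (complex.Im a)%:E * (complex.Im (f x))%:E) \+
    (fun x => (complex.Re (g x))%:E))%E); last first.
    apply/funext => x; exact: (congr1 EFin (Re_linear_comb a (f x) (g x))).
  exact: (integrableD measurableT (integrableB measurableT
    (integrableZl measurableT _ fr) (integrableZl measurableT _ fi)) gr).
- rewrite (_ : _ \o _ = ((fun x => (complex.Re a)%:E * (complex.Im (f x))%:E) \+
    (fun x => (complex.Im a)%:E * (complex.Re (f x))%:E) \+
    (fun x => (complex.Im (g x))%:E))%E); last first.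
    apply/funext => x; exact: (congr1 EFin (Im_linear_comb a (f x) (g x))).
  exact: (integrableD measurableT (integrableD measurableT
    (integrableZl measurableT _ fi) (integrableZl measurableT _ fr)) gi).
Qed.

HB.instance Definition _ :=
  GRing.isSubmodClosed.Build R[i] (X -> R[i]^o) L1pred L1pred_submod_closed.

Definition L1fun : Type := {f | f \in L1pred}.
HB.instance Definition _ := SubChoice.on L1fun.
HB.instance Definition _ := [SubChoice_isSubLmodule of L1fun by <:].

Definition mkL1fun f (cf : f \in L1pred) : L1fun :=
  exist (fun g => g \in L1pred) f cf.

Definition L1null : {pred L1fun} := mem [set f | \val f = cst 0 %[ae mu]].

Lemma L1nullP (f : L1fun) :
  reflect (\val f = cst 0 %[ae mu]) (f \in L1null).
Proof. by apply: (iffP idP); rewrite inE. Qed.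

Lemma L1null_submod_closed : submod_closed L1null.
Proof.
split=> [|a f g /L1nullP f0 /L1nullP g0]; apply/L1nullP.
  by apply/nearW => x _.
apply: filterS2 f0 g0 => x f0 g0 _.
rewrite [LHS](_ : _ = a * \val f x + \val g x)//.
by rewrite f0// g0// mulr0 addr0.
Qed.

HB.instance Definition _ :=
  GRing.isSubmodClosed.Build R[i] L1fun L1null L1null_submod_closed.

Definition L1 : Type := Quotient.quot (L1null : zmodClosed L1fun).
HB.instance Definition _ := GRing.Zmodule.on L1.
HB.instance Definition _ := EqQuotient.on L1.

Definition L1class (f : L1fun) : L1 := \pi f.

Lemma L1class_eq (f g : L1fun) :
  L1class f = L1class g <-> \val f = \val g %[ae mu].
Proof.
rewrite /L1class; split.
- move=> /eqP; rewrite -Quotient.idealrBE => /L1nullP fg.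
  apply: filterS fg => x /(_ I) fg _.
  by apply/eqP; rewrite -subr_eq0; apply/eqP.
- move=> fg; apply/eqP; rewrite -Quotient.idealrBE; apply/L1nullP.
  apply: filterS fg => x /(_ I) fg _.
  by rewrite [LHS](_ : _ = \val f x - \val g x)// fg subrr.
Qed.

Lemma repr_L1class (f : L1fun) :
  \val (repr (L1class f)) = \val f %[ae mu].
Proof. by apply/L1class_eq; rewrite /L1class reprK. Qed.

Lemma L1classK (f : L1) : L1class (repr f) = f.
Proof. exact: reprK. Qed.

Lemma L1classD (f g : L1fun) : L1class (f + g) = L1class f + L1class g.
Proof. exact: Quotient.pi_add. Qed.

Lemma L1class0 : L1class 0 = 0.
Proof. by apply: (addrI (L1class 0)); rewrite -L1classD !addr0. Qed.

Definition L1scale (a : R[i]) (f : L1) : L1 := L1class (a *: repr f).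

Lemma L1classZ a (f : L1fun) : L1class (a *: f) = L1scale a (L1class f).
Proof.
apply/L1class_eq; apply: filterS (repr_L1class f) => x /(_ I) fx _.
by rewrite [RHS](_ : _ = a * \val (repr (L1class f)) x)// fx.
Qed.

Let L1scaleA a b v : L1scale a (L1scale b v) = L1scale (a * b) v.
Proof. by rewrite -(L1classK v) -!L1classZ scalerA. Qed.

Let L1scale1 : left_id 1 L1scale.
Proof. by move=> v; rewrite -(L1classK v) -!L1classZ scale1r. Qed.

Let L1scaleDr : right_distributive L1scale +%R.
Proof.
move=> a u v; rewrite -(L1classK u) -(L1classK v) -L1classD -!L1classZ.
by rewrite scalerDr L1classD.
Qed.

Let L1scaleDl v : {morph L1scale^~ v : a b / a + b}.
Proof.
by move=> a b; rewrite -(L1classK v) -!L1classZ scalerDl L1classD.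
Qed.

HB.instance Definition _ := GRing.Zmodule_isLmodule.Build R[i] L1
  L1scaleA L1scale1 L1scaleDr L1scaleDl.

Lemma normcE (z : R[i]) : `|z| = (normc z)%:C%C.
Proof. by case: z. Qed.

Lemma measurable_normc (f : X -> R[i]^o) :
  measurable_fun setT (@complex.Re R \o f) ->
  measurable_fun setT (@complex.Im R \o f) ->
  measurable_fun setT (fun x => normc (f x)).
Proof.
move=> mr mi.
rewrite (_ : (fun x => _) = @Num.sqrt R \o
    ((fun x => complex.Re (f x) ^+ 2) \+ (fun x => complex.Im (f x) ^+ 2))).
  apply: measurableT_comp.
    by apply: continuous_measurable_fun; exact: sqrt_continuous.
  by apply: measurable_funD; [exact: (measurable_funX 2 mr)|
    exact: (measurable_funX 2 mi)].
by apply/funext => x /=; case: (f x).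
Qed.

Lemma L1_measurable_normc (f : X -> R[i]^o) : cintegrable f ->
  measurable_fun setT (fun x => normc (f x)).
Proof.
move=> [fr fi]; apply: measurable_normc; apply/measurable_EFinP.
  exact: measurable_int fr.
exact: measurable_int fi.
Qed.

Lemma normc_le_ReIm (z : R[i]) :
  normc z <= `|complex.Re z| + `|complex.Im z|.
Proof.
case: z => a b /=; rewrite -(@ler_pXn2r _ 2) ?nnegrE ?sqrtr_ge0 ?addr_ge0//.
rewrite sqr_sqrtr ?addr_ge0 ?sqr_ge0// sqrrD !real_normK ?num_real//.
by rewrite addrAC lerDl mulrn_wge0// mulr_ge0.
Qed.

Lemma integrable_normc (f : X -> R[i]^o) : cintegrable f ->
  mu.-integrable setT (EFin \o (fun x => normc (f x))).
Proof.
move=> cf; have [fr fi] := cf.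
apply: (le_integrable measurableT _ _
  (integrableD measurableT (integrable_norm fr) (integrable_norm fi))).
  exact/measurable_EFinP/L1_measurable_normc.
move=> x _ /=; rewrite lee_fin [leLHS]ger0_norm; last first.
  by case: (f x) => ? ?; exact: sqrtr_ge0.
by rewrite [leRHS]ger0_norm ?addr_ge0// normc_le_ReIm.
Qed.

(* The norm of a normed [R[i]]-module is [R[i]]-valued. *)
Definition L1norm (f : L1) : R[i] :=
  (\int[mu]_x normc (\val (repr f) x))%:C%C.

Lemma L1norm_class (f : L1fun) :
  L1norm (L1class f) = (\int[mu]_x normc (\val f x))%:C%C.
Proof.
rewrite /L1norm /Rintegral; congr ((fine _)%:C%C).
apply: ge0_ae_eq_integral => //.
- exact/measurable_EFinP/L1_measurable_normc/L1predP/valP.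
- exact/measurable_EFinP/L1_measurable_normc/L1predP/valP.
- by move=> x _; case: (\val _ _) => ? ?; rewrite lee_fin sqrtr_ge0.
- by move=> x _; case: (\val _ _) => ? ?; rewrite lee_fin sqrtr_ge0.
by apply: filterS (repr_L1class f) => x fx _; rewrite fx.
Qed.

Let L1norm_triangle (f g : L1) : L1norm (f + g) <= L1norm f + L1norm g.
Proof.
have cf (h : L1fun) : mu.-integrable setT (EFin \o (fun x => normc (\val h x))).
  exact/integrable_normc/L1predP/valP.
rewrite -(L1classK f) -(L1classK g) -L1classD !L1norm_class -rmorphD/=.
rewrite lecR -RintegralD//; [|exact: cf|exact: cf].
apply: le_Rintegral => //.
- exact: (cf (repr f + repr g)).
- exact: (integrableD measurableT (cf _) (cf _)).
- by move=> x _; exact: le_normcD.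
Qed.

Let L1normZ a (f : L1) : L1norm (a *: f) = `|a| * L1norm f.
Proof.
rewrite -(L1classK f) [X in L1norm X](_ : _ = L1class (a *: repr f)); last first.
  by rewrite L1classZ.
rewrite !L1norm_class normcE -rmorphM/=; congr (_%:C%C).
rewrite -RintegralZl//; last exact/integrable_normc/L1predP/valP.
by apply: eq_Rintegral => x _; exact: normcM.
Qed.

Let L1norm_eq0 (f : L1) : L1norm f = 0 -> f = 0.
Proof.
rewrite -(L1classK f) L1norm_class => -[].
set h := repr f => h0.
have ch : cintegrable (\val h) by exact/L1predP/valP.
have int0 : (\int[mu]_x `|(normc (\val h x))%:E| = 0)%E.
  rewrite (_ : 0%E = (\int[mu]_x normc (\val h x))%:E); last by rewrite h0.
  rewrite fineK; last exact: integrable_fin_num (integrable_normc ch).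
  apply: eq_integral => x _.
  by rewrite gee0_abs// lee_fin; case: (\val h x) => ? ?; rewrite sqrtr_ge0.
have mh := L1_measurable_normc ch.
rewrite -L1class0; apply/L1class_eq.
have /(ae_eq_integral_abs mu measurableT) := int0.
move=> /(_ ((measurable_EFinP _ _).2 mh)).
apply: filterS => x /(_ I) [] /eq0_normc hx _.
exact: hx.
Qed.

HB.instance Definition _ := @Lmodule_isNormed.Build R[i] L1 L1norm
  L1norm_triangle L1normZ L1norm_eq0.

Lemma cintegrable_norm (f : L1fun) :
  (fun x => `|\val f x| : R[i]^o) \in L1pred.
Proof.
have := integrable_normc (elimT (L1predP _) (valP f)).
move=> fn; apply/L1predP; split.
  by apply: eq_integrable fn => // x _; rewrite /= normcE.
by apply: eq_integrable (integrable0 _ _) => // x _; rewrite /= normcE.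
Qed.

Definition L1fun_abs (f : L1fun) : L1fun := mkL1fun (cintegrable_norm f).

Definition L1abs (f : L1) : L1 := L1class (L1fun_abs (repr f)).

Lemma L1abs_class (f : L1fun) : L1abs (L1class f) = L1class (L1fun_abs f).
Proof.
apply/L1class_eq; apply: filterS (repr_L1class f) => x /(_ I) fx _.
by rewrite /= -[sval _ x]/(\val _ x) fx.
Qed.

Lemma L1_normE (f : L1fun) :
  `|L1class f| = (\int[mu]_x normc (\val f x))%:C%C.
Proof. exact: L1norm_class. Qed.

End complex_integrable.

Arguments L1 {d X R} mu.
Arguments L1fun {d X R} mu.

Section constant_one.
Context {d : measure_display} {X : measurableType d} {R : realType}.
Variable P : probability X R.

Lemma cintegrable1 : (cst 1 : X -> R[i]^o) \in L1pred P.
Proof.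
apply/L1predP; split; exact: (@finite_measure_integrable_cst _ _ _ P).
Qed.

Definition L1one : L1 P := L1class (mkL1fun cintegrable1).

End constant_one.

Definition markov_isomorphism {R : realType}
    {d : measure_display} {Y : measurableType d} {Q : probability Y R}
    {d' : measure_display} {X : measurableType d'} {P : probability X R}
    (J : L1 Q -> L1 P) : Prop :=
  [/\ linear J, bijective J, (forall f, `|J f| = `|f|),
      (forall f, L1abs (J f) = J (L1abs f)) & J (L1one Q) = L1one P].

Definition finite_dimensional {K : fieldType} {E : lmodType K} (V : set E) :
    Prop :=
  exists (n : nat) (b : 'I_n -> E),
    V = [set \sum_(i < n) a i *: b i | a in [set: 'I_n -> K]].

(* [system] only holds data: a probability space and a family of maps on its
   complex L1 space, indexed by the group. What is required of them is
   [measure_preserving]. *)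
Record system (R : realType) (G : topologicalZmodType) := System {
  sys_display : measure_display;
  sys_space : measurableType sys_display;
  sys_prob : probability sys_space R;
  sys_op : G -> L1 sys_prob -> L1 sys_prob }.

Arguments sys_op {R G} X t f : rename.

Section systems.
Variables (R : realType) (G : topologicalZmodType).
Implicit Types (X Y : system R G) (chi : G -> R[i]^o).

Definition measure_preserving X : Prop :=
  [/\ (forall t, markov_isomorphism (sys_op X t)),
      (forall f, sys_op X 0 f = f),
      (forall s t f, sys_op X (s + t) f = sys_op X s (sys_op X t f))
    & (forall f, continuous (fun t => sys_op X t f))].

Definition ergodic X : Prop :=
  exists2 e : L1 (sys_prob X), e != 0 &
    [set f | forall t, sys_op X t f = f] = [set a *: e | a in [set: R[i]]].

Definition op_invariant X (V : set (L1 (sys_prob X))) : Prop :=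
  forall t f, V f -> V (sys_op X t f).

Arguments op_invariant : clear implicits.

Definition discrete_spectrum X : Prop :=
  dense (\bigcup_(V in [set V | finite_dimensional V /\ op_invariant X V]) V).

(* The dual group of [G], with pointwise multiplication; the unit circle is the
   set of complex numbers of norm 1. *)
Definition characters : set (G -> R[i]^o) :=
  [set chi : G -> R[i]^o |
    [/\ continuous chi, (forall s t, chi (s + t) = chi s * chi t)
      & forall t, `|chi t| = 1]].

Definition character_subgroup (sigma : set (G -> R[i]^o)) : Prop :=
  [/\ sigma `<=` characters, sigma (fun=> 1),
      (forall chi psi, sigma chi -> sigma psi ->
         sigma (fun t => chi t * psi t))
    & (forall chi, sigma chi -> sigma (fun t => (chi t)^-1))].

Definition point_spectrum X : set (G -> R[i]^o) :=
  [set chi : G -> R[i]^o | characters chi /\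
     exists2 f : L1 (sys_prob X), f != 0 &
       forall t, sys_op X t f = chi t *: f].

Definition isomorphic Y X : Prop :=
  exists2 J : L1 (sys_prob Y) -> L1 (sys_prob X), markov_isomorphism J &
    forall t f, J (sys_op Y t f) = sys_op X t (J f).

End systems.

(* Compactifications are not assumed commutative, hence multiplicative topological
   groups next to the additive [topologicalZmodType]. *)
HB.mixin Record isTopologicalGroup T & Topological T & Group T := {
  mulg_continuous : continuous (fun x : T * T => (x.1 * x.2)%g);
  invg_continuous : continuous (fun x : T => (x^-1)%g) }.

#[short(type="topologicalGroupType")]
HB.structure Definition TopologicalGroup :=
  {T of isTopologicalGroup T & Topological T & Group T}.

(* Measurable types are pointed types; the chosen point is the identity. *)
Definition group_pointed (H : topologicalGroupType) : Type := H.
HB.instance Definition _ (H : topologicalGroupType) :=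
  Choice.on (group_pointed H).
HB.instance Definition _ (H : topologicalGroupType) :=
  isPointed.Build (group_pointed H) (1%g : H).

Definition borel (H : topologicalGroupType) : Type :=
  g_sigma_algebraType (@open H : set (set (group_pointed H))).
HB.instance Definition _ (H : topologicalGroupType) :=
  Measurable.on (borel H).

Section translation.
Variables (R : realType) (H : topologicalGroupType).

(* Left-invariant regular Borel probability measure. The regularity conditions
   matter: without them uniqueness may fail for groups that are not metrizable. *)
Definition is_haar (m : probability (borel H) R) : Prop :=
  [/\ (forall (x : H) (A : set H), measurable (A : set (borel H)) ->
         m ((fun y => (x * y)%g) @` A) = m A),
      (forall A : set H, measurable (A : set (borel H)) ->
         m A = ereal_inf [set m U | U in [set U : set H | open U /\ A `<=` U]])
    & (forall A : set H, measurable (A : set (borel H)) ->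
         m A = ereal_sup
           [set m K | K in [set K : set H | compact K /\ K `<=` A]])].

Definition translation (x : H) (y : borel H) : borel H := (x^-1 * (y : H))%g.

Lemma measurable_translation x : measurable_fun setT (translation x).
Proof.
apply: (measurability (@open H : set (set (borel H)))) => //.
move=> _ [U oU <-]; rewrite setTI; apply: sub_sigma_algebra.
have /continuousP : continuous (fun y : H => (x^-1 * y)%g); last exact.
move=> y; apply: (@continuous_comp _ _ _ (fun y : H => (x^-1%g, y))
  (fun z : H * H => (z.1 * z.2)%g)); last exact: mulg_continuous.
by apply: cvg_pair => /=; [exact: cvg_cst|exact: cvg_id].
Qed.

Variables (m : probability (borel H) R) (hm : is_haar m).

Lemma haar_translation x (A : set (borel H)) : measurable A ->
  m (translation x @^-1` A) = m A.
Proof.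
move=> mA; case: hm => inv _ _; rewrite -(inv x A mA); congr (m _).
apply/seteqP; split=> [y Ay|_ [y Ay <-]].
  by exists (translation x y) => //; rewrite /translation mulVKg.
by rewrite /= /translation mulKg.
Qed.

Lemma integrable_translation x (g : borel H -> R) :
  m.-integrable setT (EFin \o g) ->
  m.-integrable setT (EFin \o (g \o translation x)).
Proof.
move=> /integrableP[mg ig]; have mt := @measurable_translation x.
apply/integrableP; split; first exact: (measurableT_comp mg mt).
move: ig; congr (_ < _)%E.
rewrite -(ge0_integral_pushforward mt m measurableT
  (f := fun y => `|(EFin \o g) y|%E))//.
- apply: eq_measure_integral => A mA _.
  exact: (esym (haar_translation x mA)).
- exact: measurableT_comp.
Qed.

Lemma L1pred_translation x (f : L1fun m) :
  (\val f \o translation x : borel H -> R[i]^o) \in L1pred m.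
Proof.
have /L1predP[fr fi] := valP f.
apply/L1predP; split; first exact: (integrable_translation x fr).
exact: (integrable_translation x fi).
Qed.

Definition L1fun_translation x (f : L1fun m) : L1fun m :=
  mkL1fun (L1pred_translation x f).

(* [f] is sent to the class of [y |-> f (x^-1 * y)]; see [L1translation_class]. *)
Definition L1translation x (f : L1 m) : L1 m :=
  L1class (L1fun_translation x (repr f)).

Lemma L1translation_class x (f : L1fun m) :
  L1translation x (L1class f) = L1class (L1fun_translation x f).
Proof.
apply/L1class_eq; have [A [mA A0 subA]] := repr_L1class f.
exists (translation x @^-1` A); split.
- by rewrite -[X in measurable X]setTI; exact: measurable_translation.
- exact: etrans (haar_translation _ mA) A0.
- move=> y ny; apply: subA => fy; apply: ny => _; exact: (fy I).
Qed.

End translation.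

Definition group_compactification {G : topologicalZmodType}
    (H : topologicalGroupType) (c : G -> H) : Prop :=
  [/\ compact [set: H], hausdorff_space H, continuous c,
      (forall s t, c (s + t) = (c s * c t)%g) & dense (range c)].

Definition rotation {R : realType} {G : topologicalZmodType}
    {H : topologicalGroupType} (c : G -> H) {m : probability (borel H) R}
    (hm : is_haar m) : system R G :=
  System (fun t => L1translation hm (c t)).

(* Main.v *)
Require Import Defs.
From HB Require Import structures.
From mathcomp Require Import all_boot all_order all_algebra.
From mathcomp Require Import complex.
From mathcomp Require Import all_classical all_reals all_analysis.
From mathcomp Require Import measurable_realfun ring lra.

Set Implicit Arguments.
Unset Strict Implicit.
Unset Printing Implicit Defensive.

Import Order.TTheory GRing.Theory Num.Theory.
Import numFieldNormedType.Exports.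
Import ComplexField.Normc.

Local Open Scope classical_set_scope.
Local Open Scope ring_scope.

(** The complete invariant of an ergodic system with discrete spectrum is its point
    spectrum, because the system can be rebuilt from it by Fourier analysis.

    An eigenfunction of an ergodic system has constant modulus, so it may be taken
    unimodular, and it is determined by its character up to a constant of modulus 1.
    Products and conjugates of eigenfunctions are eigenfunctions, since Markov
    isomorphisms turn out to be multiplicative ([markov_mul]); hence the point
    spectrum is a group. The constants can be fixed so that the eigenfunction of a
    product of characters is the product of their eigenfunctions: a limit
    along an ultrafilter finer than the almost everywhere filter replaces the
    evaluation at a point, and each eigenfunction is normalized to have limit 1
    ([multiplicative_eigenfunctions]).

    A linear combination of the chosen eigenfunctions then behaves like a
    trigonometric polynomial. Only the trivial character has an integral
    different from 0, so integrals of polynomials depend on coefficients only. The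
    modulus is a uniform limit of polynomial expressions in [p] and its conjugate,
    obtained by iterating towards the square root of [|p|^2]; so the L1 norm depends
    on coefficients only as well ([nrm_trig_cls]). For two systems with the same
    point spectrum, matching the polynomials is therefore an isometry that commutes
    with moduli and with the actions, and it extends to the closures
    ([unit_rep_isomorphism]). The closures are everything under discrete spectrum:
    an invariant subspace of finite dimension is spanned by common eigenvectors,
    isometries having no Jordan blocks ([finite_dimensional_eigen]). Conversely,
    an isomorphism transports eigenfunctions.

    For a group [sigma] of characters, let [H] be the closure of the image of [G]
    in the product of circles indexed by [sigma], with its Haar measure. The measure is
    the limit, along an ultrafilter of shrinking neighbourhoods of the identity, of
    ratios of covering numbers, extended from compact sets by the theorem of
    Caratheodory ([haar_measure_exists]). The conjugate coordinates of [H] are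
    eigenfunctions of the rotation for the characters in [sigma]; they separate
    points, and their combinations are dense in L1 ([trig_dense_haar]). Averaging
    removes from an approximation of an eigenfunction the terms of all other
    characters ([eigen_approximation]), which shows that the rotation is ergodic with
    point spectrum exactly [sigma]. Applied to the point spectrum of a given system,
    this rotation is isomorphic to it by the first part. *)

(** * Moduli and real-valued norms *)

Section complex_modulus.
Context {R : realType}.
Implicit Types z w : R[i].

Lemma normc_ge0 z : 0 <= normc z.
Proof. by case: z => a b; exact: sqrtr_ge0. Qed.

Lemma normr_normc z : `|z| = (normc z)%:C%C.
Proof. by case: z. Qed.

Lemma sqr_normcE z : normc z ^+ 2 = complex.Re z ^+ 2 + complex.Im z ^+ 2.
Proof. by case: z => a b /=; rewrite sqr_sqrtr// addr_ge0 ?sqr_ge0. Qed.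

Lemma normc_real (x : R) : normc x%:C%C = `|x|.
Proof. by rewrite /= expr0n addr0 sqrtr_sqr. Qed.

Lemma ge_Re_normc z : `|complex.Re z| <= normc z.
Proof.
rewrite -(@ler_pXn2r _ 2) ?nnegrE ?normc_ge0// sqr_normcE real_normK ?num_real//.
by rewrite lerDl sqr_ge0.
Qed.

Lemma ge_Im_normc z : `|complex.Im z| <= normc z.
Proof.
rewrite -(@ler_pXn2r _ 2) ?nnegrE ?normc_ge0// sqr_normcE real_normK ?num_real//.
by rewrite lerDr sqr_ge0.
Qed.

Lemma mul_conjc z : z * (z^*)%C = (normc z ^+ 2)%:C%C.
Proof. by rewrite -sqr_normc normr_normc rmorphXn. Qed.

Lemma normc_conj z : normc (z^*)%C = normc z.
Proof. by case: z => a b /=; rewrite sqrrN. Qed.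

Lemma unit_conjcV z : normc z = 1 -> (z^*)%C = z^-1.
Proof.
move=> z1; have z0 : z != 0 by apply: contra_eq_neq z1 => ->; rewrite normc0 eq_sym oner_eq0.
by apply: (mulfI z0); rewrite mul_conjc z1 expr1n mulfV.
Qed.

Lemma gt0_complexE (e : R[i]) : 0 < e -> exists2 r : R, 0 < r & e = r%:C%C.
Proof.
by case: e => a b; rewrite ltcE /= => /andP[/eqP -> a0]; exists a.
Qed.

End complex_modulus.

(** Real-valued version of the norm of a normed module over the complex
    numbers, which lets order arguments take place in [R]. *)
Definition nrm {R : realType} {V : normedModType R[i]} (v : V) : R :=
  complex.Re `|v|.

Section real_valued_norm.
Context {R : realType} {V : normedModType R[i]}.
Implicit Types u v w : V.

Lemma normr_nrm v : `|v| = (nrm v)%:C%C.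
Proof. by rewrite /nrm RRe_real// normr_real. Qed.

Lemma nrm_ge0 v : 0 <= nrm v.
Proof. by rewrite -ler0c -normr_nrm normr_ge0. Qed.

Lemma nrm0 : nrm (0 : V) = 0.
Proof. by rewrite /nrm normr0. Qed.

Lemma nrm_eq0 v : nrm v = 0 -> v = 0.
Proof. by move=> v0; apply/normr0_eq0; rewrite normr_nrm v0. Qed.

Lemma nrmD u v : nrm (u + v) <= nrm u + nrm v.
Proof. by rewrite -lecR rmorphD/= -!normr_nrm ler_normD. Qed.

Lemma nrmN v : nrm (- v) = nrm v.
Proof. by rewrite /nrm normrN. Qed.

Lemma nrmBC u v : nrm (u - v) = nrm (v - u).
Proof. by rewrite /nrm distrC. Qed.

Lemma nrm_triangle w u v : nrm (u - v) <= nrm (u - w) + nrm (w - v).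
Proof. by rewrite (le_trans _ (nrmD _ _))// addrA subrK. Qed.

Lemma nrmZ (a : R[i]) v : nrm (a *: v) = normc a * nrm v.
Proof. by apply: complexI; rewrite rmorphM/= -!normr_nrm normrZ normr_normc. Qed.

Lemma nrm_le_eps u v : (forall e : R, 0 < e -> nrm (u - v) <= e) -> u = v.
Proof.
move=> uv; apply/eqP; rewrite -subr_eq0; apply/eqP/nrm_eq0/le_anti.
by rewrite nrm_ge0 andbT; apply/ler_addgt0Pl => e e0; rewrite addr0 uv.
Qed.

Lemma nrm_sum I (r : seq I) (f : I -> V) :
  nrm (\sum_(i <- r) f i) <= \sum_(i <- r) nrm (f i).
Proof.
elim: r => [|i r ih]; first by rewrite !big_nil nrm0.
by rewrite !big_cons (le_trans (nrmD _ _))// lerD2l.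
Qed.

Lemma cvg_nrmP {T : Type} {F : set_system T} {FF : Filter F} (f : T -> V) v :
  (f @ F --> v) <-> forall e : R, 0 < e -> \forall x \near F, nrm (v - f x) < e.
Proof.
split=> [/cvgrPdist_lt fv e e0|fv].
  have /fv : 0 < e%:C%C by rewrite ltcR.
  by apply: filterS => x; rewrite normr_nrm ltcR.
apply/cvgrPdist_lt => _ /gt0_complexE[e e0 ->].
by apply: filterS (fv _ e0) => x; rewrite normr_nrm ltcR.
Qed.

Lemma dense_nrmP (S : set V) :
  dense S <-> forall v (e : R), 0 < e -> exists2 s, S s & nrm (v - s) < e.
Proof.
split=> [dS v e e0|dS O [v Ov] oO].
- have [||s [vs Ss]] := dS (ball v e%:C%C).
  + by exists v; apply: ballxx; rewrite ltcR.
  + by apply: ball_open; rewrite ltcR.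
  + by exists s => //; move: vs; rewrite -ball_normE /ball_/= normr_nrm ltcR.
- have /nbhs_ballP[_ /= /gt0_complexE[e e0 ->] veO] := open_nbhs_nbhs (conj oO Ov).
  have [s Ss vs] := dS v e e0; exists s; split => //; apply: veO.
  by rewrite -ball_normE /ball_/= normr_nrm ltcR.
Qed.

End real_valued_norm.

(** * Isometric representations of finite dimension *)

Section finite_dimensional_representation.
Context {R : realType} {V : normedModType R[i]} {G : zmodType}.
Variable T : G -> V -> V.
Hypothesis T_linear : forall t, linear (T t).
Hypothesis T0 : forall f, T 0 f = f.
Hypothesis TD : forall s t f, T (s + t) f = T s (T t f).
Hypothesis T_nrm : forall t f, nrm (T t f) = nrm f.

Definition lincomb n (b : 'I_n -> V) (a : 'rV[R[i]]_n) : V :=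
  \sum_(i < n) a 0 i *: b i.

Lemma lincomb_linear n (b : 'I_n -> V) k u v :
  lincomb b (k *: u + v) = k *: lincomb b u + lincomb b v.
Proof.
rewrite /lincomb scaler_sumr -big_split; apply: eq_bigr => i _.
by rewrite !mxE scalerDl scalerA.
Qed.

Lemma lincomb0 n (b : 'I_n -> V) : lincomb b 0 = 0.
Proof. by rewrite /lincomb big1// => i _; rewrite mxE scale0r. Qed.

Lemma lincombZ n (b : 'I_n -> V) k u : lincomb b (k *: u) = k *: lincomb b u.
Proof. by rewrite -[k *: u]addr0 lincomb_linear lincomb0 addr0. Qed.

Lemma lincomb_sum n (b : 'I_n -> V) I (r : seq I) (F : I -> 'rV_n) :
  lincomb b (\sum_(i <- r) F i) = \sum_(i <- r) lincomb b (F i).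
Proof.
elim: r => [|i r ih]; first by rewrite !big_nil lincomb0.
by rewrite !big_cons -ih -{1}[F i]scale1r lincomb_linear scale1r.
Qed.

Lemma finite_dimensional_basis (W : set V) : finite_dimensional W ->
  exists n (b : 'I_n -> V), W = range (lincomb b) /\
    forall a, lincomb b a = 0 -> a = 0.
Proof.
move=> [n [b ->]].
have -> : [set \sum_(i < n) a i *: b i | a in [set: 'I_n -> R[i]]] =
    range (lincomb b).
  apply/seteqP; split => [_ [a _ <-]|_ [a _ <-]]; last by exists (a 0).
  by exists (\row_i a i) => //; apply: eq_bigr => i _; rewrite mxE.
elim: n b => [|n ih] b.
  by exists 0%N, b; split => // a _; rewrite [a]thinmx0.
have [binj|] := pselect (forall a, lincomb b a = 0 -> a = 0).
  by exists n.+1, b.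
move=> /existsNP[a /not_implyP[ba a0]].
have [k ak] : exists k, a 0 k != 0.
  apply: contra_notP a0 => /forallNP ak; apply/rowP => k; rewrite mxE.
  by apply/eqP/negPn/negP; exact: ak.
have -> : range (lincomb b) = range (lincomb (b \o lift k)).
  apply/seteqP; split => [_ [c _ <-]|_ [d _ <-]].
    pose c' := c - (c 0 k / a 0 k) *: a.
    have -> : lincomb b c = lincomb b c'.
      by rewrite /c' addrC -scaleNr lincomb_linear ba scaler0 add0r.
    exists (\row_i c' 0 (lift k i)) => //.
    rewrite [RHS]/lincomb (bigD1_ord k)//= {1}/c' !mxE divfK// subrr scale0r add0r.
    by apply: eq_bigr => i _; rewrite !mxE.
  exists (\row_i (if unlift k i is Some j then d 0 j else 0)) => //.
  rewrite /lincomb (bigD1_ord k)//= !mxE unlift_none scale0r add0r.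
  by apply: eq_bigr => i _; rewrite mxE liftK.
exact: ih.
Qed.

(** An isometry has no Jordan block: in [T^n f = a^n (f + n g)] the right-hand
    side is unbounded unless [g = 0]. *)
Lemma isometry_no_jordan (t : G) (a : R[i]) (f g : V) :
  T t f = a *: (f + g) -> T t g = a *: g -> g = 0.
Proof.
move=> Tf Tg; have [->//|g0] := eqVneq g 0; apply: nrm_eq0.
have ng : nrm g != 0 by apply: contra_neq g0 => /nrm_eq0.
have a1 : normc a = 1.
  by apply: (mulIf ng); rewrite -nrmZ -Tg T_nrm mul1r.
have Tn n : T (t *+ n) f = a ^+ n *: (f + n%:R *: g).
  elim: n => [|n ih]; first by rewrite mulr0n T0 expr0 scale1r scale0r addr0.
  have TZ k u v : T t (k *: (u + v)) = k *: (T t u + T t v).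
    have T00 : T t 0 = 0 by apply: nrm_eq0; rewrite T_nrm nrm0.
    have -> : k *: (u + v) = k *: (u + v) + 0 by rewrite addr0.
    rewrite T_linear T00 addr0; congr (_ *: _).
    by rewrite -{1}[u]scale1r T_linear scale1r.
  have TgZ (k : R[i]) : T t (k *: g) = k *: (a *: g).
    have T00 : T t 0 = 0 by apply: nrm_eq0; rewrite T_nrm nrm0.
    by rewrite -[k *: g]addr0 T_linear T00 addr0 Tg.
  rewrite mulrS TD ih TZ Tf TgZ [n%:R *: (_ *: _)]scalerA mulrC -scalerA -scalerDr.
  rewrite scalerA -exprSr -addrA; congr (_ *: (_ + _)).
  by rewrite -{1}[g]scale1r -scalerDl -natr1 addrC.
have bnd n : n%:R * nrm g <= 2 * nrm f.
  have -> : n%:R * nrm g = nrm ((f + n%:R *: g) - f).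
    rewrite addrAC subrr add0r nrmZ; congr (_ * _).
    by rewrite -[n%:R in RHS](rmorph_nat (real_complex R)) normc_real normr_nat.
  rewrite (le_trans (nrmD _ _))// nrmN mulr_natl mulr2n lerD2r.
  rewrite -[leRHS](T_nrm (t *+ n)) Tn nrmZ.
  suff -> : normc (a ^+ n) = 1 by rewrite mul1r.
  elim: n {Tn} => [|n ih]; first by rewrite expr0 normc1.
  by rewrite exprS normcM ih a1 mulr1.
have gp : 0 < nrm g by rewrite lt_neqAle eq_sym ng nrm_ge0.
have := bnd (Num.truncn (2 * nrm f / nrm g)).+1.
by rewrite -ler_pdivlMr// leNgt truncnS_gt.
Qed.

(** Without Jordan blocks a root of the minimal polynomial can be made simple, so
    the product over the distinct roots already annihilates the matrix. *)
Lemma diagonalizable_isometry n (b : 'I_n.+1 -> V) (A : 'M[R[i]]_n.+1) t :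
  (forall a, lincomb b a = 0 -> a = 0) ->
  (forall a, lincomb b (a *m A) = T t (lincomb b a)) ->
  diagonalizable A.
Proof.
move=> binj bA.
have jordan (v : 'rV_n.+1) (a : R[i]) :
    v *m (A - a%:M) *m (A - a%:M) = 0 -> v *m (A - a%:M) = 0.
  set w := v *m _ => wA.
  have wa : w *m A = a *: w.
    by apply/eqP; rewrite -subr_eq0 -mul_mx_scalar -mulmxBr wA.
  have va : v *m A = a *: v + w.
    by rewrite /w mulmxBr mul_mx_scalar addrC subrK.
  apply: binj; have [a0|a0] := eqVneq a 0.
    apply: nrm_eq0; rewrite -(T_nrm t) -bA wa a0 scale0r lincomb0 nrm0//.
  have : a^-1 *: lincomb b w = 0.
    apply: (@isometry_no_jordan t a (lincomb b v)).
      rewrite -bA va -[v in LHS]scale1r scalerA mulr1 lincomb_linear.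
      by rewrite scalerDr scalerA mulfV// scale1r.
    by rewrite -lincombZ -bA -scalemxAl wa !lincombZ !scalerA mulVf// mulfV.
  by move/eqP; rewrite scaler_eq0 invr_eq0 (negPf a0) /= => /eqP.
pose Z (s : seq R[i]) := horner_mx A (\prod_(z <- s) ('X - z%:P)).
have Zc a s : Z (a :: s) = Z s *m (A - a%:M).
  rewrite /Z big_cons mulrC rmorphM/= rmorphB/= horner_mx_X horner_mx_C.
  by rewrite mulmxE.
have Zperm s1 s2 : perm_eq s1 s2 -> Z s1 = Z s2.
  by move=> s12; rewrite /Z (perm_big _ s12).
(* One of two equal factors can be dropped from a product that vanishes. *)
have Zdrop a s : a \in s -> Z (a :: s) = 0 -> Z s = 0.
  move=> /perm_to_rem srem; rewrite (Zperm _ _ srem).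
  have /Zperm -> : perm_eq (a :: s) [:: a, a & rem a s] by rewrite perm_cons.
  rewrite !Zc => Z0; apply/row_matrixP => i; rewrite row_mul row0; apply: jordan.
  by rewrite -!row_mul Z0 row0.
have Zundup r s : Z (r ++ s) = 0 -> Z (undup r ++ s) = 0.
  elim: r s => [//|a r ih] s Z0.
  have : Z (r ++ a :: s) = 0.
    by rewrite -Z0; apply: Zperm; rewrite perm_catC /= perm_cons perm_catC.
  move/ih; rewrite (Zperm _ (a :: undup r ++ s)); last first.
    by rewrite perm_catC /= perm_cons perm_catC.
  rewrite /=; case: ifPn => // ar; apply: Zdrop.
  by rewrite mem_cat mem_undup ar.
apply/diagonalizableP.
have [r pr] := closed_field_poly_normal (mxminpoly A).
exists (undup r); rewrite ?undup_uniq//.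
apply: mxminpoly_min; rewrite -[undup r]cats0; apply: (Zundup r); rewrite cats0.
have := mx_root_minpoly A; rewrite pr (monicP (mxminpoly_monic A)) scale1r.
by [].
Qed.

(** Commuting diagonalizable matrices have a common eigenbasis. As the group may
    be infinite, this is applied to finitely many matrices that span all of them. *)
Lemma finite_dimensional_eigen (W : set V) f :
  finite_dimensional W -> (forall t g, W g -> W (T t g)) -> W f ->
  exists n (e : 'I_n -> V), f = \sum_(i < n) e i /\
    forall i t, exists c : R[i], T t (e i) = c *: e i.
Proof.
move=> /finite_dimensional_basis[[|n] [b [-> binj]]] Winv [v _ <-].
  exists 0%N, b; split => [|[]//]; rewrite big_ord0 (_ : v = 0) ?lincomb0//.
  by rewrite [v]thinmx0.
have T00 t : T t 0 = 0 by apply: nrm_eq0; rewrite T_nrm nrm0.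
have bd i : lincomb b (delta_mx 0 i) = b i.
  rewrite /lincomb (bigD1 i)//= mxE !eqxx scale1r big1 ?addr0// => j ji.
  by rewrite mxE eqxx (negPf ji) scale0r.
have /choice[rr rrP] (p : G * 'I_n.+1) :
    exists r, T p.1 (b p.2) = lincomb b r.
  have : range (lincomb b) (b p.2) by exists (delta_mx 0 p.2).
  by move/(Winv p.1) => [r _ <-]; exists r.
pose M t : 'M[R[i]]_n.+1 := \matrix_i rr (t, i).
have Tsum t m (F : 'I_m -> V) c :
    T t (\sum_(i < m) c i *: F i) = \sum_(i < m) c i *: T t (F i).
  elim: m F c => [|m ih] F c; first by rewrite !big_ord0 T00.
  by rewrite !big_ord_recl T_linear ih.
have bM t a : lincomb b (a *m M t) = T t (lincomb b a).
  rewrite mulmx_sum_row lincomb_sum Tsum; apply: eq_bigr => i _.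
  by rewrite lincombZ rowK -rrP.
have binj2 u w : lincomb b u = lincomb b w -> u = w.
  move=> uw; apply/eqP; rewrite -subr_eq0; apply/eqP/binj.
  by rewrite addrC -scaleN1r lincomb_linear uw scaleN1r addNr.
have Mcomm s t : M s *m M t = M t *m M s.
  apply/row_matrixP => i; apply: binj2; rewrite !row_mul !bM !rowE !bM -!TD.
  by rewrite addrC.
pose P k := `[< exists ts : seq G, \dim <<map M ts>>%VS = k >].
(* A finite family of operators whose span has the largest possible dimension. *)
have [k /asboolP[ts tsk] kmax] : exists2 k, P k & forall j, P j -> (j <= k)%N.
  have P0 : exists i, P i by exists (\dim <<map M [::]>>%VS); apply/asboolP; exists [::].
  have Pb i : P i -> (i <= \dim {:'M[R[i]]_n.+1})%N.
    by move=> /asboolP[ts <-]; exact/dimvS/subvf.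
  by case: (ex_maxnP P0 Pb) => k ? ?; exists k.
have Mspan t : M t \in <<map M ts>>%VS.
  have /kmax : P (\dim <<map M (t :: ts)>>%VS) by apply/asboolP; exists (t :: ts).
  rewrite -tsk /= span_cons => le.
  have sub := addvSr <[M t]> <<map M ts>>.
  rewrite (geq_leqif (dimv_leqif_sup sub)) in le.
  by rewrite memvE (subv_trans (addvSl _ _) le).
have [Q Qunit /allP Qdiag] : codiagonalizable (map M ts).
  apply/codiagonalizableP; split=> [_ _ /mapP[s _ ->] /mapP[t _ ->]|_ /mapP[t _ ->]].
    exact: Mcomm.
  exact: (diagonalizable_isometry binj (bM t)).
have eig t i : exists c, row i Q *m M t = c *: row i Q.
  have /coord_span -> : M t \in <<in_tuple (map M ts)>>%VS by exact: Mspan.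
  rewrite mulmx_sumr.
  have /choice[c cP] (j : 'I_(size (map M ts))) :
      exists c, row i Q *m (in_tuple (map M ts))`_j = c *: row i Q.
    have : (map M ts)`_j \in map M ts by rewrite mem_nth.
    move=> /Qdiag /(diagonalizable_forLR Qunit)[d ->].
    exists (d 0 i); rewrite mxpoly.conjVmx// -row_mul !mulmxA mulmxV// mul1mx.
    by rewrite row_mul row_diag_mx -scalemxAl -rowE.
  exists (\sum_j coord (in_tuple (map M ts)) j (M t) * c j).
  rewrite scaler_suml; apply: eq_bigr => j _.
  by rewrite -scalemxAr cP scalerA.
pose a := v *m invmx Q.
exists n.+1, (fun i => lincomb b (a 0 i *: row i Q)); split.
  rewrite -lincomb_sum; congr lincomb.
  by rewrite -mulmx_sum_row mulmxKV.
move=> i t; have [c cP] := eig t i; exists c.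
by rewrite -bM -scalemxAl cP -lincombZ !scalerA mulrC.
Qed.

End finite_dimensional_representation.

(** * Completeness of real L1 *)

Section real_L1_completeness.
Context {d : measure_display} {X : measurableType d} {R : realType}.
Variable mu : {measure set X -> \bar R}.
Local Notation integrable u := (mu.-integrable setT (EFin \o u)).

Lemma measurable_realintegrable (u : X -> R) : integrable u -> measurable_fun setT u.
Proof. by move=> /measurable_int/measurable_EFinP. Qed.

Lemma EFin_Rintegral (u : X -> R) : integrable u ->
  (\int[mu]_x u x)%:E = (\int[mu]_x (u x)%:E)%E.
Proof. by move=> iu; rewrite /Rintegral fineK// integrable_fin_num. Qed.

(** Riesz-Fischer for a fast Cauchy sequence: the series of the absolute
    increments has finite integral, hence is finite almost everywhere and
    dominates the sequence. *)
Lemma real_L1_complete (u : nat -> X -> R) :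
  (forall n, integrable (u n)) ->
  (forall n, \int[mu]_x `|u n.+1 x - u n x| <= 1 / (2 ^ n.+1)%:R) ->
  exists2 w, integrable w & (fun n => \int[mu]_x `|u n x - w x|) @ \oo --> (0 : R).
Proof.
move=> iu uCauchy; have mu_ n := measurable_realintegrable (iu n).
have idu n : integrable (fun x => `|u n.+1 x - u n x|).
  exact: integrable_norm (integrableB measurableT (iu n.+1) (iu n)).
pose g (x : X) : \bar R := (\sum_(0 <= k <oo) `|u k.+1 x - u k x|%:E)%E.
have g0 x : (0 <= g x)%E by apply: nneseries_ge0 => k _ _; rewrite lee_fin.
have mg : measurable_fun setT g.
  apply: ge0_emeasurable_sum => // k _.
  exact: measurable_int (idu k).
have ig : mu.-integrable setT g.
  apply/integrableP; split => //.
  under eq_integral do rewrite gee0_abs//.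
  rewrite integral_nneseries//; last first.
    by move=> n; exact: measurable_int (idu n).
  apply: (@le_lt_trans _ _ 1%:E); last exact: ltry.
  have <- : (\sum_(0 <= k <oo) (1 / (2 ^ k.+1)%:R : R)%:E)%E = 1%:E.
    have := @cvg_geometric_eseries_half R 1 0; rewrite expr0 divr1 => h.
    rewrite (_ : eseries _ = fun n =>
        (\sum_(0 <= k < n) (1 / (2 ^ k.+1)%:R)%:E)%E) in h; first exact: cvg_lim h.
    by apply/funext => n; apply: eq_bigr => k _; rewrite addn1.
  apply: lee_nneseries => [n _ _|n _]; first exact: integral_ge0.
  by rewrite -EFin_Rintegral// lee_fin.
pose G x := (`|u 0%N x|%:E + g x)%E.
have iG : mu.-integrable setT G.
  exact: (integrableD measurableT (integrable_norm (iu 0%N)) ig).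
have uG x n : (`|u n x|%:E <= G x)%E.
  rewrite (eq_sum_telescope (u ^~ x)) /G.
  apply: (@le_trans _ _ (`|u 0%N x| + \sum_(0 <= k < n) `|u k.+1 x - u k x|)%:E).
    by rewrite lee_fin (le_trans (ler_normD _ _))// lerD2l ler_norm_sum.
  rewrite EFinD leeD2l// -sumEFin.
  by apply: nneseries_lim_ge => k _ _; rewrite lee_fin.
have ucvg : {ae mu, forall x, setT x -> cvgn (u ^~ x)}.
  apply: filterS (integrable_ae measurableT ig) => x /(_ I) gfin _.
  rewrite (_ : u ^~ x = cst (u 0%N x) \+ series (telescope (u ^~ x))); last first.
    by apply/funext => n; rewrite {1}(eq_sum_telescope (u ^~ x)).
  apply: is_cvgD; first exact: is_cvg_cst.
  apply: normed_cvg; apply: nondecreasing_is_cvgn.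
    by apply: nondecreasing_series => n _ _; exact: normr_ge0.
  exists (fine (g x)) => _ [n _ <-].
  rewrite -lee_fin fineK// /= -sumEFin.
  by apply: nneseries_lim_ge => k _ _; rewrite lee_fin.
pose w0 x := limn_esup (fun n => (u n x)%:E).
have mw0 : measurable_fun setT w0.
  by apply: measurable_fun_limn_esup => n; exact: measurable_int (iu n).
have mw : measurable_fun setT (EFin \o (fine \o w0)).
  by apply/measurable_EFinP; apply: measurableT_comp.
have uw : {ae mu, forall x, setT x -> (EFin \o u n) x @[n --> \oo] --> (EFin \o (fine \o w0)) x}.
  apply: filterS ucvg => x /(_ I) cu _ /=.
  have cE : (fun n => (u n x)%:E) @ \oo --> (limn (u ^~ x))%:E.
    by apply: cvg_EFin; [exact: nearW|exact: cu].
  have -> : w0 x = (limn (u ^~ x))%:E.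
    rewrite /w0 is_cvg_limn_esupE; last by apply/cvg_ex; eexists; exact: cE.
    exact/cvg_lim.
  exact: cE.
have [iw cw _] := dominated_convergence measurableT (fun n => measurable_int _ (iu n))
  mw uw iG (aeW _ (fun x n _ => uG x n)).
exists (fine \o w0) => //.
exact: fine_cvg.
Qed.

End real_L1_completeness.

(** * Classes of complex integrable functions *)

Section L1_classes.
Context {d : measure_display} {X : measurableType d} {R : realType}.
Variable P : probability X R.
Implicit Types f g : X -> R[i]^o.
Local Notation cint f := (cintegrable P f).

Definition cmeasurable f : Prop :=
  measurable_fun setT (@complex.Re R \o f) /\
  measurable_fun setT (@complex.Im R \o f).

(** Class of a function, extended by [0] to the non-integrable ones so that
    functions need not be paired with integrability proofs. *)
Definition cls f : L1 P :=
  if pselect (f \in L1pred P) is left fP then L1class (mkL1fun fP) else 0.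

Lemma clsE f (fP : f \in L1pred P) : cls f = L1class (mkL1fun fP).
Proof.
rewrite /cls; case: pselect => // fP'.
by congr L1class; apply/val_inj.
Qed.

Lemma cls_surj (F : L1 P) : exists2 f, cint f & F = cls f.
Proof.
exists (\val (repr F)); first exact/L1predP/valP.
rewrite -[LHS]L1classK (clsE (valP (repr F))).
by congr L1class; apply/val_inj.
Qed.

Lemma cls_eqP f g : cint f -> cint g ->
  (cls f = cls g <-> {ae P, forall x, f x = g x}).
Proof.
move=> /L1predP fP /L1predP gP; rewrite (clsE fP) (clsE gP) L1class_eq.
split; first by apply: filterS => x /(_ I).
by apply: filterS => x + _.
Qed.

Lemma cint_meas f : cint f -> cmeasurable f.
Proof.
by move=> [fr fi]; split; apply/measurable_EFinP;
  [exact: measurable_int fr|exact: measurable_int fi].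
Qed.

Lemma cintD f g : cint f -> cint g -> cint (fun x => f x + g x).
Proof.
move=> /L1predP fP /L1predP gP; apply/L1predP.
exact: (@rpredD _ (L1pred P) f g).
Qed.

Lemma cintZ (a : R[i]) f : cint f -> cint (fun x => a * f x).
Proof. by move=> /L1predP fP; apply/L1predP; exact: (@rpredZ _ _ (L1pred P) a f). Qed.

Lemma clsD f g : cint f -> cint g -> cls (fun x => f x + g x) = cls f + cls g.
Proof.
move=> cf cg; have /L1predP h := cintD cf cg.
move: cf cg => /L1predP fP /L1predP gP.
rewrite (clsE h) (clsE fP) (clsE gP) -L1classD.
by congr L1class; apply/val_inj.
Qed.

Lemma clsZ (a : R[i]) f : cint f -> cls (fun x => a * f x) = a *: cls f.
Proof.
move=> cf; have /L1predP h := cintZ a cf.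
move: cf => /L1predP fP; rewrite (clsE h) (clsE fP).
by rewrite -[RHS]L1classZ; congr L1class; apply/val_inj.
Qed.

Lemma cint_abs f : cint f -> cint (fun x => `|f x| : R[i]^o).
Proof.
by move=> /L1predP fP; apply/L1predP; exact: (cintegrable_norm (mkL1fun fP)).
Qed.

Lemma L1abs_cls f : cint f -> L1abs (cls f) = cls (fun x => `|f x| : R[i]^o).
Proof.
move=> cf; have /L1predP h := cint_abs cf; move: cf => /L1predP fP.
by rewrite (clsE fP) L1abs_class (clsE h); congr L1class; apply/val_inj.
Qed.

Lemma nrm_cls f : cint f -> nrm (cls f) = \int[P]_x normc (f x).
Proof. by move=> /L1predP fP; rewrite (clsE fP) /nrm L1_normE. Qed.

Lemma L1one_cls : L1one P = cls (cst 1).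
Proof. by rewrite (clsE (cintegrable1 P)). Qed.

Lemma cint_cst (a : R[i]) : cint (cst a).
Proof. by split; exact: finite_measure_integrable_cst. Qed.

Lemma cls_cst (a : R[i]) : cls (cst a) = a *: L1one P.
Proof.
rewrite L1one_cls -clsZ; last exact: cint_cst.
by congr cls; apply/funext => x /=; rewrite mulr1.
Qed.

Lemma cintB f g : cint f -> cint g -> cint (fun x => f x - g x).
Proof.
move=> cf cg; under eq_fun do rewrite -mulN1r.
exact: (cintD cf (cintZ _ cg)).
Qed.

Lemma clsB f g : cint f -> cint g -> cls (fun x => f x - g x) = cls f - cls g.
Proof.
move=> cf cg; under eq_fun do rewrite -mulN1r.
by rewrite (clsD cf (cintZ (-1) cg)) clsZ// scaleN1r.
Qed.

Lemma cint_sum I (r : seq I) (F : I -> X -> R[i]^o) :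
  (forall i, cint (F i)) -> cint (fun x => \sum_(i <- r) F i x).
Proof.
move=> cF; elim: r => [|i r ih].
  by under eq_fun do rewrite big_nil; exact: cint_cst.
by under eq_fun do rewrite big_cons; exact: cintD.
Qed.

Lemma cls_sum I (r : seq I) (F : I -> X -> R[i]^o) : (forall i, cint (F i)) ->
  cls (fun x => \sum_(i <- r) F i x) = \sum_(i <- r) cls (F i).
Proof.
move=> cF; elim: r => [|i r ih].
  under eq_fun do rewrite big_nil.
  by rewrite big_nil (cls_cst 0) scale0r.
under eq_fun do rewrite big_cons.
by rewrite big_cons clsD ?ih//; exact: cint_sum.
Qed.

Lemma cmeasurable_normc f : cmeasurable f -> measurable_fun setT (fun x => normc (f x)).
Proof. by move=> [mr mi]; exact: measurable_normc. Qed.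

Lemma cmeasurableD f g : cmeasurable f -> cmeasurable g ->
  cmeasurable (fun x => f x + g x).
Proof.
move=> [fr fi] [gr gi]; split.
  rewrite (_ : _ \o _ = (@complex.Re R \o f) \+ (@complex.Re R \o g)).
    exact: measurable_funD.
  by apply/funext => x /=; case: (f x) (g x) => [? ?] [? ?].
rewrite (_ : _ \o _ = (@complex.Im R \o f) \+ (@complex.Im R \o g)).
  exact: measurable_funD.
by apply/funext => x /=; case: (f x) (g x) => [? ?] [? ?].
Qed.

Lemma cmeasurableM f g : cmeasurable f -> cmeasurable g ->
  cmeasurable (fun x => f x * g x).
Proof.
move=> [fr fi] [gr gi]; split.
  rewrite (_ : _ \o _ = ((@complex.Re R \o f) \* (@complex.Re R \o g)) \-
      ((@complex.Im R \o f) \* (@complex.Im R \o g))).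
    by apply: measurable_funB; exact: measurable_funM.
  by apply/funext => x /=; case: (f x) (g x) => [? ?] [? ?].
rewrite (_ : _ \o _ = ((@complex.Re R \o f) \* (@complex.Im R \o g)) \+
    ((@complex.Im R \o f) \* (@complex.Re R \o g))).
  by apply: measurable_funD; exact: measurable_funM.
by apply/funext => x /=; case: (f x) (g x) => [? ?] [? ?].
Qed.

Lemma cmeasurable_conj f : cmeasurable f -> cmeasurable (fun x => ((f x)^*)%C).
Proof.
move=> [fr fi]; split.
  by rewrite (_ : _ \o _ = @complex.Re R \o f)//; apply/funext => x /=; case: (f x).
rewrite (_ : _ \o _ = \- (@complex.Im R \o f)); first exact: (measurable_funN fi).
by apply/funext => x /=; case: (f x).
Qed.

Lemma cmeasurable_real (u : X -> R) : measurable_fun setT u ->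
  cmeasurable (fun x => (u x)%:C%C).
Proof. by move=> mu; split => //; exact: measurable_cst. Qed.

Lemma cmeasurable_cst (a : R[i]) : cmeasurable (cst a).
Proof. by split; exact: measurable_cst. Qed.

Lemma cint_le f (u : X -> R) : cmeasurable f -> P.-integrable setT (EFin \o u) ->
  (forall x, normc (f x) <= u x) -> cint f.
Proof.
move=> [fr fi] iu fu; split; apply: le_integrable iu => //.
- exact/measurable_EFinP.
- move=> x _; rewrite lee_fin (le_trans (ge_Re_normc _))// (le_trans (fu x))//.
  exact: ler_norm.
- exact/measurable_EFinP.
- move=> x _; rewrite lee_fin (le_trans (ge_Im_normc _))// (le_trans (fu x))//.
  exact: ler_norm.
Qed.

Lemma cint_bounded f (M : R) : cmeasurable f -> (forall x, normc (f x) <= M) -> cint f.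
Proof. by move=> mf fM; apply: (cint_le mf _ fM); exact: finite_measure_integrable_cst. Qed.

Lemma cint_real (u : X -> R) : P.-integrable setT (EFin \o u) ->
  cint (fun x => (u x)%:C%C).
Proof. by move=> iu; split => //; exact: integrable0. Qed.

#[local] Instance probability_ae_proper : ProperFilter (almost_everywhere P).
Proof.
have P0 : (0 < P setT)%E by rewrite probability_setT lte01.
exact: (@ae_properfilter_algebraOfSetsType _ X R P P0).
Qed.

Lemma nrm_cls_le f (M : R) : cint f -> {ae P, forall x, normc (f x) <= M} ->
  nrm (cls f) <= M.
Proof.
move=> cf fM; have inf := integrable_normc cf; rewrite nrm_cls//.
rewrite -lee_fin EFin_Rintegral//.
have M0 : 0 <= M.
  by have [x] := filter_ex fM; apply: le_trans; exact: normc_ge0.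
apply: (@le_trans _ _ (\int[P]_x M%:E)%E).
  apply: ae_ge0_le_integral => //.
  - by move=> x _; rewrite lee_fin normc_ge0.
  - exact: measurable_int inf.
  - by apply: filterS fM => x ? _; rewrite lee_fin.
by rewrite integral_cst//= probability_setT mule1.
Qed.

Lemma nrm_clsB_le f g (M : R) : cint f -> cint g ->
  {ae P, forall x, normc (f x - g x) <= M} -> nrm (cls f - cls g) <= M.
Proof. by move=> cf cg fgM; rewrite -clsB//; apply: nrm_cls_le => //; exact: cintB. Qed.

Definition cintegral (F : L1 P) : R[i] :=
  (\int[P]_x complex.Re (\val (repr F) x) +i* \int[P]_x complex.Im (\val (repr F) x))%C.

Lemma cintegral_cls f : cint f -> cintegral (cls f) =
  (\int[P]_x complex.Re (f x) +i* \int[P]_x complex.Im (f x))%C.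
Proof.
move=> cf; have /L1predP fP := cf; rewrite /cintegral (clsE fP).
set h := repr _; have hf := repr_L1class (mkL1fun fP).
have [hr hi] : cint (\val h) by exact/L1predP/valP.
have [fr fi] := cf.
congr (_ +i* _)%C; rewrite /Rintegral; congr fine; apply: ae_eq_integral => //.
- exact: measurable_int hr.
- exact: measurable_int fr.
- by apply: filterS hf => x /(_ I) /= -> _.
- exact: measurable_int hi.
- exact: measurable_int fi.
- by apply: filterS hf => x /(_ I) /= -> _.
Qed.

Lemma cintegralD F G : cintegral (F + G) = cintegral F + cintegral G.
Proof.
have [f cf ->] := cls_surj F; have [g cg ->] := cls_surj G.
have cfg := cintD cf cg; rewrite -clsD// !cintegral_cls//.
case: cf cg => fr fi [gr gi].
rewrite [RHS](_ : _ = ((\int[P]_x complex.Re (f x) + \int[P]_x complex.Re (g x)) +i*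
   (\int[P]_x complex.Im (f x) + \int[P]_x complex.Im (g x)))%C)//.
rewrite -!RintegralD//; congr (_ +i* _)%C; apply: eq_Rintegral => x _.
  by case: (f x) (g x) => [? ?] [? ?].
by case: (f x) (g x) => [? ?] [? ?].
Qed.

Lemma cintegralZ a F : cintegral (a *: F) = a * cintegral F.
Proof.
have [f cf ->] := cls_surj F; rewrite -clsZ// !cintegral_cls//; last exact: cintZ.
case: cf => fr fi; case: a => a b.
rewrite [RHS](_ : _ = ((a * \int[P]_x complex.Re (f x) - b * \int[P]_x complex.Im (f x)) +i*
   (a * \int[P]_x complex.Im (f x) + b * \int[P]_x complex.Re (f x)))%C)//.
have iZ (c : R) (u : X -> R) : P.-integrable setT (EFin \o u) ->
    P.-integrable setT (EFin \o (fun x => c * u x)).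
  exact: integrableZl.
rewrite -!RintegralZl// -RintegralB ?iZ// -RintegralD ?iZ//.
by congr (_ +i* _)%C; apply: eq_Rintegral => x _; case: (f x).
Qed.

Lemma cintegralB F G : cintegral (F - G) = cintegral F - cintegral G.
Proof. by rewrite cintegralD -[- G]scaleN1r cintegralZ mulN1r. Qed.

Lemma cintegral0 : cintegral 0 = 0.
Proof. by rewrite -(scale0r 0) cintegralZ mul0r. Qed.

Lemma cintegral_sum I (r : seq I) (F : I -> L1 P) :
  cintegral (\sum_(i <- r) F i) = \sum_(i <- r) cintegral (F i).
Proof.
elim: r => [|i r ih]; first by rewrite !big_nil cintegral0.
by rewrite !big_cons cintegralD ih.
Qed.

Lemma cintegral1 : cintegral (L1one P) = 1.
Proof.
rewrite L1one_cls cintegral_cls; last exact: cint_cst.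
by rewrite !Rintegral_cst//= probability_setT/= mulr1 mul0r.
Qed.

Lemma Re_cintegral_le F : `|complex.Re (cintegral F)| <= nrm F.
Proof.
have [f cf ->] := cls_surj F; rewrite cintegral_cls// nrm_cls//=.
have inf := integrable_normc cf; case: cf => fr fi.
rewrite (le_trans (le_normr_Rintegral _ _))//.
apply: le_Rintegral => //; first exact: integrable_norm.
by move=> x _; exact: ge_Re_normc.
Qed.

Lemma Im_cintegral_le F : `|complex.Im (cintegral F)| <= nrm F.
Proof.
have [f cf ->] := cls_surj F; rewrite cintegral_cls// nrm_cls//=.
have inf := integrable_normc cf; case: cf => fr fi.
rewrite (le_trans (le_normr_Rintegral _ _))//.
apply: le_Rintegral => //; first exact: integrable_norm.
by move=> x _; exact: ge_Im_normc.
Qed.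

Lemma normc_cintegral_le F : normc (cintegral F) <= 2 * nrm F.
Proof.
rewrite (le_trans (normc_le_ReIm _))// mulr_natl mulr2n.
by rewrite lerD// ?Re_cintegral_le// Im_cintegral_le.
Qed.

Lemma L1abs_dist (F G : L1 P) : nrm (L1abs F - L1abs G : L1 P) <= nrm (F - G).
Proof.
have [f cf ->] := cls_surj F; have [g cg ->] := cls_surj G.
rewrite !L1abs_cls// -!clsB//; [|exact: cint_abs..].
have c1 := cintB cf cg; have c2 := cintB (cint_abs cf) (cint_abs cg).
rewrite !nrm_cls//; apply: le_Rintegral => //; [exact: integrable_normc..|].
move=> x _; rewrite -lecR -!normr_normc.
exact: (ler_dist_dist (f x) (g x)).
Qed.

(** Only fast Cauchy sequences occur, so completeness is reduced to the real and
    imaginary parts without extracting subsequences. *)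
Lemma L1_complete (F : nat -> L1 P) :
  (forall n, nrm (F n.+1 - F n) <= 1 / (2 ^ n.+1)%:R) ->
  exists G, forall e, 0 < e -> exists N, forall n, (N <= n)%N -> nrm (F n - G) < e.
Proof.
move=> FC; have /choice[f fP] n : exists g, cint g /\ F n = cls g.
  by have [g] := cls_surj (F n); exists g.
have cf n := (fP n).1; have FE n := (fP n).2.
have bnd (c : R[i] -> R) : (forall x y, c (x - y) = c x - c y) ->
    (forall x, `|c x| <= normc x) ->
    (forall n, P.-integrable setT (EFin \o (c \o f n))) ->
    forall n, \int[P]_x `|(c \o f n.+1) x - (c \o f n) x| <= 1 / (2 ^ n.+1)%:R.
  move=> cB cle ci n; apply: le_trans (FC n); rewrite !FE -clsB// nrm_cls; last exact: cintB.
  apply: le_Rintegral => //.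
  - exact: integrable_norm (integrableB measurableT (ci n.+1) (ci n)).
  - exact: integrable_normc (cintB _ _).
  - by move=> x _; rewrite /= -cB cle.
have ReB (x y : R[i]) : complex.Re (x - y) = complex.Re x - complex.Re y.
  by case: x y => [? ?] [? ?].
have ImB (x y : R[i]) : complex.Im (x - y) = complex.Im x - complex.Im y.
  by case: x y => [? ?] [? ?].
have [u iu fu] := real_L1_complete (fun n => (cf n).1)
  (bnd _ ReB ge_Re_normc (fun n => (cf n).1)).
have [v iv fv] := real_L1_complete (fun n => (cf n).2)
  (bnd _ ImB ge_Im_normc (fun n => (cf n).2)).
have cg : cint (fun x => (u x +i* v x)%C) by [].
exists (cls (fun x => (u x +i* v x)%C)) => e e0.
have e20 : 0 < e / 2 by rewrite divr_gt0.
have /cvgrPdist_lt/(_ _ e20)[N1 _ h1] := fu.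
have /cvgrPdist_lt/(_ _ e20)[N2 _ h2] := fv.
exists (maxn N1 N2) => n; rewrite geq_max => /andP[/h1 {}h1 /h2 {}h2].
rewrite FE -clsB// nrm_cls; last exact: cintB.
move: h1 h2 => /=; rewrite !sub0r !normrN => /ltr_normlW h1 /ltr_normlW h2.
have [fr fi] := cf n.
have i1 := integrable_norm (integrableB measurableT fr iu).
have i2 := integrable_norm (integrableB measurableT fi iv).
rewrite [e]splitr; apply: le_lt_trans (ltrD h1 h2).
rewrite -RintegralD//.
apply: le_Rintegral => //.
- exact: integrable_normc (cintB _ _).
- exact: (integrableD measurableT i1 i2).
- by move=> x _; rewrite (le_trans (normc_le_ReIm _))//= ReB ImB.
Qed.

End L1_classes.

(** * Multiplicativity of Markov isomorphisms *)

Section square_by_distances.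
Context {R : realType}.
Implicit Types x M : R.

Definition riemann_node M N k : R := - M + (2 * M / N.+1%:R) * k%:R.

Definition riemann_square M N x : R :=
  \sum_(k < N.+1) (2 * M / N.+1%:R) * `|x - riemann_node M N k| - M ^+ 2.

(** [x^2 + M^2] is the integral of [|x - c|] over [c] in [[-M, M]], so squaring is a
    uniform limit on [[-M, M]] of combinations of distances: maps preserving linear
    combinations, constants and moduli preserve squares. *)
Lemma riemann_squareP M N x : `|x| <= M ->
  `|x ^+ 2 - riemann_square M N x| <= 4 * M ^+ 2 / N.+1%:R.
Proof.
move=> xM; have M0 : 0 <= M by rewrite (le_trans _ xM).
set h := 2 * M / N.+1%:R; have h0 : 0 <= h by rewrite divr_ge0 ?mulr_ge0.
pose F k := x - riemann_node M N k.
have FS k : F k.+1 = F k - h.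
  by rewrite /F /riemann_node -/h -natr1; ring.
pose A k := - (F k * `|F k|) / 2.
have step k : `|A k.+1 - A k - h * `|F k| | <= h ^+ 2.
  rewrite /A FS ler_norml; set a := F k.
  by case: (ger0P a) => a0; case: (ger0P (a - h)) => ah; apply/andP; split; nra.
have AN : A N.+1 - A 0%N = x ^+ 2 + M ^+ 2.
  have FN : F N.+1 = x - M.
    by rewrite /F /riemann_node divfK ?pnatr_eq0//; ring.
  have F0 : F 0%N = x + M by rewrite /F /riemann_node mulr0; ring.
  move: xM; rewrite ler_norml => /andP[x1 x2].
  rewrite /A FN F0 (ler0_norm (_ : x - M <= 0)) ?(ger0_norm (_ : 0 <= x + M)); [|lra|lra].
  by field.
rewrite /riemann_square -/h opprB addrCA addrA [M ^+ 2 + _]addrC -AN.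
rewrite -(telescope_sumr (fun k => A k))// big_mkord -sumrB.
rewrite (le_trans (ler_norm_sum _ _ _))//.
apply: (@le_trans _ _ (\sum_(k < N.+1) h ^+ 2)).
  by apply: ler_sum => k _; exact: step.
rewrite sumr_const card_ord -mulr_natl /h.
have N0 : N.+1%:R != 0 :> R by rewrite pnatr_eq0.
by rewrite le_eqVlt; apply/orP; left; apply/eqP; field.
Qed.

Lemma small_invN (e a : R) : 0 < e -> exists N, a / N.+1%:R < e.
Proof.
move=> e0; exists (Num.truncn (a / e)).
by rewrite ltr_pdivrMr// mulrC -ltr_pdivrMr// truncnS_gt.
Qed.

End square_by_distances.

Section markov.
Context {R : realType} {d : measure_display} {Y : measurableType d}
  {Q : probability Y R} {d' : measure_display} {X : measurableType d'}
  {P : probability X R}.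
Variable J : L1 Q -> L1 P.
Hypothesis mJ : markov_isomorphism J.

Let J_linear : linear J. Proof. by case: mJ. Qed.

Lemma markov_nrm F : nrm (J F) = nrm F.
Proof. by case: mJ => _ _ Jn _ _; rewrite /nrm Jn. Qed.

Let J_abs F : L1abs (J F) = J (L1abs F). Proof. by case: mJ. Qed.
Let J_one : J (L1one Q) = L1one P. Proof. by case: mJ. Qed.

Lemma markov0 : J 0 = 0.
Proof. by apply: nrm_eq0; rewrite markov_nrm nrm0. Qed.

Lemma markovZ a F : J (a *: F) = a *: J F.
Proof. by rewrite -[a *: F]addr0 J_linear markov0 addr0. Qed.

Lemma markovD F G : J (F + G) = J F + J G.
Proof. by rewrite -{1}[F]scale1r J_linear scale1r. Qed.

Lemma markovB F G : J (F - G) = J F - J G.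
Proof. by rewrite -[- G]scaleN1r markovD markovZ scaleN1r. Qed.

Lemma markov_sum I (r : seq I) (F : I -> L1 Q) :
  J (\sum_(i <- r) F i) = \sum_(i <- r) J (F i).
Proof.
elim: r => [|i r ih]; first by rewrite !big_nil markov0.
by rewrite !big_cons markovD ih.
Qed.

Let int1 (u : Y -> R) := Q.-integrable setT (EFin \o u).
Let int2 (u : X -> R) := P.-integrable setT (EFin \o u).

(** The image of a nonnegative function is its own modulus, and on nonnegative
    functions the norm is the integral. *)
Lemma markov_ge0 (u : Y -> R) : int1 u -> (forall y, 0 <= u y) ->
  exists v, [/\ int2 v, (forall x, 0 <= v x),
    J (cls Q (fun y => (u y)%:C%C)) = cls P (fun x => (v x)%:C%C)
    & \int[Q]_y u y = \int[P]_x v x].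
Proof.
move=> iu u0; have cu := cint_real iu.
have [g cg Jg] := cls_surj (J (cls Q (fun y => (u y)%:C%C))).
have nu y : normc (u y)%:C%C = u y by rewrite normc_real ger0_norm.
have uE : L1abs (cls Q (fun y => (u y)%:C%C)) = cls Q (fun y => (u y)%:C%C).
  by rewrite L1abs_cls//; congr (cls _ _); apply/funext => y; rewrite normr_normc nu.
exists (fun x => normc (g x)); split.
- exact: integrable_normc cg.
- by move=> x; exact: normc_ge0.
- by rewrite -[in LHS]uE -J_abs Jg L1abs_cls//.
- rewrite -nrm_cls// -Jg markov_nrm nrm_cls//.
  by apply: eq_Rintegral => y _; rewrite nu.
Qed.

Lemma markov_real (u : Y -> R) : int1 u ->
  exists v, [/\ int2 v, J (cls Q (fun y => (u y)%:C%C)) = cls P (fun x => (v x)%:C%C)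
    & \int[Q]_y u y = \int[P]_x v x].
Proof.
move=> iu; have ia : int1 (fun y => `|u y|) := integrable_norm iu.
have ib : int1 (fun y => `|u y| - u y) := integrableB measurableT ia iu.
have [v [iv v0 Jv intv]] := markov_ge0 ia (fun y => normr_ge0 (u y)).
have [w [iw w0 Jw intw]] : exists w, [/\ int2 w, (forall x, 0 <= w x),
    J (cls Q (fun y => (`|u y| - u y)%:C%C)) = cls P (fun x => (w x)%:C%C)
    & \int[Q]_y (`|u y| - u y) = \int[P]_x w x].
  by apply: markov_ge0 => // y; rewrite subr_ge0 ler_norm.
exists (fun x => v x - w x); split; first exact: (integrableB measurableT iv iw).
  have -> : cls Q (fun y => (u y)%:C%C) = cls Q (fun y => (`|u y|)%:C%C) -
      cls Q (fun y => (`|u y| - u y)%:C%C).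
    rewrite -clsB; [|exact: cint_real..]; congr (cls _ _); apply/funext => y.
    by rewrite -rmorphB/= opprB addrC subrK.
  rewrite markovB Jv Jw -clsB; [|exact: cint_real..].
  by congr (cls _ _); apply/funext => x; rewrite -rmorphB.
rewrite RintegralB// -intv -intw RintegralB//.
by rewrite opprB addrC subrK.
Qed.

Lemma markov_cintegral F : cintegral (J F) = cintegral F.
Proof.
have [f [fr fi] ->] := cls_surj F.
have [v [iv Jv intv]] := markov_real fr; have [w [iw Jw intw]] := markov_real fi.
have cr := cint_real fr; have ci := cint_real fi.
have cv := cint_real iv; have cw := cint_real iw.
have -> : cls Q f = cls Q (fun y => (complex.Re (f y))%:C%C) +
    'i%C *: cls Q (fun y => (complex.Im (f y))%:C%C).
  rewrite -clsZ// -clsD//; last exact: cintZ.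
  by congr (cls _ _); apply/funext => y; exact: complexE.
rewrite markovD markovZ Jv Jw !cintegralD !cintegralZ !cintegral_cls//=.
by rewrite intv intw !Rintegral_cst// !mul0r.
Qed.

Lemma markov_abs_real (u : Y -> R) v : int1 u -> int2 v ->
  J (cls Q (fun y => (u y)%:C%C)) = cls P (fun x => (v x)%:C%C) ->
  J (cls Q (fun y => `|u y|%:C%C)) = cls P (fun x => `|v x|%:C%C).
Proof.
move=> iu iv uv; have cu := cint_real iu; have cv := cint_real iv.
transitivity (J (L1abs (cls Q (fun y => (u y)%:C%C)))).
  by rewrite L1abs_cls//; congr (J (cls _ _)); apply/funext => y; rewrite normr_normc normc_real.
rewrite -J_abs uv L1abs_cls//.
by congr (cls _ _); apply/funext => x; rewrite normr_normc normc_real.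
Qed.

(** [|u| <= M] says that the real function [M - |u|] is nonnegative. *)
Lemma markov_bounded (u : Y -> R) v M : int1 u -> int2 v ->
  J (cls Q (fun y => (u y)%:C%C)) = cls P (fun x => (v x)%:C%C) ->
  (forall y, `|u y| <= M) -> {ae P, forall x, `|v x| <= M}.
Proof.
move=> iu iv uv uM.
have ia : int1 (fun y => `|u y|) := integrable_norm iu.
have ic : int1 (fun y => M) by exact: finite_measure_integrable_cst.
have ib : int1 (fun y => M - `|u y|) := integrableB measurableT ic ia.
have iva : int2 (fun x => `|v x|) := integrable_norm iv.
have icx : int2 (fun x => M) by exact: finite_measure_integrable_cst.
have ivb : int2 (fun x => M - `|v x|) := integrableB measurableT icx iva.
have [w [iw w0 Jw _]] : exists w, [/\ int2 w, (forall x, 0 <= w x),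
    J (cls Q (fun y => (M - `|u y|)%:C%C)) = cls P (fun x => (w x)%:C%C)
    & \int[Q]_y (M - `|u y|) = \int[P]_x w x].
  by apply: markov_ge0 => // y; rewrite subr_ge0.
have : cls P (fun x => (M - `|v x|)%:C%C) = cls P (fun x => (w x)%:C%C).
  rewrite -Jw; transitivity (J (cls Q (cst M%:C%C) - cls Q (fun y => `|u y|%:C%C))).
    rewrite markovB (markov_abs_real iu iv uv) cls_cst markovZ J_one -cls_cst.
    rewrite -clsB; [|exact: cint_cst|exact: cint_real].
    by congr (cls _ _); apply/funext => x; rewrite rmorphB.
  rewrite -clsB; [|exact: cint_cst|exact: cint_real].
  by congr (J (cls _ _)); apply/funext => x; rewrite rmorphB.
move=> /(cls_eqP (cint_real ivb) (cint_real iw)); apply: filterS => x /complexI vw.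
by rewrite -subr_ge0 vw.
Qed.

Lemma markov_sqr (u : Y -> R) v M : int1 u -> int2 v -> int2 (fun x => v x ^+ 2) ->
  J (cls Q (fun y => (u y)%:C%C)) = cls P (fun x => (v x)%:C%C) ->
  (forall y, `|u y| <= M) ->
  J (cls Q (fun y => (u y ^+ 2)%:C%C)) = cls P (fun x => (v x ^+ 2)%:C%C).
Proof.
move=> iu iv iv2 uv uM; have vM := markov_bounded iu iv uv uM.
have mu2 : measurable_fun setT (fun y => u y ^+ 2).
  exact: measurable_funX (measurable_realintegrable iu).
have cu2 : cintegrable Q (fun y => (u y ^+ 2)%:C%C).
  apply: (cint_bounded Q (M := M ^+ 2) (cmeasurable_real mu2)) => y.
  by rewrite normc_real normrX lerXn2r// nnegrE// (le_trans _ (uM y)).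
have cv2 := cint_real iv2.
have shift d0 (Z : measurableType d0) (p : probability Z R) (z : Z -> R) c :
    p.-integrable setT (EFin \o z) -> p.-integrable setT (EFin \o (fun x => z x - c)).
  move=> iz.
  have ic : p.-integrable setT (EFin \o cst c) by exact: finite_measure_integrable_cst.
  exact: (integrableB measurableT iz ic).
have rsE d0 (Z : measurableType d0) (p : probability Z R) (z : Z -> R) N :
    p.-integrable setT (EFin \o z) ->
    cintegrable p (fun x => (riemann_square M N (z x))%:C%C) /\
    cls p (fun x => (riemann_square M N (z x))%:C%C) =
    \sum_(k < N.+1) (2 * M / N.+1%:R)%:C%C *:
      cls p (fun x => `|z x - riemann_node M N k|%:C%C) - (M ^+ 2)%:C%C *: L1one p.
  move=> iz; have ck k : cintegrable p (fun x => `|z x - riemann_node M N k|%:C%C).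
    by apply: cint_real; apply: integrable_norm; exact: shift.
  have -> : (fun x => (riemann_square M N (z x))%:C%C) = (fun x =>
      \sum_(k < N.+1) ((2 * M / N.+1%:R)%:C%C * `|z x - riemann_node M N k|%:C%C)
      - cst (M ^+ 2)%:C%C x).
    apply/funext => x; rewrite /riemann_square rmorphB rmorph_sum/=.
    by congr (_ - _); apply: eq_bigr => k _; rewrite rmorphM.
  have cs : cintegrable p (fun x => \sum_(k < N.+1)
      ((2 * M / N.+1%:R)%:C%C * `|z x - riemann_node M N k|%:C%C)).
    by apply: cint_sum => k; exact: cintZ.
  split; first by apply: cintB => //; exact: cint_cst.
  rewrite clsB; [|exact: cs|exact: cint_cst].
  rewrite cls_cst cls_sum; last by move=> k; exact: cintZ.
  by congr (_ - _); apply: eq_bigr => k _; rewrite clsZ.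
have Jrs N : J (cls Q (fun y => (riemann_square M N (u y))%:C%C)) =
    cls P (fun x => (riemann_square M N (v x))%:C%C).
  rewrite (rsE _ _ _ _ _ iu).2 (rsE _ _ _ _ _ iv).2 markovB markov_sum markovZ J_one.
  congr (_ - _); apply: eq_bigr => k _; rewrite markovZ; congr (_ *: _).
  apply: markov_abs_real; [exact: shift|exact: shift|].
  transitivity (J (cls Q (fun y => (u y)%:C%C) - cls Q (cst (riemann_node M N k)%:C%C))).
    rewrite -clsB; [|exact: cint_real|exact: cint_cst].
    by congr (J (cls _ _)); apply/funext => y; rewrite rmorphB.
  rewrite markovB uv cls_cst markovZ J_one -cls_cst -clsB; [|exact: cint_real|exact: cint_cst].
  by congr (cls _ _); apply/funext => y; rewrite rmorphB.
apply: nrm_le_eps => e e0.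
have [N Ne] := small_invN (4 * M ^+ 2 *+ 2) e0.
rewrite (le_trans (nrm_triangle (cls P (fun x => (riemann_square M N (v x))%:C%C)) _ _))//.
rewrite -Jrs -markovB markov_nrm (le_trans _ (ltW Ne))// Jrs.
rewrite mulr2n mulrDl lerD//.
  apply: nrm_clsB_le => //; first exact: (rsE _ _ _ _ _ iu).1.
  by apply: aeW => y; rewrite -rmorphB normc_real riemann_squareP.
apply: nrm_clsB_le => //; first exact: (rsE _ _ _ _ _ iv).1.
by apply: filterS vM => y vy; rewrite -rmorphB normc_real distrC riemann_squareP.
Qed.

Let bdreal d0 (Z : measurableType d0) (z : Z -> R) :=
  measurable_fun setT z /\ exists M, forall x, `|z x| <= M.

Let bdreal_int d0 (Z : measurableType d0) (p : probability Z R) (z : Z -> R) :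
  bdreal z -> p.-integrable setT (EFin \o z).
Proof.
move=> [mz [M zM]].
have iM : p.-integrable setT (EFin \o cst M) by exact: finite_measure_integrable_cst.
apply: le_integrable iM => //; first exact/measurable_EFinP.
by move=> x _; rewrite lee_fin (le_trans (zM x))// ler_norm.
Qed.

Let bdrealD d0 (Z : measurableType d0) (z w : Z -> R) :
  bdreal z -> bdreal w -> bdreal (fun x => z x + w x).
Proof.
move=> [mz [M zM]] [mw [N wN]]; split; first exact: measurable_funD.
by exists (M + N) => x; rewrite (le_trans (ler_normD _ _))// lerD.
Qed.

Let bdrealM d0 (Z : measurableType d0) (z w : Z -> R) :
  bdreal z -> bdreal w -> bdreal (fun x => z x * w x).
Proof.
move=> [mz [M zM]] [mw [N wN]]; split; first exact: measurable_funM.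
by exists (M * N) => x; rewrite normrM ler_pM.
Qed.

Let rcls d0 (Z : measurableType d0) (p : probability Z R) (z : Z -> R) :=
  cls p (fun x => (z x)%:C%C).

Let rclsD d0 (Z : measurableType d0) (p : probability Z R) (z w : Z -> R) :
  bdreal z -> bdreal w -> rcls p (fun x => z x + w x) = rcls p z + rcls p w.
Proof.
move=> bz bw; rewrite /rcls -clsD; [|exact/cint_real/bdreal_int..].
by congr (cls _ _); apply/funext => x; rewrite rmorphD.
Qed.

Let markov_mul_real (u1 u2 : Y -> R) (v1 v2 : X -> R) :
  bdreal u1 -> bdreal u2 -> bdreal v1 -> bdreal v2 ->
  J (rcls Q u1) = rcls P v1 -> J (rcls Q u2) = rcls P v2 ->
  J (rcls Q (fun y => u1 y * u2 y)) = rcls P (fun x => v1 x * v2 x).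
Proof.
move=> bu1 bu2 bv1 bv2 uv1 uv2.
have sq (u : Y -> R) (v : X -> R) : bdreal u -> bdreal v -> J (rcls Q u) = rcls P v ->
    J (rcls Q (fun y => u y * u y)) = rcls P (fun x => v x * v x).
  move=> bu bv uv; have [_ [M uM]] := bu.
  exact: (markov_sqr (bdreal_int Q bu) (bdreal_int P bv) (bdreal_int P (bdrealM bv bv)) uv uM).
have bu := bdrealD bu1 bu2; have bv := bdrealD bv1 bv2.
have E d0 (Z : measurableType d0) (p : probability Z R) (z w : Z -> R) :
   bdreal z -> bdreal w -> rcls p (fun x => z x * w x) =
   2^-1 *: (rcls p (fun x => (z x + w x) * (z x + w x)) - rcls p (fun x => z x * z x)
    - rcls p (fun x => w x * w x)).
  move=> bz bw; have bzw := bdrealD bz bw.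
  have c1 := cint_real (bdreal_int p (bdrealM bzw bzw)).
  have c2 := cint_real (bdreal_int p (bdrealM bz bz)).
  have c3 := cint_real (bdreal_int p (bdrealM bw bw)).
  rewrite /rcls -(clsB c1 c2) -(clsB (cintB c1 c2) c3) -clsZ; last exact: (cintB (cintB c1 c2) c3).
  by congr (cls _ _); apply/funext => x; rewrite !rmorphM !rmorphD/=; field.
have s0 : J (rcls Q (fun y => (u1 y + u2 y) * (u1 y + u2 y))) =
    rcls P (fun x => (v1 x + v2 x) * (v1 x + v2 x)).
  by apply: (sq _ _ bu bv); rewrite !rclsD// markovD uv1 uv2.
by rewrite (E _ _ Q _ _ bu1 bu2) (E _ _ P _ _ bv1 bv2) markovZ !markovB s0 (sq _ _ bu1 bv1)// (sq _ _ bu2 bv2).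
Qed.

Lemma markov_ReIm f f' : cintegrable Q f -> cintegrable P f' ->
  J (cls Q f) = cls P f' ->
  J (cls Q (fun y => (complex.Re (f y))%:C%C)) = cls P (fun x => (complex.Re (f' x))%:C%C)
  /\ J (cls Q (fun y => (complex.Im (f y))%:C%C)) = cls P (fun x => (complex.Im (f' x))%:C%C).
Proof.
move=> [fr fi] cf'; have [fr' fi'] := cf'.
have [v [iv Jv _]] := markov_real fr; have [w [iw Jw _]] := markov_real fi.
have cr := cint_real fr; have ci := cint_real fi.
have cv := cint_real iv; have cw := cint_real iw.
have -> : cls Q f = cls Q (fun y => (complex.Re (f y))%:C%C) +
    'i%C *: cls Q (fun y => (complex.Im (f y))%:C%C).
  rewrite -clsZ// -clsD//; last exact: cintZ.
  by congr (cls _ _); apply/funext => y; exact: complexE.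
rewrite markovD markovZ Jv Jw -clsZ// -clsD//; last exact: cintZ.
have cvw := cintD cv (cintZ 'i%C cw).
move=> /(cls_eqP cvw cf') vw; split; apply/cls_eqP => //; try exact: cint_real.
  apply: filterS vw => x <-; congr (_%:C%C).
  by rewrite addrC Re_linear_comb/= mul0r mulr0 subr0 add0r.
apply: filterS vw => x <-; congr (_%:C%C).
by rewrite addrC Im_linear_comb/= mul0r mul1r add0r addr0.
Qed.

Lemma markov_conj f f' : cintegrable Q f -> cintegrable P f' ->
  J (cls Q f) = cls P f' ->
  J (cls Q (fun y => ((f y)^*)%C)) = cls P (fun x => ((f' x)^*)%C).
Proof.
move=> cf cf' /(markov_ReIm cf cf')[Jr Ji].
have E d0 (Z : measurableType d0) (p : probability Z R) (z : Z -> R[i]^o) :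
   cintegrable p z -> cls p (fun x => ((z x)^*)%C) =
   cls p (fun x => (complex.Re (z x))%:C%C) - 'i%C *: cls p (fun x => (complex.Im (z x))%:C%C).
  move=> [zr zi]; rewrite -clsZ; last exact: cint_real.
  rewrite -clsB; [|exact: cint_real|exact/cintZ/cint_real].
  congr (cls _ _); apply/funext => x; case: (z x) => a b; apply/eqP.
  by rewrite eq_complex/=; apply/andP; split; apply/eqP; ring.
by rewrite !E// markovB markovZ Jr Ji.
Qed.

Definition cbounded d0 (Z : measurableType d0) (f : Z -> R[i]^o) : Prop :=
  cmeasurable f /\ exists M, forall x, normc (f x) <= M.

(** Markov isomorphisms are multiplicative on bounded functions: by polarization
    and the splitting into real and imaginary parts, squares suffice. *)
Lemma markov_mul (f g : Y -> R[i]^o) (f' g' : X -> R[i]^o) :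
  cbounded f -> cbounded g -> cbounded f' -> cbounded g' ->
  J (cls Q f) = cls P f' -> J (cls Q g) = cls P g' ->
  J (cls Q (fun y => f y * g y)) = cls P (fun x => f' x * g' x).
Proof.
move=> bf bg bf' bg' Jf Jg.
have bint d0 (Z : measurableType d0) (p : probability Z R) (z : Z -> R[i]^o) :
  cbounded z -> cintegrable p z by move=> [mz [M zM]]; exact: (cint_bounded p mz zM).
have bRe d0 (Z : measurableType d0) (z : Z -> R[i]^o) :
    cbounded z -> bdreal (fun x => complex.Re (z x)).
  move=> [[mr mi] [M zM]]; split => //; exists M => x.
  by rewrite (le_trans (ge_Re_normc _)).
have bIm d0 (Z : measurableType d0) (z : Z -> R[i]^o) :
    cbounded z -> bdreal (fun x => complex.Im (z x)).
  move=> [[mr mi] [M zM]]; split => //; exists M => x.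
  by rewrite (le_trans (ge_Im_normc _)).
have [Jfr Jfi] := markov_ReIm (bint _ _ _ _ bf) (bint _ _ _ _ bf') Jf.
have [Jgr Jgi] := markov_ReIm (bint _ _ _ _ bg) (bint _ _ _ _ bg') Jg.
have E d0 (Z : measurableType d0) (p : probability Z R) (z w : Z -> R[i]^o) :
   cbounded z -> cbounded w -> cls p (fun x => z x * w x) =
   rcls p (fun x => complex.Re (z x) * complex.Re (w x))
   - rcls p (fun x => complex.Im (z x) * complex.Im (w x))
   + 'i%C *: (rcls p (fun x => complex.Re (z x) * complex.Im (w x))
   + rcls p (fun x => complex.Im (z x) * complex.Re (w x))).
  move=> bz bw.
  have c1 := cint_real (bdreal_int p (bdrealM (bRe _ _ _ bz) (bRe _ _ _ bw))).
  have c2 := cint_real (bdreal_int p (bdrealM (bIm _ _ _ bz) (bIm _ _ _ bw))).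
  have c3 := cint_real (bdreal_int p (bdrealM (bRe _ _ _ bz) (bIm _ _ _ bw))).
  have c4 := cint_real (bdreal_int p (bdrealM (bIm _ _ _ bz) (bRe _ _ _ bw))).
  rewrite /rcls -(clsB c1 c2) -(clsD c3 c4) -(clsZ _ (cintD c3 c4)).
  rewrite -(clsD (cintB c1 c2) (cintZ _ (cintD c3 c4))).
  congr (cls _ _); apply/funext => x; case: (z x) (w x) => [a b] [a' b']; apply/eqP.
  rewrite eq_complex/= ; apply/andP; split; apply/eqP; ring.
rewrite (E _ _ _ _ _ bf bg) (E _ _ _ _ _ bf' bg').
rewrite markovD markovB markovZ markovD.
have mm := markov_mul_real.
rewrite (mm _ _ _ _ (bRe _ _ _ bf) (bRe _ _ _ bg) (bRe _ _ _ bf') (bRe _ _ _ bg'))//.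
rewrite (mm _ _ _ _ (bIm _ _ _ bf) (bIm _ _ _ bg) (bIm _ _ _ bf') (bIm _ _ _ bg'))//.
rewrite (mm _ _ _ _ (bRe _ _ _ bf) (bIm _ _ _ bg) (bRe _ _ _ bf') (bIm _ _ _ bg'))//.
by rewrite (mm _ _ _ _ (bIm _ _ _ bf) (bRe _ _ _ bg) (bIm _ _ _ bf') (bRe _ _ _ bg')).
Qed.

End markov.

(** * Trigonometric polynomials *)

Section square_root_iteration.
Context {R : realType}.
Implicit Types t y : R.

Fixpoint sqrt_iter (k : nat) y : R :=
  if k is k'.+1 then sqrt_iter k' y + 2^-1 * (y - sqrt_iter k' y * sqrt_iter k' y) else 0.

(** With [e_k] the error at [t^2], [e_(k+1) = e_k (1 - (t + r_k)/2) <= e_k (1 - t/2)],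
    whence the bound [e_k <= 2 t / (2 + k t)], which is preserved by this step. *)
Lemma sqrt_iterP k t : 0 <= t <= 1 ->
  0 <= t - sqrt_iter k (t ^+ 2) <= 2 / k.+1%:R.
Proof.
move=> /andP[t0 t1].
have : 0 <= sqrt_iter k (t ^+ 2) <= t /\
    (t - sqrt_iter k (t ^+ 2)) * (2 + k%:R * t) <= 2 * t.
  elim: k => [|k [/andP[r0 rt] ih]] /=.
    by rewrite lexx t0; split=> //; rewrite mul0r addr0 subr0 mulrC.
  set r := sqrt_iter k _ in r0 rt ih *.
  have k0 : 0 <= k%:R :> R by [].
  rewrite -[k.+1%:R]natr1; set K := k%:R in ih k0 *.
  have rr : 2^-1 * (t ^+ 2 - r * r) = (t - r) * ((t + r) / 2) by field.
  rewrite rr; set e := t - r in ih *.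
  have e0 : 0 <= e by rewrite subr_ge0.
  split.
    apply/andP; split; first by rewrite addr_ge0// mulr_ge0// divr_ge0// addr_ge0.
    by rewrite -lerBrDl -/e ler_piMr//; lra.
  have -> : t - (r + e * ((t + r) / 2)) = e * (1 - (t + r) / 2) by rewrite /e; field.
  have Kt : 0 <= K * t by rewrite mulr_ge0.
  apply: (@le_trans _ _ (e * (1 - t / 2) * (2 + (K + 1) * t))).
    apply: ler_wpM2r; first by nra.
    by apply: ler_wpM2l => //; lra.
  have -> : e * (1 - t / 2) * (2 + (K + 1) * t) =
      e * (2 + K * t) - e * ((K + 1) * t ^+ 2 / 2) by field.
  rewrite (le_trans _ ih)// lerBlDr lerDl mulr_ge0// divr_ge0// mulr_ge0 ?sqr_ge0//.
  by lra.
move=> [/andP[r0 rt] h]; rewrite subr_ge0 rt /= ler_pdivlMr//.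
set e := t - _ in h *; have e0 : 0 <= e by rewrite subr_ge0.
have k0 : 0 <= k%:R :> R by [].
rewrite -[k.+1%:R]natr1; set K := k%:R in h k0 *.
have et : e <= t by rewrite /e; lra.
clearbody e; have [t00|tp] := eqVneq t 0.
  have -> : e = 0 by lra.
  by rewrite mul0r.
have {}tp : 0 < t by rewrite lt_neqAle eq_sym tp.
rewrite -(ler_pM2r tp).
nra.
Qed.

End square_root_iteration.

Section trigonometric_polynomials.
Context {R : realType} {G : Type}.
Local Notation C := (R[i]^o).
Local Notation char := (G -> C).

(** Formal combinations of characters, to be evaluated in several
    probability spaces at once. *)
Definition trig := seq (R[i] * char).

Implicit Types (p q : trig) (sigma : set char).

Definition trig_on sigma p := forall a, a \in p -> sigma a.2.

Definition trig_scale (c : R[i]) p : trig := [seq (c * a.1, a.2) | a <- p].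
Definition trig_mul p q : trig :=
  [seq (a.1 * b.1, (fun t => a.2 t * b.2 t) : char) | a <- p, b <- q].
Definition trig_conj p : trig :=
  [seq ((a.1^*)%C, (fun t => (a.2 t)^-1) : char) | a <- p].
(** What the integral of the combination is when only the trivial character
    contributes. *)
Definition trig_coef1 p : R[i] :=
  \sum_(a <- p) (if `[< a.2 = (fun=> 1) >] then a.1 else 0).
Definition trig_bound p : R := \sum_(a <- p) normc a.1.

Fixpoint trig_sqrt (k : nat) (q : trig) : trig :=
  if k is k'.+1 then trig_sqrt k' q ++ trig_scale 2^-1
    (q ++ trig_scale (-1) (trig_mul (trig_sqrt k' q) (trig_sqrt k' q))) else [::].

(** Approximations of the modulus [|p|]. Dividing by [B > |p|] brings [|p|^2 / B^2]
    into the unit interval, where the iteration for the square root converges. The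
    only operations are products, conjugates and linear combinations, so the
    result is again a formal combination, the same one in every space. *)
Definition trig_abs (k : nat) p : trig :=
  let B := (trig_bound p + 1)%:C%C in
  trig_scale B (trig_sqrt k (trig_scale (B^-1 ^+ 2) (trig_mul p (trig_conj p)))).

Definition group_like sigma := [/\ sigma (fun=> 1),
  (forall chi psi, sigma chi -> sigma psi -> sigma (fun t => chi t * psi t))
  & (forall chi, sigma chi -> sigma (fun t => (chi t)^-1))].

Lemma trig_on_cat sigma p q : trig_on sigma p -> trig_on sigma q -> trig_on sigma (p ++ q).
Proof. by move=> hp hq a; rewrite mem_cat => /orP[/hp|/hq]. Qed.

Lemma trig_on_scale sigma c p : trig_on sigma p -> trig_on sigma (trig_scale c p).
Proof. by move=> hp _ /mapP[a /hp ha ->]. Qed.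

Lemma trig_on_nil sigma : trig_on sigma [::].
Proof. by []. Qed.

Lemma trig_on_cons sigma a p : trig_on sigma (a :: p) -> sigma a.2 /\ trig_on sigma p.
Proof.
move=> h; split; first by apply: h; rewrite mem_head.
by move=> b bp; apply: h; rewrite in_cons bp orbT.
Qed.

Lemma trig_on_cons2 sigma a p : sigma a.2 -> trig_on sigma p -> trig_on sigma (a :: p).
Proof. by move=> ha hp b; rewrite in_cons => /predU1P[->//|/hp]. Qed.

Section group_like.
Variable sigma : set char.
Hypothesis sigmaG : group_like sigma.

Lemma trig_on_mul p q : trig_on sigma p -> trig_on sigma q -> trig_on sigma (trig_mul p q).
Proof.
move=> hp hq _ /allpairsP[[a b] [/= ap bq ->]] /=.
by case: sigmaG => _ + _; apply; [exact: hp|exact: hq].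
Qed.

Lemma trig_on_conj p : trig_on sigma p -> trig_on sigma (trig_conj p).
Proof. by move=> hp _ /mapP[a /hp ha ->]; case: sigmaG => _ _; exact. Qed.

Lemma trig_on_sqrt k q : trig_on sigma q -> trig_on sigma (trig_sqrt k q).
Proof.
move=> hq; elim: k => [|k ih]; first exact: trig_on_nil.
apply: trig_on_cat => //; apply: trig_on_scale; apply: trig_on_cat => //.
by apply: trig_on_scale; exact: trig_on_mul.
Qed.

Lemma trig_on_abs k p : trig_on sigma p -> trig_on sigma (trig_abs k p).
Proof.
move=> hp; apply: trig_on_scale; apply: trig_on_sqrt; apply: trig_on_scale.
by apply: trig_on_mul => //; exact: trig_on_conj.
Qed.

End group_like.

Definition trig_eval {X : Type} (s : char -> X -> C) p : X -> C :=
  fun x => \sum_(a <- p) a.1 * s a.2 x.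

Section eval.
Context {X : Type}.
Variable s : char -> X -> C.

Lemma trig_eval_cat p q x : trig_eval s (p ++ q) x = trig_eval s p x + trig_eval s q x.
Proof. exact: big_cat. Qed.

Lemma trig_eval_scale c p x : trig_eval s (trig_scale c p) x = c * trig_eval s p x.
Proof.
rewrite /trig_eval big_map mulr_sumr; apply: eq_bigr => a _ /=.
by rewrite mulrA.
Qed.

Lemma trig_eval_nil x : trig_eval s [::] x = 0.
Proof. exact: big_nil. Qed.

Lemma trig_eval_cons a p x : trig_eval s (a :: p) x = a.1 * s a.2 x + trig_eval s p x.
Proof. exact: big_cons. Qed.

End eval.

End trigonometric_polynomials.

Arguments trig R G : clear implicits.

Section unit_representation.
Context {R : realType} {G : Type}.
Local Notation C := (R[i]^o).
Local Notation char := (G -> C).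
Variable sigma : set char.
Hypothesis sigmaG : group_like sigma.

(** Common form of the eigenfunctions of an ergodic system and of the characters
    of a compact group. For a given group [sigma] these four properties determine
    the closed span of the functions up to isomorphism. *)
Definition unit_rep {d} {X : measurableType d} (P : probability X R)
    (s : char -> X -> C) : Prop :=
  [/\ (forall chi, sigma chi -> cmeasurable (s chi)),
      (forall chi x, sigma chi -> normc (s chi x) = 1),
      (forall chi psi, sigma chi -> sigma psi ->
        {ae P, forall x, s (fun t => chi t * psi t) x = s chi x * s psi x})
    & (forall chi, sigma chi -> cintegral (cls P (s chi)) =
        if `[< chi = (fun=> 1) >] then 1 else 0)].

Section one_space.
Context {d : measure_display} {X : measurableType d}.
Variables (P : probability X R) (s : char -> X -> C).
Hypothesis srep : unit_rep P s.

Lemma unit_rep_cint chi : sigma chi -> cintegrable P (s chi).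
Proof.
move=> h; case: srep => sm s1 _ _; apply: (cint_bounded P (M := 1)); first exact: sm.
by move=> x; rewrite s1.
Qed.

Lemma normc_trig_eval p x : trig_on sigma p -> normc (trig_eval s p x) <= trig_bound p.
Proof.
case: srep => _ s1 _ _; elim: p => [|a p ih].
  by rewrite trig_eval_nil /trig_bound big_nil normc0.
move=> /trig_on_cons[ha hp]; rewrite trig_eval_cons /trig_bound big_cons.
rewrite (le_trans (le_normcD _ _))// lerD ?ih// normcM s1// mulr1//.
Qed.

Lemma trig_bound_ge0 (p : trig R G) : 0 <= trig_bound p.
Proof. by apply: sumr_ge0 => a _; exact: normc_ge0. Qed.

Lemma cmeasurable_trig p : trig_on sigma p -> cmeasurable (trig_eval s p).
Proof.
case: srep => sm _ _ _; elim: p => [_|a p ih].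
  rewrite (_ : trig_eval s [::] = cst 0); first exact: cmeasurable_cst.
  by apply/funext => x; rewrite trig_eval_nil.
move=> /trig_on_cons[ha hp]; have -> : trig_eval s (a :: p) =
    (fun x => a.1 * s a.2 x + trig_eval s p x).
  by apply/funext => x; rewrite trig_eval_cons.
apply: cmeasurableD; last exact: ih.
by apply: cmeasurableM; [exact: cmeasurable_cst|exact: sm].
Qed.

Lemma cint_trig p : trig_on sigma p -> cintegrable P (trig_eval s p).
Proof.
move=> hp; apply: (cint_bounded P (cmeasurable_trig hp) (M := trig_bound p)) => x.
exact: normc_trig_eval.
Qed.

Definition trig_cls p : L1 P := cls P (trig_eval s p).

Lemma trig_clsE p : trig_on sigma p -> trig_cls p = \sum_(a <- p) a.1 *: cls P (s a.2).
Proof.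
elim: p => [_|a p ih].
  rewrite big_nil /trig_cls (_ : trig_eval s [::] = cst 0).
    by rewrite cls_cst scale0r.
  by apply/funext => x; rewrite trig_eval_nil.
move=> /trig_on_cons[ha hp]; rewrite big_cons -ih// -clsZ; last exact: unit_rep_cint.
rewrite -clsD; [|exact/cintZ/unit_rep_cint|exact: cint_trig].
by congr (cls _ _); apply/funext => x; rewrite trig_eval_cons.
Qed.

Lemma trig_cls_cat p q : trig_on sigma p -> trig_on sigma q ->
  trig_cls (p ++ q) = trig_cls p + trig_cls q.
Proof.
move=> hp hq; rewrite /trig_cls -clsD; [|exact: cint_trig..].
by congr (cls _ _); apply/funext => x; rewrite trig_eval_cat.
Qed.

Lemma trig_cls_scale c p : trig_on sigma p -> trig_cls (trig_scale c p) = c *: trig_cls p.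
Proof.
move=> hp; rewrite /trig_cls -clsZ; last exact: cint_trig.
by congr (cls _ _); apply/funext => x; rewrite trig_eval_scale.
Qed.

Lemma trig_eval_mul p q : trig_on sigma p -> trig_on sigma q ->
  {ae P, forall x, trig_eval s (trig_mul p q) x = trig_eval s p x * trig_eval s q x}.
Proof.
case: srep => _ _ sM _; elim: p => [_ hq|a p ih].
  by apply: aeW => x; rewrite /= !trig_eval_nil mul0r.
move=> /trig_on_cons[ha hp] hq.
have h1 : {ae P, forall x, trig_eval s [seq (a.1 * b.1, fun t => a.2 t * b.2 t) | b <- q] x
    = a.1 * s a.2 x * trig_eval s q x}.
  elim: q hq {ih} => [_|b q ihq].
    by apply: aeW => x; rewrite /= !trig_eval_nil mulr0.
  move=> /trig_on_cons[hb hq]; apply: filterS2 (sM _ _ ha hb) (ihq hq) => x sx ix /=.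
  by rewrite trig_eval_cons ix trig_eval_cons sx/= mulrDr; congr (_ + _); rewrite mulrACA.
apply: filterS2 h1 (ih hp hq) => x h1 h2.
rewrite [trig_mul _ _](_ : _ =
  [seq (a.1 * b.1, fun t => a.2 t * b.2 t) | b <- q] ++ trig_mul p q)//.
by rewrite trig_eval_cat h1 h2 trig_eval_cons mulrDl.
Qed.

Lemma unit_rep1 : {ae P, forall x, s (fun=> 1) x = 1}.
Proof.
case: sigmaG => h1 _ _; case: srep => _ s1 sM _.
apply: filterS (sM _ _ h1 h1) => x; rewrite (_ : (fun=> 1 * 1) = (fun=> 1)); last first.
  by apply/funext => t; rewrite mulr1.
move=> e; apply: (@mulfI _ (s (fun=> 1) x)); last by rewrite -e mulr1.
by apply/eqP => s0; have := s1 _ x h1; rewrite s0 normc0 => /eqP; rewrite eq_sym oner_eq0.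
Qed.

Lemma unit_repV chi : sigma chi -> (forall t, chi t != 0) ->
  {ae P, forall x, s (fun t => (chi t)^-1) x = ((s chi x)^*)%C}.
Proof.
move=> h chi0; case: sigmaG => h1 _ hV; case: srep => _ s1 sM _.
apply: filterS2 (sM _ _ h (hV _ h)) unit_rep1 => x.
rewrite (_ : (fun t => chi t * (chi t)^-1) = (fun=> 1)); last first.
  by apply/funext => t; rewrite mulfV.
move=> -> e; rewrite unit_conjcV ?s1//.
have s0 : s chi x != 0.
  by apply/eqP => s0; have := s1 _ x h; rewrite s0 normc0 => /eqP; rewrite eq_sym oner_eq0.
by apply: (mulfI s0); rewrite e mulfV.
Qed.

Hypothesis sigma_neq0 : forall chi, sigma chi -> forall t, chi t != 0.

Lemma trig_eval_conj p : trig_on sigma p ->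
  {ae P, forall x, trig_eval s (trig_conj p) x = ((trig_eval s p x)^*)%C}.
Proof.
elim: p => [_|a p ih].
  by apply: aeW => x; rewrite /= !trig_eval_nil rmorph0.
move=> /trig_on_cons[ha hp]; apply: filterS2 (unit_repV ha (sigma_neq0 ha)) (ih hp) => x sx ix.
by rewrite /trig_conj/= trig_eval_cons/= [trig_eval _ _ _]ix sx trig_eval_cons rmorphD rmorphM.
Qed.

Lemma trig_eval_sqrt k q (u : X -> R) : trig_on sigma q ->
  {ae P, forall x, trig_eval s q x = (u x)%:C%C} ->
  {ae P, forall x, trig_eval s (trig_sqrt k q) x = (sqrt_iter k (u x))%:C%C}.
Proof.
move=> hq qu; elim: k => [|k ih]; first by apply: aeW => x; rewrite trig_eval_nil.
have hk := trig_on_sqrt sigmaG (k := k) hq.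
apply: filterS3 qu ih (trig_eval_mul hk hk) => x qx ix mx.
rewrite /= trig_eval_cat trig_eval_scale trig_eval_cat trig_eval_scale mx ix qx.
by rewrite !rmorphD !rmorphM/= rmorphB/= rmorphM/= fmorphV rmorph_nat mulN1r.
Qed.

Lemma trig_eval_abs k p : trig_on sigma p ->
  {ae P, forall x, normc (`|trig_eval s p x| - trig_eval s (trig_abs k p) x) <=
    2 * (trig_bound p + 1) / k.+1%:R}.
Proof.
move=> hp; set B := trig_bound p + 1.
have B0 : 0 < B by rewrite ltr_wpDl// trig_bound_ge0.
pose u x := (normc (trig_eval s p x) / B) ^+ 2.
have hq := trig_on_scale (c := B%:C%C^-1 ^+ 2) (trig_on_mul sigmaG hp (trig_on_conj sigmaG hp)).
have qu : {ae P, forall x, trig_eval s (trig_scale (B%:C%C^-1 ^+ 2) (trig_mul p (trig_conj p))) x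
    = (u x)%:C%C}.
  apply: filterS2 (trig_eval_mul hp (trig_on_conj sigmaG hp)) (trig_eval_conj hp) => x mx cx.
  rewrite trig_eval_scale mx cx mul_conjc /u exprMn [RHS]rmorphM/= [LHS]mulrC.
  by congr (_ * _); rewrite [RHS]rmorphXn/= fmorphV.
apply: filterS (trig_eval_sqrt k hq qu) => x ex.
rewrite /trig_abs -/B trig_eval_scale ex normr_normc -rmorphM -rmorphB normc_real.
set t := normc (trig_eval s p x) / B.
have tB : normc (trig_eval s p x) = B * t by rewrite /t mulrC divfK// gt_eqF.
have t01 : 0 <= t <= 1.
  rewrite divr_ge0 ?normc_ge0 ?(ltW B0)//= ler_pdivrMr// mul1r.
  by rewrite (le_trans (normc_trig_eval x hp))// lerDl.
rewrite tB -mulrBr normrM gtr0_norm// -[u x]/(t ^+ 2).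
have /andP[e0 e1] := sqrt_iterP k t01.
by rewrite ger0_norm// [2 * B]mulrC -mulrA ler_pM2l.
Qed.

Lemma cintegral_trig p : trig_on sigma p -> cintegral (trig_cls p) = trig_coef1 p.
Proof.
move=> hp; rewrite trig_clsE// cintegral_sum /trig_coef1; apply: eq_big_seq => a ap.
case: srep => _ _ _ sI; rewrite cintegralZ sI; last exact: hp.
by case: ifP; rewrite ?mulr1 ?mulr0.
Qed.

Lemma trig_abs_cls k p : trig_on sigma p ->
  nrm (L1abs (trig_cls p) - trig_cls (trig_abs k p)) <= 2 * (trig_bound p + 1) / k.+1%:R.
Proof.
move=> hp; have cp := cint_trig hp; rewrite L1abs_cls//; apply: nrm_clsB_le.
- exact: cint_abs.
- by apply: cint_trig; apply: trig_on_abs.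
- exact: trig_eval_abs.
Qed.

(** The norm of a trigonometric polynomial is the integral of its modulus, which
    can be read off from the coefficients alone: it does not depend on the space
    in which the polynomial is evaluated. *)
Lemma nrm_trig_cls k p : trig_on sigma p ->
  `|nrm (trig_cls p) - complex.Re (trig_coef1 (trig_abs k p))| <=
    2 * (trig_bound p + 1) / k.+1%:R.
Proof.
move=> hp; have cp := cint_trig hp; rewrite -cintegral_trig; last exact: trig_on_abs.
have -> : nrm (trig_cls p) = complex.Re (cintegral (L1abs (trig_cls p))).
  by rewrite nrm_cls// L1abs_cls// cintegral_cls//; exact: cint_abs.
have ReB (x y : R[i]) : complex.Re (x - y) = complex.Re x - complex.Re y.
  by case: x y => [? ?] [? ?].
apply: le_trans (trig_abs_cls k hp); apply: le_trans (Re_cintegral_le _).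
by rewrite cintegralB ReB.
Qed.

End one_space.

End unit_representation.

(** * Isomorphism of spaces with the same trigonometric polynomials *)

Section unit_representation_closeness.
Context {R : realType} {G : Type}.
Local Notation char := (G -> R[i]^o).
Variable sigma : set char.
Hypothesis sigmaG : group_like sigma.
Hypothesis sigma_neq0 : forall chi, sigma chi -> forall t, chi t != 0.

Definition trig_dense {d} {X : measurableType d} (P : probability X R)
    (s : char -> X -> R[i]^o) : Prop :=
  forall (x : L1 P) (e : R), 0 < e ->
    exists2 p, trig_on sigma p & nrm (x - trig_cls P s p) < e.

(** Closure of the graph of the map that sends the evaluation of a formal
    combination in one space to its evaluation in the other. *)
Definition trig_close {d1} {X1 : measurableType d1} (P1 : probability X1 R)
    (s1 : char -> X1 -> R[i]^o) {d2} {X2 : measurableType d2}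
    (P2 : probability X2 R) (s2 : char -> X2 -> R[i]^o) (x : L1 P1) (y : L1 P2) : Prop :=
  forall e : R, 0 < e -> exists p, [/\ trig_on sigma p,
    nrm (x - trig_cls P1 s1 p) < e & nrm (y - trig_cls P2 s2 p) < e].

Lemma close_sym d1 (X1 : measurableType d1) (P1 : probability X1 R)
    (s1 : char -> X1 -> R[i]^o) d2 (X2 : measurableType d2)
    (P2 : probability X2 R) (s2 : char -> X2 -> R[i]^o) x y :
  trig_close s1 s2 x y -> trig_close (P1 := P2) (P2 := P1) s2 s1 y x.
Proof. by move=> xy e /xy[p [? ? ?]]; exists p. Qed.

Section two_spaces.
Context {d1 : measure_display} {X1 : measurableType d1} {P1 : probability X1 R}
  {s1 : char -> X1 -> R[i]^o} {d2 : measure_display} {X2 : measurableType d2}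
  {P2 : probability X2 R} {s2 : char -> X2 -> R[i]^o}.
Hypothesis rep1 : unit_rep sigma P1 s1.
Hypothesis rep2 : unit_rep sigma P2 s2.
Local Notation c1 := (trig_cls P1 s1).
Local Notation c2 := (trig_cls P2 s2).
Local Notation trig_close := (trig_close (P1 := P1) (P2 := P2) s1 s2).

Lemma trig_cls_isometry p : trig_on sigma p -> nrm (c1 p) = nrm (c2 p).
Proof.
move=> hp; apply/eqP; rewrite -subr_eq0 -normr_le0; apply/ler_addgt0Pl => e e0.
rewrite addr0; have [k ke] := small_invN (2 * (trig_bound p + 1) *+ 2) e0.
rewrite (le_trans _ (ltW ke))// mulr2n mulrDl.
rewrite (le_trans (ler_distD (complex.Re (trig_coef1 (trig_abs k p))) _ _))// lerD//.
  exact: (nrm_trig_cls sigmaG rep1 sigma_neq0).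
by rewrite distrC; exact: (nrm_trig_cls sigmaG rep2 sigma_neq0).
Qed.

Lemma trig_cls_isometryB p q : trig_on sigma p -> trig_on sigma q ->
  nrm (c1 p - c1 q) = nrm (c2 p - c2 q).
Proof.
move=> hp hq; have hq' := trig_on_scale (c := -1) hq.
have := trig_cls_isometry (trig_on_cat hp hq').
rewrite (trig_cls_cat rep1)// (trig_cls_cat rep2)//.
by rewrite (trig_cls_scale rep1)// (trig_cls_scale rep2)// !scaleN1r.
Qed.

Lemma close_linear a x y x' y' : trig_close x y -> trig_close x' y' ->
  trig_close (a *: x + x') (a *: y + y').
Proof.
move=> xy xy' e e0; have e20 : 0 < e / 2 by rewrite divr_gt0.
have a0 : 0 < normc a + 1 by rewrite ltr_wpDl ?normc_ge0.
have ea0 : 0 < e / 2 / (normc a + 1) by rewrite divr_gt0.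
have [p [hp xp yp]] := xy _ ea0; have [q [hq xq yq]] := xy' _ e20.
exists (trig_scale a p ++ q).
have hp' := trig_on_scale (c := a) hp.
have bound (V : normedModType R[i]) (u v cp cq : V) :
    nrm (u - cp) < e / 2 / (normc a + 1) -> nrm (v - cq) < e / 2 ->
    nrm (a *: u + v - (a *: cp + cq)) < e.
  move=> h1 h2; rewrite opprD addrACA -scalerBr (le_lt_trans (nrmD _ _))//.
  rewrite [e]splitr ler_ltD// nrmZ (le_trans (ler_wpM2r (nrm_ge0 _) (_ : _ <= normc a + 1)))//.
    by rewrite lerDl.
  by rewrite mulrC -ler_pdivlMr// ltW.
split; first exact: trig_on_cat.
  by rewrite (trig_cls_cat rep1)// (trig_cls_scale rep1)//; exact: bound.
by rewrite (trig_cls_cat rep2)// (trig_cls_scale rep2)//; exact: bound.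
Qed.

Lemma nrm_dist_lt (V : normedModType R[i]) (u v : V) (e : R) :
  nrm (u - v) < e -> `|nrm u - nrm v| < e.
Proof.
apply: le_lt_trans; rewrite -lecR -normr_nrm.
have -> : `|nrm u - nrm v|%:C%C = `| `|u| - `|v| |.
  by rewrite !normr_nrm -rmorphB normr_normc normc_real.
exact: ler_dist_dist.
Qed.

Lemma close_nrm x y : trig_close x y -> nrm x = nrm y.
Proof.
move=> xy; apply/eqP; rewrite -subr_eq0 -normr_le0; apply/ler_addgt0Pl => e e0.
rewrite addr0; have e20 : 0 < e / 2 by rewrite divr_gt0.
have [p [hp /nrm_dist_lt/ltW xp /nrm_dist_lt/ltW yp]] := xy _ e20.
rewrite (le_trans (ler_distD (nrm (c1 p)) _ _))// [e]splitr lerD//.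
by rewrite (trig_cls_isometry hp) distrC.
Qed.

Lemma close_uniq x y y' : trig_close x y -> trig_close x y' -> y = y'.
Proof.
move=> xy xy'; have := close_linear (-1) xy xy'.
rewrite !scaleN1r addNr => /close_nrm; rewrite nrm0 => /esym/nrm_eq0/eqP.
by rewrite addrC subr_eq0 => /eqP.
Qed.

Lemma close_trig p : trig_on sigma p -> trig_close (c1 p) (c2 p).
Proof. by move=> hp e e0; exists p; rewrite !subrr !nrm0. Qed.

Lemma close_abs x y : trig_close x y -> trig_close (L1abs x) (L1abs y).
Proof.
move=> xy e e0; have e20 : 0 < e / 2 by rewrite divr_gt0.
have [p [hp xp yp]] := xy _ e20.
have [k ke] := small_invN (2 * (trig_bound p + 1)) e20.
exists (trig_abs k p); split; first exact: trig_on_abs.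
  rewrite (le_lt_trans (nrm_triangle (L1abs (c1 p)) _ _))// [e]splitr ltrD//.
    exact: le_lt_trans (L1abs_dist _ _) xp.
  exact: le_lt_trans (trig_abs_cls sigmaG rep1 sigma_neq0 k hp) ke.
rewrite (le_lt_trans (nrm_triangle (L1abs (c2 p)) _ _))// [e]splitr ltrD//.
  exact: le_lt_trans (L1abs_dist _ _) yp.
exact: le_lt_trans (trig_abs_cls sigmaG rep2 sigma_neq0 k hp) ke.
Qed.

Lemma close_one : trig_close (L1one P1) (L1one P2).
Proof.
case: sigmaG => h1 _ _; pose p : trig R G := [:: (1, fun=> 1)].
have hp : trig_on sigma p by apply: trig_on_cons2 => //; exact: trig_on_nil.
have pE d (X : measurableType d) (P : probability X R) s : unit_rep sigma P s ->
    trig_cls P s p = L1one P.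
  move=> rep; rewrite (trig_clsE rep)// big_seq1 scale1r L1one_cls.
  apply/cls_eqP; [exact: (unit_rep_cint rep)|exact: cint_cst|].
  exact: (unit_rep1 sigmaG rep).
by have := close_trig hp; rewrite (pE _ _ _ _ rep1) (pE _ _ _ _ rep2).
Qed.

(** Approximations of [x] are a Cauchy sequence; their evaluations in the other
    space are one too, and the limit of these is the partner of [x]. *)
Lemma close_total x : trig_dense P1 s1 -> exists y, trig_close x y.
Proof.
move=> dense1.
(* Two consecutive errors add up to the rate required by [L1_complete]. *)
pose e n : R := 1 / (2 ^ n.+2)%:R.
have e0 n : 0 < e n by rewrite divr_gt0// ltr0n expn_gt0.
have /choice[p pP] n : exists p, trig_on sigma p /\ nrm (x - c1 p) < e n.
  by have [p ? ?] := dense1 x _ (e0 n); exists p.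
have [n|y yP] := @L1_complete _ _ _ P2 (fun n => c2 (p n)).
  have [h1 xp1] := pP n.+1; have [h xp] := pP n.
  rewrite -trig_cls_isometryB//.
  rewrite (le_trans (nrm_triangle x _ _))// (_ : 1 / _ = e n + e n); last first.
    by rewrite /e [(2 ^ n.+2)%N]expnSr natrM; field; rewrite pnatr_eq0 expn_eq0.
  rewrite lerD ?(ltW xp)// nrmBC (le_trans (ltW xp1))//.
  rewrite /e ler_pM2l// lef_pV2 ?posrE ?ltr0n ?expn_gt0// ler_nat leq_exp2l//.
exists y => eps eps0; have [N1 NP1] := yP _ eps0.
have [N2 NP2] := small_invN 1 eps0.
pose n := maxn N1 N2; exists (p n); have [hp xp] := pP n; split => //.
  rewrite (lt_le_trans xp)// (le_trans _ (ltW NP2))// /e !mul1r.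
  rewrite lef_pV2 ?posrE ?ltr0n ?expn_gt0// ler_nat.
  have h := leq_maxr N1 N2.
  rewrite (leq_trans (_ : _ <= n.+1)%N)//.
  by rewrite (leq_trans (ltnW (ltn_expl n.+1 (ltnSn 1))))// leq_exp2l.
by rewrite nrmBC NP1// leq_maxl.
Qed.

End two_spaces.

Section isomorphism.
Context {d1 : measure_display} {X1 : measurableType d1} {P1 : probability X1 R}
  {s1 : char -> X1 -> R[i]^o} {d2 : measure_display} {X2 : measurableType d2}
  {P2 : probability X2 R} {s2 : char -> X2 -> R[i]^o}.
Hypothesis rep1 : unit_rep sigma P1 s1.
Hypothesis rep2 : unit_rep sigma P2 s2.
Hypothesis dense1 : trig_dense P1 s1.
Hypothesis dense2 : trig_dense P2 s2.

(** By the isometry property the closed graph is that of a bijection, and it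
    respects moduli since [trig_abs] approximates them in both spaces at once. *)
Lemma unit_rep_isomorphism : exists J : L1 P1 -> L1 P2,
  markov_isomorphism J /\ forall x, trig_close s1 s2 x (J x).
Proof.
have /choice[J JP] x := close_total rep1 rep2 x dense1.
have /choice[K KP] y := close_total rep2 rep1 y dense2.
exists J; split => //; split.
- move=> a u v; apply: (close_uniq rep1 rep2 (JP _)).
  exact: (close_linear rep1 rep2).
- exists K => [x|y].
    by apply: (close_uniq rep2 rep1 (KP _)); exact/close_sym/JP.
  by apply: (close_uniq rep1 rep2 (JP _)); exact/close_sym/KP.
- by move=> x; rewrite !normr_nrm (close_nrm rep1 rep2 (JP x)).
- move=> x; apply/esym/(close_uniq rep1 rep2 (JP _)).
  exact: (close_abs rep1 rep2).
- apply: (close_uniq rep1 rep2 (JP _)); exact: (close_one rep1 rep2).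
Qed.

(** Both maps act on formal combinations by multiplying the coefficients by [m]. *)
Lemma close_intertwine (T1 : L1 P1 -> L1 P1) (T2 : L1 P2 -> L1 P2) (m : char -> R[i]) x y :
  markov_isomorphism T1 -> markov_isomorphism T2 ->
  (forall chi, sigma chi -> T1 (cls P1 (s1 chi)) = m chi *: cls P1 (s1 chi)) ->
  (forall chi, sigma chi -> T2 (cls P2 (s2 chi)) = m chi *: cls P2 (s2 chi)) ->
  trig_close s1 s2 x y -> trig_close s1 s2 (T1 x) (T2 y).
Proof.
move=> mT1 mT2 T1s T2s xy e /xy[p [hp xp yp]].
pose q : trig R G := [seq (a.1 * m a.2, a.2) | a <- p].
have hq : trig_on sigma q by move=> _ /mapP[a /hp ha ->].
have qE d (X : measurableType d) (P : probability X R) s T : unit_rep sigma P s ->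
    markov_isomorphism T ->
    (forall chi, sigma chi -> T (cls P (s chi)) = m chi *: cls P (s chi)) ->
    T (trig_cls P s p) = trig_cls P s q.
  move=> rep mT Ts; rewrite !(trig_clsE rep)// (markov_sum mT) big_map.
  apply: eq_big_seq => a /hp ha.
  by rewrite (markovZ mT) Ts// scalerA.
exists q; split => //.
  by rewrite -(qE _ _ _ _ _ rep1 mT1 T1s) -(markovB mT1) (markov_nrm mT1).
by rewrite -(qE _ _ _ _ _ rep2 mT2 T2s) -(markovB mT2) (markov_nrm mT2).
Qed.

End isomorphism.

End unit_representation_closeness.

(** * Eigenfunctions of ergodic systems *)

Section ultrafilter_limits.
Context {R : realType}.

Lemma nrm_normc (z : R[i]^o) : nrm z = normc z.
Proof. by rewrite /nrm normr_normc. Qed.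

Lemma compact_complex_square :
  compact [set z : R[i]^o | `|complex.Re z| <= 1 /\ `|complex.Im z| <= 1].
Proof.
have -> : [set z : R[i]^o | `|complex.Re z| <= 1 /\ `|complex.Im z| <= 1] =
    (fun x : R * R => (x.1 +i* x.2)%C : R[i]^o) @` (`[-1, 1] `*` `[-1, 1]).
  apply/seteqP; split => [[a b]/= [a1 b1]|_ [[a b] /= [a1 b1] <-]] /=.
    by exists (a, b) => //=; rewrite !in_itv/= -!ler_norml.
  by move: a1 b1; rewrite /= !in_itv/= -!ler_norml.
apply: continuous_compact; last exact: (compact_setX (@segment_compact _ _ _) (@segment_compact _ _ _)).
apply: continuous_subspaceT => -[a b]; apply/cvg_nrmP => e e0.
have e20 : 0 < e / 2 by rewrite divr_gt0.
have : \forall x \near ((a, b) : R * R), ball (a, b) (e / 2) x by exact: nbhsx_ballx.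
apply: filterS => -[a' b'] [/= h1 h2].
rewrite nrm_normc (le_lt_trans (normc_le_ReIm _))//= [e]splitr.
by apply: ltrD.
Qed.

Lemma ultra_compact_cvg {T : Type} {Y : topologicalType} (U : set_system T)
    (f : T -> Y) (A : set Y) :
  UltraFilter U -> compact A -> (forall x, A (f x)) -> exists2 y, A y & f @ U --> y.
Proof.
move=> UU cA fA.
have [|y [Ay cy]] := cA (f @ U) _.
  by apply: (@filterS _ U _ setT); [move=> x _; exact: fA|exact: filterT].
exists y => // V Vy.
have [//|UV] := in_ultra_setVsetC (f @^-1` V) UU.
by have [z []] := cy (~` V) V UV Vy.
Qed.

Lemma ultra_unit_limit {T : Type} (U : set_system T) (f : T -> R[i]^o) :
  UltraFilter U -> (forall x, normc (f x) = 1) ->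
  exists z : R[i]^o, normc z = 1 /\ f @ U --> z.
Proof.
move=> UU f1; have [x|z _ fz] := ultra_compact_cvg UU compact_complex_square (f := f).
  by rewrite /= -(f1 x); split; [exact: ge_Re_normc|exact: ge_Im_normc].
exists z; split => //.
have h : (fun x => `|f x|) @ U --> `|z| by exact: cvg_norm.
have E : (fun x => `|f x|) = cst 1 by apply/funext => x; rewrite normr_normc f1.
have c1 : (fun x => `|f x|) @ U --> (1 : R[i]^o) by rewrite E; exact: cvg_cst.
have /(congr1 (@complex.Re R)) : `|z| = 1.
  exact: (cvg_unique (@norm_hausdorff _ (R[i]^o)) h c1).
by rewrite normr_normc.
Qed.

End ultrafilter_limits.

Section eigenfunctions.
Context {R : realType} {G : topologicalZmodType}.
Local Notation char := (G -> R[i]^o).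
Variable X : system R G.
Hypothesis mX : measure_preserving X.
Local Notation P := (sys_prob X).
Local Notation T := (@sys_op R G X).
Local Notation sX := (sys_space X).

Let mT t : markov_isomorphism (T t). Proof. by case: mX. Qed.

Lemma nrm_one {d} {Z : measurableType d} (p : probability Z R) : nrm (L1one p) = 1.
Proof.
rewrite L1one_cls nrm_cls; last exact: cint_cst.
rewrite (@eq_Rintegral _ _ _ _ _ (cst 1)); last by move=> x _; exact: normc1.
by rewrite Rintegral_cst//= probability_setT mulr1.
Qed.

Lemma sys_op_one t : T t (L1one P) = L1one P.
Proof. by case: (mT t). Qed.

Definition unit_eigen (chi : char) (s : sX -> R[i]^o) : Prop :=
  [/\ cmeasurable s, (forall x, normc (s x) = 1)
    & forall t, T t (cls P s) = chi t *: cls P s].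

Lemma unit_eigen_cbounded chi s : unit_eigen chi s -> cbounded s.
Proof. by move=> [ms s1 _]; split => //; exists 1 => x; rewrite s1. Qed.

Lemma unit_eigen_cint chi s : unit_eigen chi s -> cintegrable P s.
Proof. by move=> /unit_eigen_cbounded[ms [M sM]]; exact: (cint_bounded _ ms sM). Qed.

Lemma cboundedZ (a : R[i]) (s : sX -> R[i]^o) : cbounded s -> cbounded (fun x => a * s x).
Proof.
move=> [ms [M sM]]; split; first exact: (cmeasurableM (cmeasurable_cst _) ms).
by exists (normc a * M) => x; rewrite normcM ler_wpM2l ?normc_ge0.
Qed.

Lemma unit_eigen1 : unit_eigen (fun=> 1) (cst 1).
Proof.
split; [exact: cmeasurable_cst|by move=> x; exact: normc1|move=> t].
by rewrite scale1r -L1one_cls sys_op_one.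
Qed.

(** Eigenfunctions multiply because Markov isomorphisms are multiplicative. *)
Lemma unit_eigenM chi psi s r : unit_eigen chi s -> unit_eigen psi r ->
  unit_eigen (fun t => chi t * psi t) (fun x => s x * r x).
Proof.
move=> es er; have [ms s1 Ts] := es; have [mr r1 Tr] := er; split.
- exact: cmeasurableM.
- by move=> x; rewrite normcM s1 r1 mulr1.
move=> t; have bs := unit_eigen_cbounded es; have br := unit_eigen_cbounded er.
have := markov_mul (mT t) bs br (cboundedZ (chi t) bs) (cboundedZ (psi t) br).
rewrite !clsZ; [|exact: unit_eigen_cint er|exact: unit_eigen_cint es].
move=> /(_ (Ts t) (Tr t)) ->; rewrite -clsZ.
  by congr (cls _ _); apply/funext => x; rewrite mulrACA.
apply: (cint_bounded _ (M := 1)); first exact: cmeasurableM.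
by move=> x; rewrite normcM s1 r1 mulr1.
Qed.

Lemma unit_eigenV chi s : characters chi -> unit_eigen chi s ->
  unit_eigen (fun t => (chi t)^-1) (fun x => ((s x)^*)%C).
Proof.
move=> [_ _ chi1] es; have [ms s1 Ts] := es; split.
- exact: cmeasurable_conj.
- by move=> x; rewrite normc_conj.
move=> t; have cs := unit_eigen_cint es.
rewrite (markov_conj (mT t) cs (cintZ (chi t) cs)); last by rewrite Ts clsZ.
have c1 : normc (chi t) = 1 by apply: complexI; rewrite -normr_normc chi1.
rewrite -clsZ; last first.
  apply: (cint_bounded _ (M := 1)); first exact: cmeasurable_conj.
  by move=> x; rewrite normc_conj s1.
by congr (cls _ _); apply/funext => x; rewrite rmorphM /= (unit_conjcV c1).
Qed.

Lemma unit_eigenZ chi s (a : R[i]) : normc a = 1 -> unit_eigen chi s ->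
  unit_eigen chi (fun x => a * s x).
Proof.
move=> a1 es; have [ms s1 Ts] := es; split.
- exact: (cmeasurableM (cmeasurable_cst _) ms).
- by move=> x; rewrite normcM s1 a1 mulr1.
move=> t; rewrite clsZ; last exact: unit_eigen_cint es.
by rewrite (markovZ (mT t)) Ts !scalerA mulrC.
Qed.

Lemma cls_unit_neq0 s : cintegrable P s -> (forall x, normc (s x) = 1) -> cls P s != 0.
Proof.
move=> cs s1; apply/eqP => /(congr1 nrm); rewrite nrm0 nrm_cls//.
under eq_Rintegral do rewrite s1.
by rewrite Rintegral_cst//= probability_setT mulr1 => /eqP; rewrite oner_eq0.
Qed.

(** As [a |-> a *: F] multiplies distances by [nrm F > 0], the eigenvalue inherits
    continuity, multiplicativity and unit modulus from the action. *)
Lemma eigenvalue_character (chi : char) F : F != 0 ->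
  (forall t, T t F = chi t *: F) -> characters chi.
Proof.
move=> F0 TF; have nF : 0 < nrm F.
  by rewrite lt_neqAle nrm_ge0 andbT eq_sym; apply: contra_neq F0 => /nrm_eq0.
have [_ T0 TD Tc] := mX; split.
- move=> t; apply/cvg_nrmP => e e0.
  have /cvg_nrmP/(_ (e * nrm F)) := Tc F t; rewrite mulr_gt0// => /(_ isT).
  apply: filterS => u; rewrite !TF -scalerBl nrmZ ltr_pM2r//.
- move=> u t; have := TD u t F; rewrite !TF (markovZ (mT u)) TF scalerA => /eqP.
  by rewrite -subr_eq0 -scalerBl scaler_eq0 (negPf F0) orbF subr_eq0 mulrC => /eqP.
- move=> t; rewrite normr_normc; congr (_%:C%C).
  by apply: (mulIf (lt0r_neq0 nF)); rewrite -nrmZ -TF (markov_nrm (mT t)) mul1r.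
Qed.

Lemma unit_eigen_point_spectrum chi s : unit_eigen chi s -> point_spectrum X chi.
Proof.
move=> es; have [ms s1 Ts] := es.
have s0 := cls_unit_neq0 (unit_eigen_cint es) s1.
by split; [exact: (eigenvalue_character s0 Ts)|exists (cls P s)].
Qed.

(** The trivial character is the only eigenvalue with an eigenfunction of nonzero
    integral since the action preserves integrals. *)
Lemma unit_eigen_cintegral chi s : unit_eigen chi s -> chi <> (fun=> 1) ->
  cintegral (cls P s) = 0.
Proof.
move=> [ms s1 Ts] chi1; have [t /eqP t1] : exists t, chi t <> 1.
  apply: contra_notP chi1 => /forallNP h; apply/funext => t.
  by apply: contrapT; exact: h.
have := markov_cintegral (mT t) (cls P s); rewrite Ts cintegralZ => /eqP.
rewrite -subr_eq0 -{2}[cintegral _]mul1r -mulrBl mulf_eq0 subr_eq0 (negPf t1).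
by move=> /eqP.
Qed.

Section ergodic.
Hypothesis eX : ergodic X.

Lemma fixed_constant F : (forall t, T t F = F) -> exists a, F = a *: L1one P.
Proof.
case: eX => e e0 fixE TF.
have : [set f | forall t, T t f = f] (L1one P) by exact: sys_op_one.
rewrite fixE => -[b _ b1].
have : [set f | forall t, T t f = f] F by [].
rewrite fixE => -[a _ <-].
have b0 : b != 0.
  apply/eqP => b0; have := nrm_one P; rewrite -b1 b0 scale0r nrm0 => /eqP.
  by rewrite eq_sym oner_eq0.
by exists (a / b); rewrite -b1 scalerA divfK.
Qed.

Lemma fixed_constant_fun (f : sX -> R[i]^o) : cintegrable P f ->
  (forall t, T t (cls P f) = cls P f) -> exists a, {ae P, forall x, f x = a}.
Proof.
move=> cf /fixed_constant[a fa]; exists a.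
by move: fa; rewrite -cls_cst => /(cls_eqP cf (cint_cst P a)).
Qed.

(** The modulus of an eigenfunction is invariant, hence constant by ergodicity; on
    the null set where it differs from the constant [s] is set to [1]. *)
Lemma eigenfunction_unit (chi : char) F : F != 0 -> (forall t, T t F = chi t *: F) ->
  exists (a : R[i]) s, unit_eigen chi s /\ F = a *: cls P s.
Proof.
move=> F0 TF; have [_ _ chi1] := eigenvalue_character F0 TF.
have [f cf Ff] := cls_surj F.
have ca := cint_abs cf.
have [t|a fa] := fixed_constant_fun ca.
  rewrite -L1abs_cls// -Ff; case: (mT t) => _ _ _ <- _.
  rewrite TF Ff -clsZ// !L1abs_cls//; last exact: cintZ.
  by congr (cls _ _); apply/funext => x; rewrite normrM chi1 mul1r.
have [r r0 ar] : exists2 r, 0 <= r & {ae P, forall x, normc (f x) = r}.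
  have [x0 ax0] := filter_ex (FF := probability_ae_proper P) fa.
  exists (normc (f x0)); first exact: normc_ge0.
  apply: filterS fa => x ax; apply: complexI.
  by rewrite -!normr_normc ax ax0.
have rp : 0 < r.
  rewrite lt_neqAle r0 andbT eq_sym; apply: contra_neq F0 => r00.
  apply: nrm_eq0; apply/le_anti; rewrite nrm_ge0 andbT Ff; apply: nrm_cls_le => //.
  by apply: filterS ar => x ->; rewrite r00.
pose A := [set x | normc (f x) = r].
have mf := cint_meas cf.
have mA : measurable A.
  have -> : A = setT `&` (fun x => normc (f x)) @^-1` [set r] by rewrite setTI.
  exact: (cmeasurable_normc mf).
pose s x : R[i]^o := f x * ((r^-1 * \1_A x)%:C%C) + (\1_(~` A) x)%:C%C.
have sA x : A x -> s x = f x * (r^-1)%:C%C.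
  move=> Ax; rewrite /s !indicE (mem_set Ax) mulr1 (memNset (_ : ~ (~` A) x))//.
  by rewrite addr0.
have sNA x : ~ A x -> s x = 1.
  move=> Ax; rewrite /s !indicE (memNset Ax) mulr0 mulr0 add0r.
  by rewrite (mem_set (_ : (~` A) x)).
have ms : cmeasurable s.
  apply: cmeasurableD; last first.
    by apply: cmeasurable_real; apply: measurable_indic; exact: measurableC.
  apply: cmeasurableM => //; apply: cmeasurable_real.
  by apply: measurable_funM => //; exact: measurable_indic.
have s1 x : normc (s x) = 1.
  have [Ax|Ax] := pselect (A x); last by rewrite sNA// normc1.
  by rewrite sA// normcM normc_real ger0_norm ?invr_ge0// Ax mulfV ?gt_eqF.
have cs : cintegrable P s by apply: (cint_bounded _ ms (M := 1)) => x; rewrite s1.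
have Fs : F = r%:C%C *: cls P s.
  rewrite Ff -clsZ//; apply/(cls_eqP cf (cintZ _ cs)).
  apply: filterS ar => x Ax; rewrite sA// mulrCA -rmorphM/= mulfV ?gt_eqF//.
  by rewrite mulr1.
exists r%:C%C, s; split => //; split => // t.
have r0C : r%:C%C != 0 :> R[i] by rewrite (inj_eq (@complexI R)) gt_eqF.
have -> : cls P s = r%:C%C^-1 *: F by rewrite Fs scalerA mulVf// scale1r.
by rewrite (markovZ (mT t)) TF !scalerA mulrC.
Qed.

Lemma point_spectrum_unit chi : point_spectrum X chi -> exists s, unit_eigen chi s.
Proof. by move=> [_ [F F0 /(eigenfunction_unit F0)[a [s [? _]]]]]; exists s. Qed.

(** The quotient of two eigenfunctions for the same character is invariant. *)
Lemma unit_eigen_uniq chi s r : characters chi -> unit_eigen chi s -> unit_eigen chi r ->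
  exists c : R[i], normc c = 1 /\ {ae P, forall x, r x = c * s x}.
Proof.
move=> hchi es er; have [ms s1 Ts] := es; have [mr r1 Tr] := er.
have h := unit_eigenM er (unit_eigenV hchi es).
have [t|c hc] := fixed_constant_fun (unit_eigen_cint h).
  case: h => _ _ ->; rewrite mulfV ?scale1r//.
  by case: hchi => _ _ /(_ t) c1; rewrite -normr_eq0 c1 oner_eq0.
have [x0 cx0] := filter_ex (FF := probability_ae_proper P) hc.
exists c; split; first by rewrite -cx0 normcM normc_conj r1 s1 mulr1.
apply: filterS hc => x <-; rewrite -mulrA [_^*%C * _]mulrC mul_conjc s1 expr1n.
by rewrite mulr1.
Qed.

Lemma point_spectrum_subgroup : character_subgroup (point_spectrum X).
Proof.
split.
- by move=> chi [].
- exact: unit_eigen_point_spectrum unit_eigen1.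
- move=> chi psi /point_spectrum_unit[s es] /point_spectrum_unit[r er].
  exact: unit_eigen_point_spectrum (unit_eigenM es er).
- move=> chi hchi; have [s es] := point_spectrum_unit hchi.
  by apply: unit_eigen_point_spectrum (unit_eigenV _ es); case: hchi.
Qed.

(** The limit of eigenfunctions along an ultrafilter finer than the almost
    everywhere filter is multiplicative, like the evaluation at a point would be;
    normalising eigenfunctions to have limit [1] makes the choice of one
    eigenfunction per eigenvalue multiplicative. *)
Lemma multiplicative_eigenfunctions : exists s : char -> sX -> R[i]^o,
  (forall chi, point_spectrum X chi -> unit_eigen chi (s chi)) /\
  (forall chi psi, point_spectrum X chi -> point_spectrum X psi ->
    {ae P, forall x, s (fun t => chi t * psi t) x = s chi x * s psi x}).
Proof.
have [U [UU PU]] := ultraFilterLemma (probability_ae_proper P).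
have /choice[f fP] (chi : char) : exists s, point_spectrum X chi ->
    unit_eigen chi s /\ s @ U --> (1 : R[i]^o).
  have [hchi|] := pselect (point_spectrum X chi); last by exists (cst 0).
  have [s es] := point_spectrum_unit hchi; have [ms s1 Ts] := es.
  have [z [z1 sz]] := ultra_unit_limit UU s1.
  have z0 : z != 0.
    by apply/eqP => z0; move: z1; rewrite z0 normc0 => /eqP; rewrite eq_sym oner_eq0.
  exists (fun x => z^-1 * s x) => _; split.
    by apply: unit_eigenZ => //; rewrite normcV z1 invr1.
  have h : (fun x => z^-1 * s x) @ U --> (z^-1 * z : R[i]^o).
    exact: (cvgM (cvg_cst (z^-1 : R[i]^o)) sz).
  have E : (z^-1 * z : R[i]^o) = 1 by exact: mulVf z0.
  rewrite E in h.
  exact: h.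
exists f; split=> [chi /fP[]//|chi psi hchi hpsi].
have [_ _ sM _] := point_spectrum_subgroup.
have [e1 l1] := fP _ hchi; have [e2 l2] := fP _ hpsi.
have [e3 l3] := fP _ (sM _ _ hchi hpsi).
have [c [c1 h]] := unit_eigen_uniq (sM _ _ hchi hpsi).1 e3 (unit_eigenM e1 e2).
suff c11 : c = 1 by apply: filterS h => x; rewrite c11 mul1r => ->.
(* Comparing the limits along [U] of both sides shows that the constant is 1. *)
have L1 : (fun x => f chi x * f psi x) @ U --> (1 * 1 : R[i]^o) by exact: cvgM.
have L2 : (fun x => f chi x * f psi x) @ U --> (c * 1 : R[i]^o).
  have : (fun x => c * f (fun t => chi t * psi t) x) @ U --> (c * 1 : R[i]^o).
    exact: (cvgM (cvg_cst (c : R[i]^o)) l3).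
  apply: cvg_trans; apply: near_eq_cvg.
  by apply: PU; apply: filterS h => x ->.
have := cvg_unique (@norm_hausdorff _ (R[i]^o)) L1 L2.
by rewrite !mulr1 => <-.
Qed.

Lemma point_spectrum_group_like : group_like (point_spectrum X).
Proof. by case: point_spectrum_subgroup. Qed.

Lemma eigenfunctions_unit_rep (s : char -> sX -> R[i]^o) :
  (forall chi, point_spectrum X chi -> unit_eigen chi (s chi)) ->
  (forall chi psi, point_spectrum X chi -> point_spectrum X psi ->
    {ae P, forall x, s (fun t => chi t * psi t) x = s chi x * s psi x}) ->
  unit_rep (point_spectrum X) P s.
Proof.
move=> es sM; split => //.
- by move=> chi /es[].
- by move=> chi x /es[].
move=> chi hchi; case: ifPn => /asboolP; last exact: unit_eigen_cintegral (es _ hchi).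
move=> chi1; have e1 := es _ hchi; rewrite chi1 in e1 hchi *.
have one1 : {ae P, forall x, s (fun=> 1) x = 1}.
  have := sM _ _ hchi hchi; apply: filterS => x.
  rewrite (_ : (fun=> 1 * 1) = (fun=> 1)); last by apply/funext => t; rewrite mulr1.
  move=> e; apply: (@mulfI _ (s (fun=> 1) x)); last by rewrite -e mulr1.
  apply/eqP => s0; case: e1 => _ /(_ x) + _.
  by rewrite s0 normc0 => /eqP; rewrite eq_sym oner_eq0.
rewrite -[RHS](cintegral1 P) L1one_cls; congr cintegral.
by apply/(cls_eqP (unit_eigen_cint e1) (cint_cst P 1)).
Qed.

Section discrete_spectrum.
Hypothesis dX : discrete_spectrum X.

(** Invariant subspaces of finite dimension are spanned by eigenvectors, each of
    which is a multiple of the chosen eigenfunction for its character. *)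
Lemma eigenfunctions_dense (s : char -> sX -> R[i]^o) :
  (forall chi, point_spectrum X chi -> unit_eigen chi (s chi)) ->
  unit_rep (point_spectrum X) P s -> trig_dense (point_spectrum X) P s.
Proof.
move=> es rep x e e0.
have [v [V [fV iV] Vv] xv] := (dense_nrmP _).1 dX x e e0.
suff [p hp vp] : exists2 p, trig_on (point_spectrum X) p & v = trig_cls P s p.
  by exists p; rewrite -?vp.
have [_ T0 TD _] := mX.
have Tl t : linear (T t) by case: (mT t).
have [n [E [-> Eeig]]] := finite_dimensional_eigen Tl T0 TD
  (fun t f => markov_nrm (mT t) f) fV iV Vv.
have one i : exists2 p, trig_on (point_spectrum X) p & E i = trig_cls P s p.
  have [Ei0|Ei0] := eqVneq (E i) 0.
    exists [::]; first exact: trig_on_nil.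
    by rewrite (trig_clsE rep) ?big_nil//; exact: trig_on_nil.
  have /choice[chi chiP] := Eeig i.
  have [a [r [er Er]]] := eigenfunction_unit Ei0 chiP.
  have hchi := unit_eigen_point_spectrum er.
  have [c [c1 rc]] := unit_eigen_uniq hchi.1 (es _ hchi) er.
  have hp : trig_on (point_spectrum X) [:: (a * c, chi)].
    by apply: trig_on_cons2 => //; exact: trig_on_nil.
  exists [:: (a * c, chi)] => //.
  rewrite (trig_clsE rep)// big_seq1/= -scalerA Er; congr (_ *: _).
  have cs := unit_eigen_cint (es _ hchi).
  by rewrite -clsZ//; apply/(cls_eqP (unit_eigen_cint er) (cintZ c cs)).
elim: n E {Eeig} one => [|n ih] E one.
  exists [::]; first exact: trig_on_nil.
  by rewrite big_ord0 (trig_clsE rep) ?big_nil//; exact: trig_on_nil.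
have [p hp pE] := ih (fun i => E (lift ord0 i)) (fun i => one _).
have [q hq qE] := one ord0.
exists (q ++ p); first exact: trig_on_cat.
by rewrite big_ord_recl (trig_cls_cat rep)// -qE -pE.
Qed.

End discrete_spectrum.

End ergodic.

End eigenfunctions.

Section classification.
Context {R : realType} {G : topologicalZmodType}.
Implicit Types X : system R G.

Lemma character_neq0 (chi : G -> R[i]^o) : characters chi -> forall t, chi t != 0.
Proof. by move=> [_ _ h] t; rewrite -normr_eq0 h oner_eq0. Qed.

Lemma isomorphic_of_point_spectrum X1 X2 :
  measure_preserving X1 -> ergodic X1 -> discrete_spectrum X1 ->
  measure_preserving X2 -> ergodic X2 -> discrete_spectrum X2 ->
  point_spectrum X1 = point_spectrum X2 -> isomorphic X1 X2.
Proof.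
move=> m1 e1 d1 m2 e2 d2 sp.
have [s1 [u1 mul1]] := multiplicative_eigenfunctions m1 e1.
have [s2 [u2 mul2]] := multiplicative_eigenfunctions m2 e2.
have r1 := eigenfunctions_unit_rep m1 u1 mul1.
have r2 := eigenfunctions_unit_rep m2 u2 mul2.
have dn1 := eigenfunctions_dense m1 e1 d1 u1 r1.
have dn2 := eigenfunctions_dense m2 e2 d2 u2 r2.
rewrite -sp in u2 mul2 r2 dn2.
have gl := point_spectrum_group_like m1 e1.
have ne0 chi : point_spectrum X1 chi -> forall t, chi t != 0.
  by case=> /character_neq0.
have [J [mJ JP]] := unit_rep_isomorphism gl ne0 r1 r2 dn1 dn2.
exists J => // t f; apply: (close_uniq gl ne0 r1 r2 (JP _)).
have [mT1 _ _ _] := m1; have [mT2 _ _ _] := m2.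
apply: (close_intertwine r1 r2 (m := fun chi => chi t) (mT1 t) (mT2 t) _ _ (JP f)).
  by move=> chi /u1[].
by move=> chi /u2[].
Qed.

Lemma isomorphic_point_spectrum X1 X2 :
  isomorphic X1 X2 -> point_spectrum X1 = point_spectrum X2.
Proof.
move=> [J mJ JT]; have [_ [K JK KJ] _ _ _] := mJ.
apply/seteqP; split=> chi [hchi [F F0 TF]]; split => //.
  exists (J F); first by apply: contra_neq F0 => JF; rewrite -[F]JK JF -(markov0 mJ) JK.
  by move=> t; rewrite -JT TF (markovZ mJ).
exists (K F).
  by apply: contra_neq F0 => KF; rewrite -[F]KJ KF (markov0 mJ).
move=> t; rewrite -[LHS]JK JT KJ TF.
by rewrite -{1}[F]KJ -(markovZ mJ) JK.
Qed.

End classification.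

(** * Covering numbers and invariant contents *)

Lemma compact_finite_cover {T : topologicalType} {I : eqType} (K : set T) (D : I -> set T) :
  compact K -> (forall i, open (D i)) -> (forall x, K x -> exists i, D i x) ->
  exists s : seq I, forall x, K x -> exists2 i, i \in s & D i x.
Proof.
move=> cK oD KD; apply: contrapT => /forallNP noS.
pose B (s : seq I) := [set x | K x /\ forall i, i \in s -> ~ D i x].
have FF : ProperFilter (filter_from [set: seq I] B).
  apply: filter_from_proper.
    apply: filter_from_filter; first by exists [::].
    move=> s1 s2 _ _; exists (s1 ++ s2) => // x [Kx nx].
    by split; split => // i si; apply: nx; rewrite mem_cat si ?orbT.
  move=> s _; apply: contrapT => /nonemptyPn nx; apply: (noS s) => x Kx.
  apply: contrapT => /forall2NP ni.
  have : B s x by split => // i si; case: (ni i).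
  by rewrite nx.
have [|p [Kp cp]] := cK _ FF; first by exists [::] => // x [].
have [i Dip] := KD p Kp.
have [||x [[_ nx] Dx]] := cp (B [:: i]) (D i).
- by exists [:: i].
- exact: open_nbhs_nbhs.
- by apply: nx Dx; rewrite mem_head.
Qed.

Lemma ler_limits {R : realType} {T : Type} {F : set_system T} {FF : ProperFilter F}
    (f g : T -> R) (l l' : R) :
  f @ F --> l -> g @ F --> l' -> (\forall x \near F, f x <= g x) -> l <= l'.
Proof.
move=> fl gl fg; rewrite -subr_ge0.
have h : (g \- f) @ F --> l' - l by exact: cvgB.
have <- := cvg_lim (@Rhausdorff R) h.
apply: limr_ge; first by apply/cvg_ex; eexists; exact: h.
by apply: filterS fg => x; rewrite subr_ge0.
Qed.

Section haar_existence.
Variables (R : realType) (H : topologicalGroupType).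
Hypothesis compactH : compact [set: H].
Hypothesis hausdorffH : hausdorff_space H.
Implicit Types (A B K U V : set H) (x y a : H).

Lemma mulg_left_continuous x : continuous (fun y : H => (x * y)%g).
Proof.
move=> y; apply: (@continuous_comp _ _ _ (fun y : H => (x, y))
  (fun z : H * H => (z.1 * z.2)%g)); last exact: mulg_continuous.
by apply: cvg_pair => /=; [exact: cvg_cst|exact: cvg_id].
Qed.

Definition ltrans x A : set H := [set (x * y)%g | y in A].

Lemma ltransE x A : ltrans x A = (fun y => (x^-1 * y)%g) @^-1` A.
Proof.
apply/seteqP; split => [_ [y Ay <-]|y Ay]; first by rewrite /= mulKg.
by exists (x^-1 * y)%g => //; rewrite mulVKg.
Qed.

Lemma ltransV x A : ltrans x^-1%g (ltrans x A) = A.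
Proof. by rewrite !ltransE; apply/funext => y /=; rewrite invgK mulKg. Qed.

Lemma open_ltrans x A : open A -> open (ltrans x A).
Proof. by move=> oA; rewrite ltransE; apply: open_comp => // y _; exact: mulg_left_continuous. Qed.

Lemma compact_ltrans x K : compact K -> compact (ltrans x K).
Proof.
move=> cK; apply: continuous_compact cK.
by apply: continuous_subspaceT; exact: mulg_left_continuous.
Qed.

Lemma closed_compact K : closed K -> compact K.
Proof. by move=> cK; exact: (subclosed_compact cK compactH). Qed.

(** Covering number of [A] by left translates of [U]; the default value [0] is used
    when no finite cover exists. *)
Definition covered A U n := exists s : seq H, size s = n /\
  forall x, A x -> exists2 a, a \in s & U (a^-1 * x)%g.

Definition covering_number A U : nat :=
  xget 0%N [set n | covered A U n /\ forall k, covered A U k -> (n <= k)%N].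

Local Notation N := covering_number.

Lemma coveredS A B U n : A `<=` B -> covered B U n -> covered A U n.
Proof. by move=> AB [s [<- Bs]]; exists s; split => // x /AB/Bs. Qed.

Lemma covering_numberP A U n : covered A U n ->
  covered A U (N A U) /\ forall k, covered A U k -> (N A U <= k)%N.
Proof.
move=> An; rewrite /N; case: xgetP => [_ -> //|].
have ex : exists k, `[< covered A U k >] by exists n; apply/asboolP.
move=> /(_ (ex_minn ex)) []; case: ex_minnP => m /asboolP Am mmin; split => // k Ak.
by apply: mmin; apply/asboolP.
Qed.

Lemma covered_exists U : nbhs 1%g U -> exists n, covered [set: H] U n.
Proof.
rewrite nbhsE => -[V [oV V1] VU].
have [s sP] := @compact_finite_cover H H setT (fun a => (fun x => (a^-1 * x)%g) @^-1` V)
  compactH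
  (fun a => open_comp (fun x _ => @mulg_left_continuous a^-1%g x) oV)
  (fun x _ => ex_intro _ x (eq_ind_r V V1 (mulVg x))).
exists (size s), s; split => // x _; have [a sa Va] := sP x I.
by exists a => //; exact: VU.
Qed.

Lemma covering_numberT U : nbhs 1%g U ->
  forall A, covered A U (N A U) /\ forall k, covered A U k -> (N A U <= k)%N.
Proof.
move=> /covered_exists[n nU] A; apply: (covering_numberP (n := n)).
exact: coveredS nU.
Qed.

Lemma covering_number_mono A B U : nbhs 1%g U -> A `<=` B -> (N A U <= N B U)%N.
Proof.
move=> nU AB; apply: (covering_numberT nU A).2.
by apply: coveredS AB _; exact: (covering_numberT nU B).1.
Qed.

Lemma covering_numberU A B U : nbhs 1%g U -> (N (A `|` B) U <= N A U + N B U)%N.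
Proof.
move=> nU; apply: (covering_numberT nU _).2.
have [s [<- As]] := (covering_numberT nU A).1.
have [r [<- Br]] := (covering_numberT nU B).1.
exists (s ++ r); split; first exact: size_cat.
move=> x [/As[a sa Ua]|/Br[a ra Ua]]; exists a => //; rewrite mem_cat.
  by rewrite sa.
by rewrite ra orbT.
Qed.

Lemma covering_number_ltrans x A U : nbhs 1%g U -> N (ltrans x A) U = N A U.
Proof.
move=> nU; have le z B : (N (ltrans z B) U <= N B U)%N.
  apply: (covering_numberT nU _).2.
  have [s [<- Bs]] := (covering_numberT nU B).1.
  exists [seq (z * a)%g | a <- s]; split; first exact: size_map.
  move=> _ [y By <-]; have [a sa Ua] := Bs y By.
  by exists (z * a)%g; [exact: map_f|rewrite invgM -mulgA mulKg].
apply/eqP; rewrite eqn_leq le /=.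
by rewrite -{1}(ltransV x A) le.
Qed.

(** When no translate of [U] meets both sets, a cover of the union splits into two
    disjoint covers. *)
Lemma covering_number_disjoint A B U : nbhs 1%g U ->
  (forall a x y, A x -> B y -> U (a^-1 * x)%g -> U (a^-1 * y)%g -> False) ->
  (N A U + N B U <= N (A `|` B) U)%N.
Proof.
move=> nU AB; have [s [<- ABs]] := (covering_numberT nU (A `|` B)).1.
pose p a := `[< exists2 x, A x & U (a^-1 * x)%g >].
rewrite -(count_predC p s) leq_add// -size_filter; apply: (covering_numberT nU _).2.
  exists (seq.filter p s); split => // x Ax; have [a sa Ua] := ABs x (or_introl Ax).
  exists a => //; rewrite mem_filter sa andbT; apply/asboolP.
  by exists x.
exists (seq.filter (predC p) s); split => // y By; have [a sa Ua] := ABs y (or_intror By).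
exists a => //; rewrite mem_filter sa andbT; apply/negP => /asboolP[x Ax Ux].
exact: AB Ax By Ux Ua.
Qed.

Lemma covering_number_gt0 U : nbhs 1%g U -> (0 < N [set: H] U)%N.
Proof.
move=> nU; have [s [<- sP]] := (covering_numberT nU setT).1.
by have [a] := sP 1%g I; case: s {sP}.
Qed.

Definition covering_ratio A U : R := (N A U)%:R / (N [set: H] U)%:R.

(** Disjoint compact sets are separated by all small enough translates, because
    [A^-1 B] is a compact set that does not contain the identity. *)
Lemma separating_nbhs A B : compact A -> compact B -> A `&` B = set0 ->
  exists2 V, nbhs 1%g V & forall U a x y, U `<=` V -> A x -> B y ->
    U (a^-1 * x)%g -> U (a^-1 * y)%g -> False.
Proof.
move=> cA cB AB.
pose f (z : H * H) : H := (z.1^-1 * z.2)%g.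
have cf : continuous f.
  move=> z; apply: (@continuous_comp _ _ _ (fun z : H * H => (z.1^-1%g, z.2))
    (fun z : H * H => (z.1 * z.2)%g)); last exact: mulg_continuous.
  apply: cvg_pair => /=; last exact: cvg_snd.
  apply: (@continuous_comp _ _ _ (fun z : H * H => z.1) (fun x : H => x^-1%g)).
    exact: cvg_fst.
  exact: invg_continuous.
have cD : compact (f @` (A `*` B)).
  apply: continuous_compact; last exact: compact_setX.
  exact: continuous_subspaceT.
have nD : nbhs (1%g : H) (~` (f @` (A `*` B))).
  apply: open_nbhs_nbhs; split; first by apply: closed_openC; exact: compact_closed.
  move=> [[x y] [/= Ax By]] /(congr1 (fun z => x * z)%g).
  rewrite mulVKg mulg1 => xy; have : (A `&` B) x by split => //; rewrite -xy.
  by rewrite AB.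
have : nbhs (1%g : H, 1%g : H) (f @^-1` (~` (f @` (A `*` B)))).
  by apply: cf; rewrite /f/= invg1 mulg1.
move=> [[V W] /= [nV nW] VW]; exists (V `&` W); first exact: filterI.
move=> U a x y UV Ax By /UV[Vx _] /UV[_ Wy].
have : (f @^-1` (~` (f @` (A `*` B)))) ((a^-1 * x)%g, (a^-1 * y)%g) by exact: VW.
apply; exists (x, y) => //.
by rewrite /f/= invgM invgK -mulgA mulVKg.
Qed.

Let small_sets : set_system (set H) :=
  filter_from (nbhs (1%g : H)) (fun V => [set U | nbhs (1%g : H) U /\ U `<=` V]).

Let small_sets_proper : ProperFilter small_sets.
Proof.
apply: filter_from_proper; last by move=> V nV; exists V; split.
apply: filter_from_filter; first by exists setT; exact: filterT.
move=> V W nV nW; exists (V `&` W); first exact: filterI.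
by move=> U [nU UVW]; split; split => // x /UVW[].
Qed.

(** The content is the limit of the covering ratios along an ultrafilter of
    neighbourhoods shrinking to the identity, which makes subadditivity an equality
    on disjoint compact sets. *)
Lemma haar_content : exists lam : set H -> R,
  [/\ (forall A B, A `<=` B -> lam A <= lam B),
      (forall A B, lam (A `|` B) <= lam A + lam B),
      (forall A B, compact A -> compact B -> A `&` B = set0 ->
        lam A + lam B <= lam (A `|` B)),
      (forall x A, lam (ltrans x A) = lam A)
    & lam set0 = 0 /\ lam [set: H] = 1].
Proof.
have [W [WU sW]] := ultraFilterLemma small_sets_proper.
have WP : ProperFilter W by exact: ultra_proper.
have nearW0 : \forall U \near W, nbhs (1%g : H) U.
  by apply: sW; exists setT; [exact: filterT|move=> U []].
have h01 A U : `[(0 : R), 1]%classic (covering_ratio A U).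
  rewrite /= in_itv/= divr_ge0//=.
  have [[n nU]|nc] := pselect (exists n, covered [set: H] U n).
    have [c1 m1] := covering_numberP nU.
    have [N0|Np] := posnP (N [set: H] U).
      by rewrite /covering_ratio N0 invr0 mulr0.
    rewrite /covering_ratio ler_pdivrMr ?ltr0n// mul1r ler_nat.
    have cA : covered A U (N [set: H] U) by exact: coveredS c1.
    exact: (covering_numberP cA).2.
  rewrite /covering_ratio (_ : N [set: H] U = 0%N) ?invr0 ?mulr0//.
  rewrite /covering_number; case: xgetP => // n _ [cn _].
  by exfalso; apply: nc; exists n.
have /choice[lam lamP] A : exists y : R, covering_ratio A @ W --> y.
  have [y _ yP] := ultra_compact_cvg WU (@segment_compact R 0 1) (h01 A).
  by exists y.
have lamD A B : (covering_ratio A \+ covering_ratio B) @ W --> lam A + lam B.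
  by apply: cvgD; exact: lamP.
exists lam; split.
- move=> A B AB; apply: (ler_limits (lamP A) (lamP B)).
  apply: filterS nearW0 => U nU.
  by rewrite /covering_ratio ler_wpM2r// ler_nat covering_number_mono.
- move=> A B; apply: (ler_limits (lamP (A `|` B)) (lamD A B)).
  apply: filterS nearW0 => U nU.
  by rewrite /covering_ratio /= -mulrDl ler_wpM2r// -natrD ler_nat covering_numberU.
- move=> A B cA cB AB; apply: (ler_limits (lamD A B) (lamP (A `|` B))).
  have [V nV sepV] := separating_nbhs cA cB AB.
  apply: sW; exists V => // U [nU UV].
  rewrite /covering_ratio /= -mulrDl ler_wpM2r// -natrD ler_nat.
  by apply: covering_number_disjoint => // a x y; exact: sepV.
- move=> x A; apply/eqP; rewrite eq_le; apply/andP; split.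
    apply: (ler_limits (lamP (ltrans x A)) (lamP A)).
    by apply: filterS nearW0 => U nU; rewrite /covering_ratio covering_number_ltrans.
  apply: (ler_limits (lamP A) (lamP (ltrans x A))).
  by apply: filterS nearW0 => U nU; rewrite /covering_ratio covering_number_ltrans.
- split; apply/eqP; rewrite eq_le; apply/andP; split.
  + apply: (ler_limits (lamP set0) (cvg_cst 0)).
    apply: filterS nearW0 => U nU; rewrite /covering_ratio (_ : N set0 U = 0%N) ?mul0r//.
    apply/eqP; rewrite -leqn0; apply: (covering_numberT nU _).2.
    by exists [::].
  + apply: (ler_limits (cvg_cst 0) (lamP set0)).
    by apply: nearW => U; rewrite divr_ge0.
  + have c1 : (fun=> 1 : R) @ W --> (1 : R) by exact: cvg_cst.
    apply: (ler_limits (lamP [set: H]) c1).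
    by apply: nearW => U; have /= := h01 setT U; rewrite in_itv/= => /andP[].
  + have c1 : (fun=> 1 : R) @ W --> (1 : R) by exact: cvg_cst.
    apply: (ler_limits c1 (lamP [set: H])).
    apply: filterS nearW0 => U nU; rewrite /covering_ratio divff//.
    by rewrite pnatr_eq0 -lt0n covering_number_gt0.
Qed.

End haar_existence.

(** * Existence of Haar measure *)

Section haar_measure.
Variables (R : realType) (H : topologicalGroupType).
Hypothesis compactH : compact [set: H].
Hypothesis hausdorffH : hausdorff_space H.
Variable lam : set H -> R.
Implicit Types (A B K U V : set H) (x : H).
Hypothesis lam_mono : forall A B, A `<=` B -> lam A <= lam B.
Hypothesis lamU : forall A B, lam (A `|` B) <= lam A + lam B.
Hypothesis lam_disjoint : forall A B, compact A -> compact B -> A `&` B = set0 ->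
  lam A + lam B <= lam (A `|` B).
Hypothesis lam_ltrans : forall x A, lam (ltrans x A) = lam A.
Hypothesis lam0 : lam set0 = 0.
Hypothesis lam1 : lam [set: H] = 1.

Local Open Scope ereal_scope.

(** The content extends to open sets from inside and then to all sets from
    outside, which gives an outer measure. *)
Definition content_open U : \bar R :=
  ereal_sup [set (lam K)%:E | K in [set K | compact K /\ K `<=` U]].

Definition content_outer A : \bar R :=
  ereal_inf [set content_open U | U in [set U | open U /\ A `<=` U]].

Local Notation nu := content_open.
Local Notation mu := content_outer.

Let nu_ub K U : compact K -> K `<=` U -> (lam K)%:E <= nu U.
Proof. by move=> cK KU; apply: ereal_sup_ubound; exists K. Qed.

Let nu_le U (M : \bar R) :
  (forall K, compact K -> K `<=` U -> (lam K)%:E <= M) -> nu U <= M.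
Proof. by move=> UM; apply: ge_ereal_sup => _ [K [cK KU] <-]; exact: UM. Qed.

Let nu_ge0 U : 0 <= nu U.
Proof.
rewrite -[leLHS]/(0%R%:E) -lam0; apply: nu_ub; last exact: sub0set.
exact: compact0.
Qed.

Let nu_mono U V : U `<=` V -> nu U <= nu V.
Proof. by move=> UV; apply: nu_le => K cK KU; apply: nu_ub => //; exact: subset_trans KU UV. Qed.

Let nu_le1 U : nu U <= 1.
Proof. by apply: nu_le => K _ _; rewrite lee_fin -lam1 lam_mono. Qed.

Let nuT : nu setT = 1.
Proof.
by apply/eqP; rewrite eq_le nu_le1 /= -[leLHS]/(1%R%:E) -lam1 nu_ub.
Qed.

(** A compact set covered by two open sets splits into compact pieces, one in
    each, because the space is normal. *)
Let nuU U V : open U -> open V -> nu (U `|` V) <= nu U + nu V.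
Proof.
move=> oU oV; apply: nu_le => K cK KUV.
have clK : closed K := compact_closed hausdorffH cK.
have clKV : closed (K `\` V) by apply: closedI => //; exact: open_closedC.
have KVU : set_nbhs (K `\` V) U.
  apply/set_nbhsP; exists U; split => // x [Kx nVx].
  by case: (KUV x Kx).
have [W /set_nbhsP[W' [oW' KW' W'W]] WU] := compact_normal hausdorffH compactH clKV KVU.
pose K1 := K `&` closure W; pose K2 := K `\` W'.
have cK1 : compact K1.
  apply: (closed_compact compactH); apply: closedI => //; exact: closed_closure.
have cK2 : compact K2.
  by apply: (closed_compact compactH); apply: closedI => //; exact: open_closedC.
have K12 : K `<=` K1 `|` K2.
  move=> x Kx; have [W'x|nW'x] := pselect (W' x); last by right.
  by left; split => //; apply: subset_closure; exact: W'W.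
have h : (lam K <= lam K1 + lam K2)%R by exact: le_trans (lam_mono K12) (lamU _ _).
rewrite (@le_trans _ _ (lam K1 + lam K2)%:E) ?lee_fin// EFinD.
rewrite leeD//; apply: nu_ub => //; first by move=> x [_ /WU].
move=> x [Kx nW'x]; apply: contrapT => nVx; apply: nW'x; exact: KW'.
Qed.

Let nu_bigcup (F : nat -> set H) : (forall n, open (F n)) ->
  nu (\bigcup_n F n) <= \sum_(0 <= n <oo) nu (F n).
Proof.
move=> oF; apply: nu_le => K cK KF.
have [s sP] := compact_finite_cover cK oF (fun x Kx => let: ex_intro2 i _ Fi := KF x Kx
  in ex_intro _ i Fi).
pose N := (\max_(i <- s) i).+1.
have KN : K `<=` \big[setU/set0]_(0 <= i < N) F i.
  move=> x /sP[i si Fix]; rewrite big_mkord -bigcup_mkord/=.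
  exists i => //=; rewrite ltnS; exact: leq_bigmax_seq.
apply: (@le_trans _ _ (nu (\big[setU/set0]_(0 <= i < N) F i))); first exact: nu_ub.
apply: (@le_trans _ _ (\sum_(0 <= i < N) nu (F i))); last exact: nneseries_lim_ge.
elim: N {KN} => [|N ih].
  by rewrite !big_nil; apply: nu_le => K' _; rewrite subset0 => ->; rewrite lam0.
rewrite !big_nat_recr//=; apply: (le_trans (nuU _ _)) => //.
  by rewrite big_mkord -bigcup_mkord; apply: bigcup_open => i _; exact: oF.
exact: leeD.
Qed.

Let mu_open U : open U -> mu U = nu U.
Proof.
move=> oU; apply/eqP; rewrite eq_le; apply/andP; split.
  by apply: ereal_inf_lbound; exists U => //; split.
by apply: le_ereal_inf_tmp => _ [V [oV UV] <-]; exact: nu_mono.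
Qed.

Let mu_mono A B : A `<=` B -> mu A <= mu B.
Proof.
move=> AB; apply: le_ereal_inf_tmp => _ [V [oV BV] <-].
by apply: ereal_inf_lbound; exists V => //; split => //; exact: subset_trans AB BV.
Qed.

Let mu_ge0 A : 0 <= mu A.
Proof. by apply: le_ereal_inf_tmp => _ [V _ <-]; exact: nu_ge0. Qed.

Let mu0 : mu set0 = 0.
Proof.
rewrite mu_open; last exact: open0.
apply/eqP; rewrite eq_le nu_ge0 andbT; apply: nu_le => K _; rewrite subset0 => ->.
by rewrite lam0.
Qed.

Let mu_fin A : mu A \is a fin_num.
Proof.
rewrite ge0_fin_numE; last exact: mu_ge0.
apply: le_lt_trans (mu_mono (@subsetT _ A)) _.
by rewrite mu_open ?nuT ?ltry//; exact: openT.
Qed.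

Let mu_approx A (e : R) : (0 < e)%R ->
  exists U, [/\ open U, A `<=` U & nu U <= mu A + e%:E].
Proof.
move=> e0; have [_ [U [oU AU] <-] Ue] := lb_ereal_inf_adherent e0 (mu_fin A).
by exists U; split => //; exact: ltW.
Qed.

Let mu_sigma_subadditive : sigma_subadditive (mu : set (group_pointed H) -> \bar R).
Proof.
move=> F; apply/lee_addgt0Pr => e e0.
have e_gt0 n : (0 < e / (2 ^ n.+1)%:R)%R by rewrite divr_gt0// ltr0n expn_gt0.
have /choice[U UP] n := mu_approx (F n) (e_gt0 n).
apply: (@le_trans _ _ (\sum_(0 <= n <oo) (mu (F n) + (e / (2 ^ n.+1)%:R)%:E))).
  apply: (@le_trans _ _ (\sum_(0 <= n <oo) nu (U n))); last first.
    by apply: lee_nneseries => // n _; case: (UP n).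
  apply: le_trans (nu_bigcup _); last by move=> n; case: (UP n).
  apply: ereal_inf_lbound; exists (\bigcup_n U n) => //; split.
    by apply: bigcup_open => n _; case: (UP n).
  by apply: subset_bigcup => n _; case: (UP n).
by apply: epsilon_trick => //; exact: ltW.
Qed.

Let outer : {outer_measure set (group_pointed H) -> \bar R} :=
  HB.pack (mu : set (group_pointed H) -> \bar R)
    (@isOuterMeasure.Build R (group_pointed H) mu mu0 mu_ge0 (fun A B AB => mu_mono AB)
      mu_sigma_subadditive).

(** Compact sets [K] in [V `&` U] and [L] in [V `\` K] are disjoint, so that the
    content of their union, which is at most that of [V], is the sum of theirs. *)
Let open_caratheodory U : open U -> outer.-caratheodory (U : set (group_pointed H)).
Proof.
move=> oU; apply: le_caratheodory_measurable => X; rewrite /=.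
apply: le_ereal_inf_tmp => _ [V [oV XV] <-].
apply: (@le_trans _ _ (mu (V `&` U) + mu (V `&` ~` U))).
  by apply: leeD; apply: mu_mono; exact: setSI.
rewrite [mu (V `&` U)]mu_open; last exact: openI.
rewrite -leeBrDr; last exact: mu_fin.
apply: nu_le => K cK KVU; have clK := compact_closed hausdorffH cK.
rewrite leeBrDr; last exact: mu_fin.
have oVK : open (V `\` K) by apply: openI => //; exact: closed_openC.
apply: (@le_trans _ _ ((lam K)%:E + nu (V `\` K))).
  rewrite leeD2l// -mu_open//; apply: mu_mono => x [Vx nUx]; split => // Kx.
  by have [_] := KVU x Kx.
rewrite addeC -leeBrDr//.
apply: nu_le => L cL LVK; rewrite leeBrDr// -EFinD addrC.
apply: (@le_trans _ _ (lam (K `|` L))%:E).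
  rewrite lee_fin; apply: lam_disjoint => //; apply/seteqP; split => // x [Kx Lx].
  by have [_] := LVK x Lx.
apply: nu_ub; first exact: compactU.
by move=> x [/KVU[]//|/LVK[]].
Qed.

Let borel_caratheodory (A : set (borel H)) : measurable A ->
  outer.-caratheodory (A : set (group_pointed H)).
Proof.
move=> mA; suff : (outer.-cara).-measurable (A : set (caratheodory_type outer)) by [].
move: A mA; apply: smallest_sub.
  split.
  - exact: measurable0.
  - by move=> A mA; rewrite setTD; exact: measurableC.
  - by move=> F mF; exact: bigcup_measurable.
by move=> U oU; exact: open_caratheodory.
Qed.

Let m (A : set (borel H)) : \bar R := mu A.

Let m_sigma_additive : semi_sigma_additive m.
Proof.
move=> F mF tF mUF; have := @caratheodory_measure_sigma_additive _ _ outer F.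
apply => //; first by move=> n; exact: borel_caratheodory.
exact: borel_caratheodory.
Qed.

Let m1 : m setT = 1.
Proof. by rewrite /m mu_open ?nuT//; exact: openT. Qed.

Let measure_m : {measure set (borel H) -> \bar R} :=
  HB.pack m (isMeasure.Build _ (borel H) R m mu0 mu_ge0 m_sigma_additive).

Definition haar_of_content : probability (borel H) R :=
  HB.pack (Measure.sort measure_m)
   (Measure_isProbability.Build _ (borel H) R measure_m m1).

Let open_borel U : open U -> measurable (U : set (borel H)).
Proof. by move=> oU; exact: sub_sigma_algebra. Qed.

Let nu_ltrans x U : nu (ltrans x U) <= nu U.
Proof.
apply: nu_le => K cK KU; rewrite -(lam_ltrans x^-1%g).
apply: nu_ub; first exact: compact_ltrans.
move=> _ [y Ky <-]; have [z Uz <-] := KU y Ky.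
by rewrite mulKg.
Qed.

Let mu_ltrans x A : mu (ltrans x A) <= mu A.
Proof.
apply: le_ereal_inf_tmp => _ [V [oV AV] <-]; apply: le_trans (nu_ltrans x V).
apply: ereal_inf_lbound; exists (ltrans x V) => //; split; first exact: open_ltrans.
by move=> _ [y Ay <-]; exists y => //; exact: AV.
Qed.

(** Outer regularity is built into the definition of the measure; taking
    complements turns it into inner regularity, since [H] is compact. *)
Lemma is_haar_of_content : is_haar haar_of_content.
Proof.
split.
- move=> x A mA; apply/eqP; rewrite eq_le; apply/andP; split; first exact: mu_ltrans.
  rewrite -[A in leLHS](ltransV x); exact: mu_ltrans.
- move=> A mA; apply: eq_trans (erefl (mu A)) _; congr ereal_inf.
  by apply/seteqP; split => _ [U [oU AU] <-]; exists U => //; rewrite -mu_open.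
- move=> A mA; apply/eqP; rewrite eq_le; apply/andP; split; last first.
    apply: ge_ereal_sup => _ [K [cK KA] <-]; exact: mu_mono.
  apply/lee_addgt0Pr => e e0.
  have [U [oU AU Ue]] := mu_approx (~` A) e0.
  have mU := open_borel oU.
  have UA : ~` U `<=` A by move=> x nUx; apply: contrapT => /AU.
  have cU : compact (~` U) by apply: (closed_compact compactH); exact: open_closedC.
  apply: (@le_trans _ _ (haar_of_content (~` U : set (borel H)) + e%:E)); last first.
    by rewrite leeD2r//; apply: ereal_sup_ubound; exists (~` U).
  have -> : haar_of_content (~` U : set (borel H)) = 1 - haar_of_content U.
    by rewrite -probability_setC.
  have -> : haar_of_content A = 1 - haar_of_content (~` A : set (borel H)).
    by rewrite -probability_setC ?setCK//; exact: measurableC.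
  have fA : haar_of_content (~` A : set (borel H)) \is a fin_num by exact: mu_fin.
  have fU : haar_of_content U \is a fin_num by exact: mu_fin.
  have : haar_of_content U <= haar_of_content (~` A : set (borel H)) + e%:E.
    by move: Ue; rewrite -mu_open.
  rewrite -(fineK fA) -(fineK fU).
  move: (fine _) (fine _) => a b; rewrite -EFinD lee_fin => ab.
  have oneB (c : R) : 1 - c%:E = (1 - c)%:E by [].
  by rewrite !oneB -EFinD lee_fin; lra.
Qed.

End haar_measure.

Lemma haar_measure_exists (R : realType) (H : topologicalGroupType) :
  compact [set: H] -> hausdorff_space H -> exists m : probability (borel H) R, is_haar m.
Proof.
move=> cH hH; have [lam [l1 l2 l3 l4 [l5 l6]]] := haar_content R cH hH.
by exists (haar_of_content cH hH l1 l2 l3 l5 l6); exact: is_haar_of_content.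
Qed.

(** * Density of trigonometric polynomials for Haar measure *)

Section trigonometric_density.
Import HBSimple.
Context {R : realType} {G : Type} {H : topologicalGroupType}.
Local Notation char := (G -> R[i]^o).
Variable m : probability (borel H) R.
Hypothesis hm : is_haar m.
Hypothesis compactH : compact [set: H].
Hypothesis hausdorffH : hausdorff_space H.
Variable sigma : set char.
Hypothesis sigmaG : group_like sigma.
Hypothesis sigma_neq0 : forall chi, sigma chi -> forall t, chi t != 0.
Variable s : char -> borel H -> R[i]^o.
Hypothesis srep : unit_rep sigma m s.
Hypothesis s_continuous : forall chi, sigma chi -> continuous (s chi : H -> R[i]^o).
Hypothesis s_separates : forall x y : H, x <> y ->
  exists2 chi, sigma chi & s chi x <> s chi y.

Local Notation adherent x := (trig_close sigma (P1 := m) (P2 := m) s s x x).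
Local Notation rcls u := (cls m (fun x => (u x)%:C%C)).

Let adherent_lim x : (forall e : R, 0 < e -> exists2 y : L1 m, adherent y & nrm (x - y) < e) ->
  adherent x.
Proof.
move=> h e e0; have e20 : 0 < e / 2 by rewrite divr_gt0.
have [y ay xy] := h _ e20; have [p [hp yp _]] := ay _ e20.
have xp : nrm (x - trig_cls m s p) < e.
  by rewrite (le_lt_trans (nrm_triangle y _ _))// [e]splitr ltrD.
by exists p.
Qed.

(** Real functions in the closure of the trigonometric polynomials. Being close to
    itself through [s] on both sides expresses membership in the closure, so that the
    lemmas on [trig_close] apply. *)
Let realA (u : borel H -> R) : Prop :=
  m.-integrable setT (EFin \o u) /\ adherent (rcls u).

Let realA_cst (c : R) : realA (cst c).
Proof.
split; first exact: finite_measure_integrable_cst.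
rewrite (_ : (fun x => (cst c x)%:C%C) = cst (c%:C%C : R[i]))// cls_cst.
have a1 := close_one sigmaG srep srep.
have a0 : adherent (0 : L1 m).
  have := close_linear srep srep (-1) a1 a1.
  by rewrite scaleN1r addNr.
by have := close_linear srep srep c%:C%C a1 a0; rewrite addr0.
Qed.

Let realA_linear (a : R) (u v : borel H -> R) : realA u -> realA v ->
  realA (fun x => a * u x + v x).
Proof.
move=> [iu au] [iv av]; split.
  exact: (integrableD measurableT (integrableZl measurableT a iu) iv).
have -> : rcls (fun x => a * u x + v x) = a%:C%C *: rcls u + rcls v.
  rewrite -clsZ; last exact: cint_real.
  rewrite -clsD; [|by apply: cintZ; exact: cint_real|exact: cint_real].
  by congr (cls _ _); apply/funext => x; rewrite rmorphD rmorphM.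
exact: (close_linear srep srep).
Qed.

Let realA_abs (u : borel H -> R) : realA u -> realA (fun x => `|u x|).
Proof.
move=> [iu au]; split; first exact: integrable_norm.
have -> : rcls (fun x => `|u x|) = L1abs (rcls u).
  rewrite L1abs_cls; last exact: cint_real.
  by congr (cls _ _); apply/funext => x; rewrite normr_normc normc_real.
exact: (close_abs sigmaG sigma_neq0 srep srep).
Qed.

Let realA_ext (u v : borel H -> R) : u =1 v -> realA u -> realA v.
Proof. by move=> /funext ->. Qed.

Let realA_min (u v : borel H -> R) : realA u -> realA v ->
  realA (fun x => Num.min (u x) (v x)).
Proof.
move=> au av; have a0 := realA_cst 0.
have d := realA_linear (-1) av au.
have := realA_linear 2^-1 (realA_linear (-1) (realA_abs d) (realA_linear 1 au av)) a0.
apply: realA_ext => x /=; rewrite addr0 !mulN1r mul1r.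
by rewrite minr_absE [RHS]mulrC; congr (_ * _); rewrite addrC [u x - v x]addrC.
Qed.

Let nrm_rclsB (u v : borel H -> R) : m.-integrable setT (EFin \o u) ->
  m.-integrable setT (EFin \o v) -> nrm (rcls u - rcls v) = \int[m]_x `|u x - v x|.
Proof.
move=> iu iv; rewrite -clsB; [|exact: cint_real..].
rewrite nrm_cls; last by apply: cintB; exact: cint_real.
by apply: eq_Rintegral => x _; rewrite -rmorphB normc_real.
Qed.

Let realA_lim (u : borel H -> R) (v : nat -> borel H -> R) :
  m.-integrable setT (EFin \o u) -> (forall n, realA (v n)) ->
  (\int[m]_x `|(u x)%:E - (v n x)%:E|)%E @[n --> \oo] --> 0%E -> realA u.
Proof.
move=> iu av uv; split => //; apply: adherent_lim => e e0.
have /fine_cvg/cvgrPdist_lt/(_ _ e0)[N _ /(_ N (leqnn N))] := uv.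
rewrite /= sub0r normrN => h; have [iN aN] := av N.
exists (rcls (v N)) => //; rewrite nrm_rclsB//.
exact: le_lt_trans (ler_norm _) h.
Qed.

(** [min 1 (n u^+)] increases to the indicator function of [u > 0]. *)
Let realA_indic_gt0 (u : borel H -> R) : realA u -> realA (\1_[set x | 0 < u x]).
Proof.
move=> au; set B := [set x | 0 < u x].
have iu := au.1; have mu := measurable_realintegrable iu.
have mB : measurable B.
  have -> : B = setT `&` u @^-1` `]0, +oo[.
    by rewrite setTI; apply/seteqP; split => x; rewrite /= in_itv/= andbT.
  exact: mu.
pose v n x := Num.min 1 (n%:R * - Num.min (- u x) 0).
have av n : realA (v n).
  apply: realA_min; first exact: realA_cst.
  have a0 := realA_cst 0.
  have a1 : realA (fun x => - u x).
    by apply: realA_ext (realA_linear (-1) au a0) => x; rewrite addr0 mulN1r.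
  apply: realA_ext (realA_linear (- n%:R) (realA_min a1 a0) a0) => x /=.
  by rewrite addr0 mulrN mulNr.
have iB : m.-integrable setT (EFin \o \1_B) by exact: integrable_indic.
have v0 x : u x <= 0 -> forall n, v n x = 0.
  move=> ux n; rewrite /v (min_r (_ : 0 <= - u x)) ?oppr_ge0//.
  by rewrite oppr0 mulr0 min_r.
have vp x : 0 < u x -> forall n, v n x = Num.min 1 (n%:R * u x).
  by move=> ux n; rewrite /v (min_l (_ : - u x <= 0)) ?opprK// oppr_le0 ltW.
have v01 n x : `|v n x| <= 1.
  have [ux|ux] := leP (u x) 0; first by rewrite v0// normr0.
  by rewrite vp// ger0_norm ?ge_min ?lexx// le_min ler01 mulr_ge0// ltW.
have vB x : (EFin \o v n) x @[n --> \oo] --> (EFin \o \1_B) x.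
  apply: cvg_EFin; first exact: nearW.
  rewrite /= indicE; have [ux|ux] := leP (u x) 0.
    rewrite memNset; last by rewrite /B /= ltNge ux.
    by apply: cvg_near_cst; apply: nearW => n; exact: (v0 x ux n).
  rewrite mem_set//; apply: cvg_near_cst.
  exists (Num.truncn (u x)^-1).+1 => // n /= hn.
  rewrite vp// min_l// -ler_pdivrMr// mul1r ltW//.
  by rewrite (lt_le_trans (truncnS_gt _))// ler_nat.
have i1 : m.-integrable setT (EFin \o cst (1:R)) by exact: finite_measure_integrable_cst.
have mv k : measurable_fun setT (EFin \o v k) by exact: measurable_int (av k).1.
have aecvg : {ae m, forall x, setT x -> (EFin \o v n) x @[n --> \oo] --> (EFin \o \1_B) x}.
  by apply: aeW => x _; exact: vB.
have aele : {ae m, forall x n, setT x -> (`|(EFin \o v n) x| <= (EFin \o cst 1%R) x)%E}.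
  by apply: aeW => x n _; rewrite lee_fin.
have [_ c _] := dominated_convergence measurableT mv (measurable_int _ iB) aecvg i1 aele.
apply: (realA_lim iB av); apply: cvg_trans c; apply: near_eq_cvg.
apply: nearW => n; apply: eq_integral => x _.
by rewrite -!EFinB /= distrC.
Qed.

Let setA (B : set (borel H)) := measurable B /\ realA (\1_B).

Let setA_C B : setA B -> setA (~` B).
Proof.
move=> [mB aB]; split; first exact: measurableC.
apply: realA_ext (realA_linear (-1) aB (realA_cst 1)) => x /=.
rewrite !indicE in_setC mulN1r addrC.
by case: (x \in B); rewrite /= ?subrr ?subr0.
Qed.

Let setA_I B C : setA B -> setA C -> setA (B `&` C).
Proof.
move=> [mB aB] [mC aC]; split; first exact: measurableI.
apply: realA_ext (realA_min aB aC) => x /=.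
rewrite !indicE in_setI.
by rewrite -natr_min; case: (x \in B); case: (x \in C).
Qed.

Let setA_T : setA setT.
Proof.
split => //; apply: realA_ext (realA_cst 1) => x.
by rewrite indicE in_setT.
Qed.

Let setA_bigcap (I : eqType) (r : seq I) (F : I -> set (borel H)) :
  (forall i, setA (F i)) -> setA [set x | forall i, i \in r -> F i x].
Proof.
move=> aF; elim: r => [|i r ih].
  rewrite (_ : [set x | _] = setT); first exact: setA_T.
  by apply/seteqP; split.
rewrite (_ : [set x | _] = F i `&` [set x | forall i, i \in r -> F i x]).
  exact: setA_I.
apply/seteqP; split => x /=.
  move=> h; split; first by apply: h; rewrite mem_head.
  by move=> j jr; apply: h; rewrite in_cons jr orbT.
by move=> [Fi h] j; rewrite in_cons => /predU1P[->//|/h].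
Qed.

Let setA_bigcup (I : eqType) (r : seq I) (F : I -> set (borel H)) :
  (forall i, setA (F i)) -> setA [set x | exists2 i, i \in r & F i x].
Proof.
move=> aF; rewrite -[X in setA X]setCK; apply: setA_C.
have := setA_bigcap r (fun i => setA_C (aF i)).
congr (setA _); apply/seteqP; split => x /=.
  by move=> h [i ir]; exact: h.
by move=> h i ir Fi; apply: h; exists i.
Qed.

Let setA_ball chi (w : R[i]) (r : R) : sigma chi ->
  setA [set x | normc (s chi x - w) < r].
Proof.
move=> hchi; have cchi := unit_rep_cint srep hchi.
have ic : cintegrable m (fun x => s chi x - w).
  exact: (cintB cchi (cint_cst m w)).
have iu := integrable_normc ic.
have hp : trig_on sigma [:: (1, chi)].
  by apply: trig_on_cons2 => //; exact: trig_on_nil.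
have a1 : adherent (cls m (s chi)).
  have := close_trig hp (P1 := m) (P2 := m) (s1 := s) (s2 := s).
  by rewrite (trig_clsE srep hp) big_seq1 scale1r.
have aw : adherent (cls m (fun x => s chi x - w)).
  rewrite (clsB cchi (cint_cst m w)) cls_cst addrC -scaleNr.
  exact: (close_linear srep srep _ (close_one sigmaG srep srep)).
have au : realA (fun x => normc (s chi x - w)).
  split => //.
  have := close_abs sigmaG sigma_neq0 srep srep aw.
  rewrite L1abs_cls//; congr (trig_close _ _ _ (cls _ _) (cls _ _));
    by apply/funext => x; rewrite normr_normc.
have := realA_indic_gt0 (realA_linear (-1) au (realA_cst r)).
have -> : [set x | 0 < -1 * normc (s chi x - w) + cst r x] =
    [set x | normc (s chi x - w) < r].
  by apply/seteqP; split => x /=; rewrite mulN1r [- _ + _]addrC subr_gt0.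
split => //.
have -> : [set x | normc (s chi x - w) < r] =
    setT `&` (fun x => normc (s chi x - w)) @^-1` `]-oo, r[.
  by rewrite setTI; apply/seteqP; split => x; rewrite /= in_itv.
exact: (measurable_realintegrable iu).
Qed.

Let open_ball_preimage chi (w : R[i]) (r : R) : sigma chi ->
  open ([set x | normc (s chi x - w) < r] : set H).
Proof.
move=> hchi.
have -> : [set x | normc (s chi x - w) < r] =
    (s chi : H -> R[i]^o) @^-1` (ball (w : R[i]^o) r%:C%C).
  apply/seteqP; split => x /=.
    by rewrite -ball_normE /ball_/= distrC normr_normc ltcR.
  by rewrite -ball_normE /ball_/= distrC normr_normc ltcR.
have [r0|r0] := ltP 0 r.
  by apply: open_comp; [move=> x _; exact: s_continuous|apply: ball_open; rewrite ltcR].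
rewrite (_ : _ @^-1` _ = set0); first exact: open0.
apply/seteqP; split => x //=; rewrite -ball_normE /ball_/= normr_normc ltcR.
by rewrite ltNge (le_trans r0)// normc_ge0.
Qed.

(** The compact complement of [U] is covered by finitely many sets, each separated
    from [x] by one of the functions. *)
Let setA_base (U : set H) (x : H) : open U -> U x ->
  exists B : set H, [/\ open B, setA B, B x & B `<=` U].
Proof.
move=> oU Ux.
have /choice[chi chiP] (y : H) : exists chi : char, sigma chi /\ (~ U y -> s chi x <> s chi y).
  have [->|xy] := pselect (y = x).
    by case: sigmaG => h _ _; exists (fun=> 1).
  have [chi hchi sxy] := s_separates (fun e : x = y => xy (esym e)).
  by exists chi.
pose d y := if `[< U y >] then 0 else normc (s (chi y) x - s (chi y) y) / 2.
pose V y := [set z : H | normc (s (chi y) z - s (chi y) y) < d y].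
pose W y := [set z : H | normc (s (chi y) z - s (chi y) x) < d y].
have cU : compact (~` U) by apply: (closed_compact compactH); exact: open_closedC.
have dp y : ~ U y -> 0 < d y.
  move=> nUy; rewrite /d asboolF// divr_gt0// lt_neqAle normc_ge0 andbT eq_sym.
  apply/eqP => /eq0_normc/eqP; rewrite subr_eq0 => /eqP.
  exact: (chiP y).2.
have oV y : open (V y) by apply: open_ball_preimage; exact: (chiP y).1.
have UV y : (~` U) y -> exists z, V z y.
  by move=> nUy; exists y; rewrite /V /= subrr normc0 dp.
have [r rP] := compact_finite_cover cU oV UV.
have W' y : exists C : set H, [/\ open C, setA C, C x & (~ U y -> C = W y)].
  have [Uy|nUy] := pselect (U y).
    by exists setT; split => //; exact: openT.
  exists (W y); split => //.
  - by apply: open_ball_preimage; exact: (chiP y).1.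
  - by apply: setA_ball; exact: (chiP y).1.
  - by rewrite /W /= subrr normc0 dp.
have /choice[C CP] := W'.
exists [set z | forall y, y \in r -> C y z]; split.
- elim: (r) => [|y q ih].
    rewrite (_ : [set z | _] = setT); first exact: openT.
    by apply/seteqP; split.
  rewrite (_ : [set z | _] = C y `&` [set z | forall y, y \in q -> C y z]).
    by apply: openI => //; case: (CP y).
  apply/seteqP; split => z /=.
    move=> h; split; first by apply: h; rewrite mem_head.
    by move=> j jr; apply: h; rewrite in_cons jr orbT.
  by move=> [Fi h] j; rewrite in_cons => /predU1P[->//|/h].
- by apply: (@setA_bigcap H) => y; case: (CP y).
- by move=> y _; case: (CP y).
- move=> z hz; apply: contrapT => nUz; have [y yr Vyz] := rP z nUz.
  have nUy : ~ U y.
    by move=> Uy; move: Vyz; rewrite /V /d /= asboolT// ltNge normc_ge0.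
  have := hz y yr; have [_ _ _ ->//] := CP y => Wyz.
  have : normc (s (chi y) x - s (chi y) y) < d y + d y.
    rewrite (_ : _ - _ = (s (chi y) z - s (chi y) y) - (s (chi y) z - s (chi y) x)).
      by rewrite (le_lt_trans (le_normcD _ _))// normcN ltrD.
    by ring.
  by rewrite /d asboolF// -splitr ltxx.
Qed.

(** The distance of two indicator functions is the measure of the symmetric
    difference. *)
Let setA_approx (A : set (borel H)) : measurable A ->
  (forall e : R, 0 < e -> exists B : set (borel H),
    [/\ setA B, m (A `\` B) <= e%:E & m (B `\` A) <= e%:E]%E) -> setA A.
Proof.
move=> mA h; split => //; have iA : m.-integrable setT (EFin \o \1_A) by exact: integrable_indic.
split => //; apply: adherent_lim => e e0.
have e40 : 0 < e / 4 by rewrite divr_gt0.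
have [B [[mB [iB aB]] h1 h2]] := h _ e40.
exists (rcls (\1_B)) => //; rewrite nrm_rclsB//.
have mAB : measurable (A `\` B) by exact: measurableD.
have mBA : measurable (B `\` A) by exact: measurableD.
have -> : \int[m]_x `|\1_A x - \1_B x| = \int[m]_x (\1_(A `\` B) x + \1_(B `\` A) x).
  apply: eq_Rintegral => x _; rewrite !indicE !in_setD.
  by case: (x \in A); case: (x \in B); rewrite /= ?subrr ?subr0 ?sub0r ?normrN ?normr0 ?normr1 ?addr0 ?add0r.
rewrite RintegralD//; [|exact: integrable_indic..].
rewrite /Rintegral !integral_indic// !setIT.
have fAB : m (A `\` B) \is a fin_num by exact: fin_num_measure.
have fBA : m (B `\` A) \is a fin_num by exact: fin_num_measure.
move: h1 h2; rewrite -{1}(fineK fAB) -{1}(fineK fBA) !lee_fin; lra.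
Qed.

Let open_measurable (U : set H) : open U -> measurable (U : set (borel H)).
Proof. by move=> oU; exact: sub_sigma_algebra. Qed.

(** Inner regularity provides a compact subset of nearly full measure, which is
    covered by finitely many of the sets of [setA_base]. *)
Let setA_open (U : set H) : open U -> setA U.
Proof.
move=> oU; have mU := open_measurable oU.
apply: setA_approx => // e e0.
have fU : m (U : set (borel H)) \is a fin_num by exact: fin_num_measure.
have [_ _ /(_ U mU) inner] := hm.
have fsup := fU; rewrite inner in fsup.
have [_ [K [cK KU] <-] Ke] := ub_ereal_sup_adherent e0 fsup.
rewrite -inner in Ke.
have /choice[B BP] (x : H) : exists B : set H, U x -> [/\ open B, setA B, B x & B `<=` U].
  have [Ux|] := pselect (U x); last by exists setT.
  by have [B] := setA_base oU Ux; exists B.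
pose B' x := if pselect (U x) is left _ then B x else set0.
have B'P x : open (B' x) /\ setA (B' x).
  rewrite /B'; case: pselect => [Ux|_]; first by have [] := BP x Ux.
  split; first exact: open0.
  by rewrite -setCT; apply: setA_C; exact: setA_T.
have KB x : K x -> exists y, B' y x.
  move=> Kx; exists x; rewrite /B'; case: pselect => [Ux|]; last by case; exact: KU.
  by have [] := BP x Ux.
have [r rP] := compact_finite_cover cK (fun x => (B'P x).1) KB.
exists [set x | exists2 i, i \in r & B' i x]; split.
- by apply: (@setA_bigcup H) => x; exact: (B'P x).2.
- have mK : measurable (K : set (borel H)).
    by rewrite -[K]setCK; apply: measurableC; apply: open_measurable;
      apply: closed_openC; exact: compact_closed.
  apply: (@le_trans _ _ (m (U `\` K : set (borel H)))).
    apply: le_measure; rewrite ?inE.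
    + apply: measurableD => //; have := setA_bigcup r (fun x => (B'P x).2).
      by case.
    + exact: measurableD.
    + by move=> x [Ux nx]; split => // Kx; apply: nx; exact: rP.
  rewrite measureD//; last by rewrite -ge0_fin_numE.
  rewrite (setIidr KU); have fK : m (K : set (borel H)) \is a fin_num by exact: fin_num_measure.
  by rewrite leeBlDr// addeC -leeBlDr//; exact: ltW Ke.
- rewrite (_ : _ `\` _ = set0) ?measure0 ?lee_fin ?ltW//.
  apply/seteqP; split => // x [[y yr]]; rewrite /B'; case: pselect => // Uy Bx.
  by case; have [_ _ _] := BP y Uy; apply.
Qed.

Let setA_measurable (A : set (borel H)) : measurable A -> setA A.
Proof.
move=> mA; apply: setA_approx => // e e0.
have fA : m A \is a fin_num by exact: fin_num_measure.
have [_ /(_ A mA) outer _] := hm.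
have finf := fA; rewrite outer in finf.
have [_ [U [oU AU] <-] Ue] := lb_ereal_inf_adherent e0 finf.
rewrite -outer in Ue; have mU := open_measurable oU.
have fU : m (U : set (borel H)) \is a fin_num by exact: fin_num_measure.
exists U; split; first exact: setA_open.
  by rewrite (_ : A `\` U = set0) ?measure0 ?lee_fin ?ltW//; apply/seteqP; split => // x [/AU].
rewrite measureD//; last by rewrite -ge0_fin_numE.
by rewrite (setIidr AU) leeBlDr// addeC; exact: ltW Ue.
Qed.

Let realA_integrable (u : borel H -> R) : m.-integrable setT (EFin \o u) -> realA u.
Proof.
move=> iu; have [g [ig gu c]] := approximation_sfun_integrable measurableT iu.
apply: (@realA_lim u (fun n x => g n x) iu _ c) => n.
have gE : g n =1 (fun x => \sum_(y <- finmap.enum_fset (fset_set (range (g n)))) y * \1_(g n @^-1` [set y]) x).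
  by move=> x; rewrite {1}(fimfunE (g n)) fsbig_finite//.
apply: (realA_ext (fun x => esym (gE x))).
elim: (finmap.enum_fset _) => [|y q ih].
  by apply: realA_ext (realA_cst 0) => x; rewrite big_nil.
have aI : realA (\1_(g n @^-1` [set y])).
  by apply: (setA_measurable _).2; rewrite -[_ @^-1` _]setTI; exact: measurable_funP.
by apply: realA_ext (realA_linear y aI ih) => x; rewrite big_cons.
Qed.

(** The closure of the trigonometric polynomials is a closed vector lattice
    containing the constants. It contains the indicator functions of the sets
    where [s chi] takes values in a disc, hence those of finite intersections of
    such sets; by regularity of the measure it contains those of open sets, then
    those of Borel sets, and finally every integrable function. *)
Lemma trig_dense_haar : trig_dense sigma m s.
Proof.
move=> x e e0; have [f cf ->] := cls_surj x; have [fr fi] := cf.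
have [_ ar] := realA_integrable fr; have [_ ai] := realA_integrable fi.
have : adherent (cls m f).
  have -> : cls m f = 'i%C *: rcls (@complex.Im R \o f) + rcls (@complex.Re R \o f).
    rewrite -clsZ; last exact: cint_real.
    rewrite -clsD; [|by apply: cintZ; exact: cint_real|exact: cint_real].
    by congr (cls _ _); apply/funext => y; rewrite addrC; exact: complexE.
  exact: (close_linear srep srep).
by move=> /(_ _ e0)[p [hp xp _]]; exists p.
Qed.

End trigonometric_density.

(** * The compactification attached to a group of characters *)

Section product_convergence.

Lemma cvg_prod_topology {I T : Type} {V : topologicalType} (F : set_system T)
    {FF : Filter F} (f : T -> prod_topology (fun _ : I => V)) (g : prod_topology (fun _ : I => V)) :
  (forall i, (fun x => f x i) @ F --> g i) -> f @ F --> g.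
Proof.
move=> h; apply/cvg_sup => i B [_ [[W oW <-] Wg] WB].
apply: (filterS WB); exact: (h i W (open_nbhs_nbhs (conj oW Wg))).
Qed.

Lemma prod_topology_coord {I : eqType} {V : topologicalType} (i : I) :
  continuous (fun x : prod_topology (fun _ : I => V) => x i).
Proof. exact: (@proj_continuous I (fun _ => V) i). Qed.

Lemma closure_stable {T : topologicalType} (A : set T) (f : T -> T) :
  continuous f -> (forall x, A x -> closure A (f x)) ->
  forall x, closure A x -> closure A (f x).
Proof.
move=> cf fA x Ax; apply: closed_closure => B Bfx.
have [y [Ay By]] := Ax _ (cf x B Bfx).
by exists (f y); split => //; exact: fA.
Qed.

Lemma compact_set_type {T : topologicalType} (A : set T) :
  compact A -> compact [set: set_type A].
Proof.
move=> cA F FF _.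
have [|p [Ap cp]] := cA (set_val @ F) _.
  by apply: (@filterS _ F _ setT); [move=> x _; exact: set_valP|exact: filterT].
exists (exist _ p (mem_set Ap)); split => // B C FB [_ [[W oW <-] Wp] WC].
have FB' : (set_val @ F) (set_val @` B).
  by apply: (@filterS _ F _ B) => // x Bx; exists x.
have [_ [[x Bx <-] Wx]] := cp _ _ FB' (open_nbhs_nbhs (conj oW Wp)).
by exists x; split => //; exact: WC.
Qed.

Lemma hausdorff_separating {T : topologicalType} {I : Type} {V : topologicalType}
    (f : I -> T -> V) : hausdorff_space V -> (forall i, continuous (f i)) ->
  (forall x y, (forall i, f i x = f i y) -> x = y) -> hausdorff_space T.
Proof.
move=> hV cf finj x y xy; apply: finj => i; apply: hV => B C Bx Cy.
by have [z [? ?]] := xy _ _ (cf i x B Bx) (cf i y C Cy); exists (f i z).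
Qed.

End product_convergence.

Section dual_group.
Context {R : realType} {G : topologicalZmodType}.
Local Notation C := (R[i]^o).
Local Notation char := (G -> C).

Definition bohr_point (sigma : set char) (t : G) : prod_topology (fun _ : char => C) :=
  fun chi => if `[< sigma chi >] then chi t else 1.

Definition bohr_set (sigma : set char) := closure (range (bohr_point sigma)).

(** The compactification of [G] attached to a group of characters: the closure of
    its image in the product of circles indexed by them. Indexing the product by all
    functions on [G], with trivial coordinates outside [sigma], avoids subtypes;
    the proof argument is what the group laws need. *)
Definition bohr_group (sigma : set char) (h : character_subgroup sigma) : Type :=
  set_type (bohr_set sigma).

HB.instance Definition _ sigma h :=
  Topological.copy (@bohr_group sigma h) (set_type (bohr_set sigma)).

Section laws.
Variables (sigma : set char) (h : character_subgroup sigma).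
Local Notation H := (@bohr_group sigma h).

Definition bohr_coord (chi : char) (x : H) : C := (set_val x : prod_topology (fun _ : char => C)) chi.

Lemma bohr_coord_continuous chi : continuous (bohr_coord chi).
Proof.
move=> x; apply: (@continuous_comp _ _ _ (set_val : H -> prod_topology (fun _ : char => C))
   (fun z : prod_topology (fun _ : char => C) => z chi)).
  exact: initial_continuous.
exact: prod_topology_coord.
Qed.

Lemma bohr_coord_inj (x y : H) : (forall chi, bohr_coord chi x = bohr_coord chi y) -> x = y.
Proof. by move=> xy; apply: val_inj; apply/funext => chi; exact: xy. Qed.

Lemma bohr_coord_cvg {T : Type} (F : set_system T) {FF : Filter F} (f : T -> H) (y : H) :
  (forall chi, (fun x => bohr_coord chi (f x)) @ F --> bohr_coord chi y) -> f @ F --> y.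
Proof.
move=> hf B [_ [[W oW <-] Wy] WB]; apply: (filterS WB).
have : (fun x => set_val (f x) : prod_topology (fun _ : char => C)) @ F -->
    (set_val y : prod_topology (fun _ : char => C)) by exact: cvg_prod_topology.
by move=> /(_ W (open_nbhs_nbhs (conj oW Wy))).
Qed.

(** Equations between coordinates pass from the image of [G] to its closure. *)
Lemma bohr_set_closed_eq (P : prod_topology (fun _ : char => C) -> C) :
  continuous P -> (forall t, P (bohr_point sigma t) = 0) ->
  forall x, bohr_set sigma x -> P x = 0.
Proof.
move=> cP P0 x Ax; apply/eqP/negPn/negP => Px.
have : nbhs x (P @^-1` (~` [set 0])).
  apply: (cP x); apply: open_nbhs_nbhs; split; last exact/eqP.
  by apply: closed_openC; apply: accessible_closed_set1; apply: hausdorff_accessible;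
    exact: norm_hausdorff.
by move=> /Ax[_ [[t _ <-]]] /=; rewrite P0.
Qed.

Lemma conjc_continuous : continuous (fun z : C => ((z^*)%C : C)).
Proof.
move=> z; apply/(@cvg_nrmP R C C (nbhs z) (nbhs_filter z)) => e e0.
have : nbhs z (ball z e%:C%C) by apply: nbhsx_ballx; rewrite ltcR.
apply: filterS => w; rewrite -ball_normE /ball_/= normr_normc ltcR.
by rewrite /nrm -rmorphB normr_normc normc_conj.
Qed.

Lemma bohr_set_unit x chi : bohr_set sigma x -> normc (x chi) = 1.
Proof.
move=> Ax.
have c : continuous (fun x : prod_topology (fun _ : char => C) =>
    x chi * ((x chi)^*)%C - 1 : C).
  move=> y.
  have h1 : (fun x : prod_topology (fun _ : char => C) => x chi) @ y --> y chi.
    exact: prod_topology_coord.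
  have h2 : (fun x : prod_topology (fun _ : char => C) => ((x chi)^*)%C : C) @ y
      --> (((y chi)^*)%C : C).
    exact: (@continuous_comp _ _ _ (fun z : prod_topology (fun _ : char => C) => z chi)
      (fun z : C => ((z^*)%C : C)) y h1 (@conjc_continuous (y chi))).
  exact: (cvgB (cvgM h1 h2) (cvg_cst (1 : C))).
have : x chi * ((x chi)^*)%C - 1 = 0.
  apply: (bohr_set_closed_eq c _ Ax) => t.
  rewrite /bohr_point; case: ifPn => [/asboolP hchi|_]; last first.
    by rewrite rmorph1 mulr1 subrr.
  case: h => /(_ _ hchi)[_ _ chi1] _ _ _.
  by rewrite mul_conjc rmorphXn/= -normr_normc chi1 expr1n subrr.
move/eqP; rewrite subr_eq0 mul_conjc => /eqP/complexI/eqP.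
by rewrite sqrf_eq1 => /orP[/eqP//|/eqP e]; have := normc_ge0 (x chi); rewrite e ler0N1.
Qed.

Lemma bohr_point_add s t chi :
  bohr_point sigma (s + t) chi = bohr_point sigma s chi * bohr_point sigma t chi.
Proof.
rewrite /bohr_point; case: ifPn => [/asboolP hchi|_]; last by rewrite mulr1.
by case: h => /(_ _ hchi)[_ -> _].
Qed.

Lemma bohr_point_unit t chi : normc (bohr_point sigma t chi) = 1.
Proof. by apply: bohr_set_unit; apply: subset_closure; exists t. Qed.

Definition bohr_mul0 (x y : prod_topology (fun _ : char => C)) :
  prod_topology (fun _ : char => C) := fun chi => x chi * y chi.

Lemma bohr_set_mul x y : bohr_set sigma x -> bohr_set sigma y ->
  bohr_set sigma (bohr_mul0 x y).
Proof.
have cl z : continuous (bohr_mul0 z).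
  move=> y0; apply: (@cvg_prod_topology char _ C (nbhs y0) _ (bohr_mul0 z) (bohr_mul0 z y0)) => chi.
  have hy : (fun x : prod_topology (fun _ : char => C) => x chi) @ y0 --> y0 chi.
    exact: prod_topology_coord.
  exact: (cvgM (cvg_cst (z chi : C)) hy).
have cr z : continuous (bohr_mul0^~ z).
  move=> y0; apply: (@cvg_prod_topology char _ C (nbhs y0) _ (bohr_mul0^~ z) (bohr_mul0 y0 z)) => chi.
  have hy : (fun x : prod_topology (fun _ : char => C) => x chi) @ y0 --> y0 chi.
    exact: prod_topology_coord.
  exact: (cvgM hy (cvg_cst (z chi : C))).
move=> Ax Ay; apply: (closure_stable (cr y) _ Ax) => _ [s _ <-].
apply: (closure_stable (cl _) _ Ay) => _ [t _ <-].
apply: subset_closure; exists (s + t) => //.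
by apply/funext => chi; exact: bohr_point_add.
Qed.

Definition bohr_inv0 (x : prod_topology (fun _ : char => C)) :
  prod_topology (fun _ : char => C) := fun chi => ((x chi)^*)%C.

Lemma bohr_set_inv x : bohr_set sigma x -> bohr_set sigma (bohr_inv0 x).
Proof.
have ci : continuous bohr_inv0.
  move=> y0; apply: (@cvg_prod_topology char _ C (nbhs y0) _ bohr_inv0 (bohr_inv0 y0)) => chi.
  apply: (@continuous_comp _ _ _ (fun z : prod_topology (fun _ : char => C) => z chi)
    (fun z : C => ((z^*)%C : C))); first exact: prod_topology_coord.
  exact: conjc_continuous.
apply: (closure_stable ci) => _ [t _ <-]; apply: subset_closure; exists (- t) => //.
apply/funext => chi; rewrite /bohr_inv0 unit_conjcV; last exact: bohr_point_unit.
have p0 : bohr_point sigma t chi != 0.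
  by apply/eqP => p0; have := bohr_point_unit t chi; rewrite p0 normc0 => /eqP; rewrite eq_sym oner_eq0.
apply: (mulfI p0); rewrite mulfV// -bohr_point_add subrr.
rewrite /bohr_point; case: ifPn => [/asboolP hchi|//].
case: h => /(_ _ hchi)[_ hM h1] _ _ _; have := hM 0 0; rewrite addr0 => e.
have c0 : chi 0 != 0 by rewrite -normr_eq0 h1 oner_eq0.
by apply: (mulfI c0); rewrite -e mulr1.
Qed.

Definition bohr_embed (t : G) : H :=
  exist _ (bohr_point sigma t) (mem_set (subset_closure (ex_intro2 _ _ t I erefl))).
Definition bohr_mul (x y : H) : H :=
  exist _ (bohr_mul0 (set_val x) (set_val y)) (mem_set (bohr_set_mul (set_valP x) (set_valP y))).
Definition bohr_inv (x : H) : H :=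
  exist _ (bohr_inv0 (set_val x)) (mem_set (bohr_set_inv (set_valP x))).
Definition bohr_one : H := bohr_embed 0.

Lemma bohr_coordM chi x y : bohr_coord chi (bohr_mul x y) = bohr_coord chi x * bohr_coord chi y.
Proof. by []. Qed.

Lemma bohr_coordV chi x : bohr_coord chi (bohr_inv x) = ((bohr_coord chi x)^*)%C.
Proof. by []. Qed.

Lemma bohr_coord_unit chi x : normc (bohr_coord chi x) = 1.
Proof. by apply: bohr_set_unit; exact: (set_valP x). Qed.

Lemma bohr_coord1 chi : bohr_coord chi bohr_one = 1.
Proof.
have e : bohr_coord chi bohr_one * bohr_coord chi bohr_one = bohr_coord chi bohr_one.
  by rewrite -[LHS](bohr_point_add 0 0) addr0.
have p0 : bohr_coord chi bohr_one != 0.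
  apply/eqP => p0; have := bohr_coord_unit chi bohr_one.
  by rewrite p0 normc0 => /eqP; rewrite eq_sym oner_eq0.
by apply: (mulfI p0); rewrite e mulr1.
Qed.

Lemma bohr_mulA : associative bohr_mul.
Proof. by move=> x y z; apply: bohr_coord_inj => chi; rewrite !bohr_coordM mulrA. Qed.

Lemma bohr_mul1 : left_id bohr_one bohr_mul.
Proof. by move=> x; apply: bohr_coord_inj => chi; rewrite bohr_coordM bohr_coord1 mul1r. Qed.

Lemma bohr_mulr1 : right_id bohr_one bohr_mul.
Proof. by move=> x; apply: bohr_coord_inj => chi; rewrite bohr_coordM bohr_coord1 mulr1. Qed.

Lemma bohr_mulV : right_inverse bohr_one bohr_inv bohr_mul.
Proof.
move=> x; apply: bohr_coord_inj => chi.
by rewrite bohr_coordM bohr_coordV bohr_coord1 mul_conjc bohr_coord_unit expr1n.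
Qed.

Lemma bohr_mulVl : left_inverse bohr_one bohr_inv bohr_mul.
Proof.
move=> x; apply: bohr_coord_inj => chi.
by rewrite bohr_coordM bohr_coordV bohr_coord1 mulrC mul_conjc bohr_coord_unit expr1n.
Qed.

Lemma bohr_mul_continuous : continuous (fun x : H * H => bohr_mul x.1 x.2).
Proof.
move=> x; apply: (@bohr_coord_cvg _ (nbhs x) (nbhs_filter x)) => chi.
have h1 : (fun z : H * H => bohr_coord chi z.1) @ x --> bohr_coord chi x.1.
  apply: (@continuous_comp _ _ _ (fun z : H * H => z.1) (bohr_coord chi)).
    exact: cvg_fst.
  exact: bohr_coord_continuous.
have h2 : (fun z : H * H => bohr_coord chi z.2) @ x --> bohr_coord chi x.2.
  apply: (@continuous_comp _ _ _ (fun z : H * H => z.2) (bohr_coord chi)).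
    exact: cvg_snd.
  exact: bohr_coord_continuous.
exact: (cvgM h1 h2).
Qed.

Lemma bohr_inv_continuous : continuous bohr_inv.
Proof.
move=> x; apply: (@bohr_coord_cvg _ (nbhs x) (nbhs_filter x)) => chi.
apply: (@continuous_comp _ _ _ (bohr_coord chi) (fun z : C => ((z^*)%C : C))).
  exact: bohr_coord_continuous.
exact: conjc_continuous.
Qed.

End laws.

HB.instance Definition _ sigma h := isGroup.Build (@bohr_group sigma h)
  (@bohr_mulA sigma h) (@bohr_mul1 sigma h) (@bohr_mulr1 sigma h)
  (@bohr_mulVl sigma h) (@bohr_mulV sigma h).
HB.instance Definition _ sigma h := isTopologicalGroup.Build (@bohr_group sigma h)
  (@bohr_mul_continuous sigma h) (@bohr_inv_continuous sigma h).

End dual_group.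

(** * Ergodic averages *)

Section ergodic_averages.
Context {R : realType} {G : Type}.
Local Notation char := (G -> R[i]^o).
Variable sigma : set char.
Context {d : measure_display} {X : measurableType d}.
Variables (P : probability X R) (s : char -> X -> R[i]^o).
Hypothesis srep : unit_rep sigma P s.

Section one_map.
Variables (J : L1 P -> L1 P) (mult : char -> R[i]).
Hypothesis mJ : markov_isomorphism J.
Hypothesis J_eigen : forall chi, sigma chi -> J (cls P (s chi)) = mult chi *: cls P (s chi).

Definition average (w : R[i]) N (F : L1 P) : L1 P :=
  N.+1%:R^-1 *: \sum_(k < N.+1) w ^+ k *: iter k J F.

Definition average_coef (w : R[i]) N (chi : char) : R[i] :=
  N.+1%:R^-1 * \sum_(k < N.+1) (w * mult chi) ^+ k.

Definition trig_average w N (p : trig R G) : trig R G :=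
  [seq (a.1 * average_coef w N a.2, a.2) | a <- p].

Let normc_natV N : normc (N.+1%:R^-1 : R[i]) = N.+1%:R^-1.
Proof.
rewrite normcV -[N.+1%:R in LHS](rmorph_nat (real_complex R)) normc_real.
by rewrite ger0_norm.
Qed.

Lemma nrm_average w N F : normc w = 1 -> nrm (average w N F) <= nrm F.
Proof.
move=> w1; rewrite nrmZ normc_natV ler_pdivrMl ?ltr0n// (le_trans (nrm_sum _ _))//.
rewrite (eq_bigr (fun=> nrm F)); first by rewrite sumr_const card_ord mulr_natl.
move=> k _; rewrite nrmZ (_ : normc (w ^+ k) = 1) ?mul1r.
  by elim: (k : nat) => //= n <-; rewrite (markov_nrm mJ).
by elim: (k : nat) => [|n ih]; rewrite ?expr0 ?normc1// exprS normcM w1 mul1r.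
Qed.

Lemma averageD w N F F' : average w N (F + F') = average w N F + average w N F'.
Proof.
rewrite /average -scalerDr -big_split/=; congr (_ *: _); apply: eq_bigr => k _.
rewrite -scalerDr; congr (_ *: _).
by elim: (k : nat) => //= n ->; rewrite (markovD mJ).
Qed.

Lemma average0 w N : average w N 0 = 0.
Proof.
rewrite /average big1 ?scaler0// => k _; rewrite (_ : iter _ _ _ = 0) ?scaler0//.
by elim: (k : nat) => //= n ->; rewrite (markov0 mJ).
Qed.

Lemma averageB w N F F' : average w N (F - F') = average w N F - average w N F'.
Proof. by have := averageD w N (F - F') F'; rewrite subrK => ->; rewrite addrK. Qed.

Lemma average_eigen w N F (z : R[i]) : J F = z *: F ->
  average w N F = (N.+1%:R^-1 * \sum_(k < N.+1) (w * z) ^+ k) *: F.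
Proof.
move=> JF; rewrite /average -scalerA scaler_suml; congr (_ *: _).
apply: eq_bigr => k _; rewrite exprMn -scalerA; congr (_ *: _).
elim: (k : nat) => [|n ih]; first by rewrite expr0 scale1r.
by rewrite iterS ih (markovZ mJ) JF scalerA exprSr.
Qed.

Lemma average_fixed w N F (z : R[i]) : J F = z *: F -> w * z = 1 -> average w N F = F.
Proof.
move=> JF wz; rewrite (average_eigen _ _ JF) wz.
under eq_bigr do rewrite expr1n.
by rewrite sumr_const card_ord mulVf ?scale1r// pnatr_eq0.
Qed.

Lemma trig_on_average w N p : trig_on sigma p -> trig_on sigma (trig_average w N p).
Proof. by move=> hp _ /mapP[a /hp ha ->]. Qed.

Lemma average_trig w N p : trig_on sigma p ->
  average w N (trig_cls P s p) = trig_cls P s (trig_average w N p).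
Proof.
move=> hp; rewrite !(trig_clsE srep)//; last exact: trig_on_average.
elim: p hp => [_|a p ih /trig_on_cons[ha hp]].
  by rewrite !big_nil average0.
rewrite !big_cons -ih// averageD; congr (_ + _).
rewrite (@average_eigen _ _ _ (mult a.2)); last first.
  by rewrite (markovZ mJ) J_eigen// !scalerA mulrC.
by rewrite scalerA mulrC.
Qed.

Lemma normc_average_coef w N chi : normc (w * mult chi) = 1 -> w * mult chi != 1 ->
  normc (average_coef w N chi) <= 2 / normc (w * mult chi - 1) / N.+1%:R.
Proof.
move=> z1 zn1; set z := w * mult chi in z1 zn1 *.
have z0 : z - 1 != 0 by rewrite subr_eq0.
have n0 : 0 < normc (z - 1).
  by rewrite lt_neqAle normc_ge0 andbT eq_sym; apply: contra_neq z0 => /eq0_normc.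
rewrite /average_coef -/z normcM normc_natV mulrC ler_pM2r ?invr_gt0 ?ltr0n//.
rewrite ler_pdivlMr// -normcM mulrC -subrX1.
rewrite (le_trans (le_normcD _ _))// normcN (_ : normc (z ^+ N.+1) = 1).
  by rewrite normc1 -natr1.
by elim: (N.+1) => [|n ih]; rewrite ?expr0 ?normc1// exprS normcM z1 mul1r.
Qed.

Lemma nrm_unit chi : sigma chi -> nrm (cls P (s chi)) <= 1.
Proof.
move=> hchi; apply: nrm_cls_le; first exact: (unit_rep_cint srep).
by case: srep => _ s1 _ _; apply: aeW => x; rewrite s1.
Qed.

End one_map.

(** For a character [chi] other than [psi] choose [t] with [chi t <> psi t]. The
    averages of the powers of [psi(t)^-1 T_t] fix [f], do not increase norms and
    annihilate, in the limit, the term of a polynomial that belongs to [chi]. Thus the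
    terms outside [psi] can be removed one at a time without losing more than
    [e] in the distance to [f]. *)
Lemma eigen_approximation (T : G -> L1 P -> L1 P) (psi : char) f p (e : R) :
  (forall t, markov_isomorphism (T t)) ->
  (forall chi t, sigma chi -> T t (cls P (s chi)) = chi t *: cls P (s chi)) ->
  (forall chi t, sigma chi -> normc (chi t) = 1) -> (forall t, normc (psi t) = 1) ->
  (forall t, T t f = psi t *: f) -> trig_on sigma p -> 0 < e ->
  exists q, [/\ trig_on sigma q, (forall a, a \in q -> a.2 = psi) &
    nrm (f - trig_cls P s q) <= nrm (f - trig_cls P s p) + e].
Proof.
move=> mT Ts chi1 psi1 Tf.
(* [q] holds the terms that are kept, [r] those still to be treated. *)
suff : forall n (q r : trig R G) (e : R), size r = n -> trig_on sigma q -> trig_on sigma r ->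
    (forall a, a \in q -> a.2 = psi) -> 0 < e ->
    exists q', [/\ trig_on sigma q', (forall a, a \in q' -> a.2 = psi) &
    nrm (f - trig_cls P s q') <= nrm (f - trig_cls P s (q ++ r)) + e].
  move=> h hp e0; have [//|q' [? ? ?]] := h _ [::] p e erefl (trig_on_nil sigma) hp _ e0.
  by exists q'.
elim=> [|n ih] q r {}e.
  move=> /size0nil -> hq _ qpsi e0; exists q; split => //.
  by rewrite cats0 lerDl ltW.
case: r => // a r [rn] hq /trig_on_cons[ha hr] qpsi e0.
have [apsi|] := pselect (a.2 = psi).
  have hqa : trig_on sigma (q ++ [:: a]).
    by apply: trig_on_cat => //; apply: trig_on_cons2 => //; exact: trig_on_nil.
  have [|q' [? ? h]] := ih (q ++ [:: a]) r e rn hqa hr _ e0.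
    by move=> b; rewrite mem_cat mem_seq1 => /orP[/qpsi//|/eqP ->].
  by exists q'; split => //; move: h; rewrite -catA.
move=> apsi; have [t /eqP at1] : exists t, a.2 t <> psi t.
  by apply: contra_notP apsi => /forallNP h; apply/funext => t; apply: contrapT; exact: h.
have p0 : psi t != 0.
  by apply/eqP => p0; have := psi1 t; rewrite p0 normc0 => /eqP; rewrite eq_sym oner_eq0.
pose w := (psi t)^-1; have w1 : normc w = 1 by rewrite normcV psi1 invr1.
pose mult (chi : char) := chi t.
have Jm chi : sigma chi -> T t (cls P (s chi)) = mult chi *: cls P (s chi) by exact: Ts.
have z1 : normc (w * mult a.2) = 1 by rewrite normcM w1 chi1// mulr1.
have zn : w * mult a.2 != 1.
  apply: contra_neq at1 => e1; have := congr1 (fun z => psi t * z) e1.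
  by rewrite mulVKf// mulr1.
have e20 : 0 < e / 2 by rewrite divr_gt0.
have [N Ne] := small_invN (normc a.1 * (2 / normc (w * mult a.2 - 1))) e20.
pose q1 := trig_average mult w N q; pose r1 := trig_average mult w N r.
pose c := a.1 * average_coef mult w N a.2.
have hq1 : trig_on sigma q1 by exact: trig_on_average.
have hr1 : trig_on sigma r1 by exact: trig_on_average.
have hc : trig_on sigma [:: (c, a.2)].
  by apply: trig_on_cons2 => //; exact: trig_on_nil.
have [||q' [? ? h]] := ih q1 r1 (e / 2) _ hq1 hr1 _ e20.
- by rewrite size_map.
- by move=> _ /mapP[b /qpsi bpsi ->].
exists q'; split => //; rewrite (le_trans h)// [e in leRHS]splitr addrA lerD2r.
have hqr : trig_on sigma (q ++ a :: r).
  by apply: trig_on_cat => //; exact: trig_on_cons2.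
have hqr1 : trig_on sigma (q1 ++ r1) by exact: trig_on_cat.
have E : trig_cls P s (q1 ++ r1) =
    trig_cls P s (trig_average mult w N (q ++ a :: r)) - trig_cls P s [:: (c, a.2)].
  rewrite /trig_average map_cat/= -cat1s -/q1 -/r1.
  have hcr : trig_on sigma ([:: (c, a.2)] ++ r1) by exact: trig_on_cat.
  rewrite !(trig_cls_cat srep)//.
  by rewrite addrCA addrAC subrr add0r.
rewrite E opprB addrA addrAC (le_trans (nrmD _ _))// lerD//.
  rewrite -(average_trig (mT t) Jm)//.
  have fixf : average (T t) w N f = f by apply: (average_fixed (mT t) _ (Tf t)); rewrite mulVf.
  rewrite -{1}fixf.
  by rewrite -(averageB (mT t)) (nrm_average (mT t)).
rewrite (trig_clsE srep)// big_seq1/= nrmZ (le_trans _ (ltW Ne))//.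
rewrite (le_trans (ler_wpM2l (normc_ge0 _) (nrm_unit ha)))// mulr1 /c normcM -!mulrA.
rewrite ler_wpM2l ?normc_ge0// mulrA.
exact: normc_average_coef.
Qed.

End ergodic_averages.

(** * The rotation on the compactification *)

Section continuous_functions.
Context {R : realType} {H : topologicalGroupType}.

Lemma continuous_measurable (g : H -> R) : continuous g ->
  measurable_fun setT (g : borel H -> R).
Proof.
move=> cg; apply: (measurability _ (RGenOInfty.measurableE R)).
move=> _ [_ [x ->] <-]; rewrite setTI; apply: sub_sigma_algebra.
by apply: open_comp; [move=> ? _; exact: cg|exact: interval_open].
Qed.

Lemma Re_continuous : continuous (fun z : R[i]^o => complex.Re z).
Proof.
move=> z; apply/(@cvgrPdist_lt R R _ _ (nbhs_filter z)) => e e0.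
have : nbhs z (ball z e%:C%C) by apply: nbhsx_ballx; rewrite ltcR.
apply: filterS => w; rewrite -ball_normE /ball_/= normr_normc ltcR.
apply: le_lt_trans; rewrite (le_trans _ (ge_Re_normc _))//.
by case: z w => [? ?] [? ?].
Qed.

Lemma Im_continuous : continuous (fun z : R[i]^o => complex.Im z).
Proof.
move=> z; apply/(@cvgrPdist_lt R R _ _ (nbhs_filter z)) => e e0.
have : nbhs z (ball z e%:C%C) by apply: nbhsx_ballx; rewrite ltcR.
apply: filterS => w; rewrite -ball_normE /ball_/= normr_normc ltcR.
apply: le_lt_trans; rewrite (le_trans _ (ge_Im_normc _))//.
by case: z w => [? ?] [? ?].
Qed.

Lemma continuous_cmeasurable (f : H -> R[i]^o) : continuous f ->
  cmeasurable (f : borel H -> R[i]^o).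
Proof.
move=> cf; split.
  apply: (@continuous_measurable (@complex.Re R \o f)) => x.
  by apply: continuous_comp; [exact: cf|exact: Re_continuous].
apply: (@continuous_measurable (@complex.Im R \o f)) => x.
by apply: continuous_comp; [exact: cf|exact: Im_continuous].
Qed.

End continuous_functions.

Section translations.
Context {R : realType} {H : topologicalGroupType}.
Variables (m : probability (borel H) R) (hm : is_haar m).
Local Notation T := (L1translation hm).

Lemma cint_translation (x : H) (f : borel H -> R[i]^o) : cintegrable m f ->
  cintegrable m (f \o translation x).
Proof.
move=> [fr fi]; split; first exact: (integrable_translation hm x fr).
exact: (integrable_translation hm x fi).
Qed.

Lemma cls_translation (x : H) (f : borel H -> R[i]^o) : cintegrable m f ->
  T x (cls m f) = cls m (f \o translation x).
Proof.
move=> cf; have /L1predP h := cint_translation x cf; move: cf => /L1predP fP.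
by rewrite (clsE fP) L1translation_class (clsE h); congr L1class; apply/val_inj.
Qed.

Lemma Rintegral_translation (x : H) (u : borel H -> R) :
  m.-integrable setT (EFin \o u) -> (forall y, 0 <= u y) ->
  \int[m]_y u (translation x y) = \int[m]_y u y.
Proof.
move=> iu u0; have mt := @measurable_translation H x.
rewrite /Rintegral; congr fine.
rewrite -(ge0_integral_pushforward mt m measurableT (f := EFin \o u))//.
- by apply: eq_measure_integral => A mA _; exact: haar_translation.
- exact: measurable_int iu.
- by move=> y _; rewrite lee_fin; exact: u0.
Qed.

Lemma translation1 F : T 1%g F = F.
Proof.
have [f cf ->] := cls_surj F; rewrite cls_translation//; congr (cls _ _).
by apply/funext => y /=; rewrite /translation invg1 mul1g.
Qed.

Lemma translationM x y F : T (x * y)%g F = T x (T y F).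
Proof.
have [f cf ->] := cls_surj F; rewrite !cls_translation//; last exact: cint_translation.
by congr (cls _ _); apply/funext => z /=; rewrite /translation invgM mulgA.
Qed.

Lemma translation_markov x : markov_isomorphism (T x).
Proof.
split.
- move=> a F F'; have [f cf ->] := cls_surj F; have [g cg ->] := cls_surj F'.
  have ct := cint_translation x cf; have cgt := cint_translation x cg.
  rewrite -clsZ// -clsD//; last exact: cintZ.
  rewrite !cls_translation//; last by apply: cintD => //; exact: cintZ.
  by rewrite -clsZ// -clsD//; exact: cintZ.
- exists (T x^-1%g) => F; rewrite -translationM ?mulVg ?mulgV; exact: translation1.
- move=> F; rewrite !normr_nrm; congr (_%:C%C).
  have [f cf ->] := cls_surj F; rewrite cls_translation//.
  rewrite !nrm_cls//; last exact: cint_translation.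
  apply: (Rintegral_translation x (u := fun y => normc (f y))).
    exact: integrable_normc.
  by move=> y; exact: normc_ge0.
- move=> F; have [f cf ->] := cls_surj F.
  have ca := cint_abs cf; have ct := cint_translation x cf.
  by rewrite cls_translation// !L1abs_cls// cls_translation.
- rewrite !L1one_cls cls_translation//; exact: cint_cst.
Qed.

End translations.

Section rotation.
Context {R : realType} {G : topologicalZmodType}.
Local Notation C := (R[i]^o).
Local Notation char := (G -> C).
Variables (sigma : set char) (hsigma : character_subgroup sigma).
Local Notation H := (bohr_group hsigma : topologicalGroupType).
Local Notation c := (bohr_embed hsigma : G -> H).

Lemma bohr_group_compact : compact [set: H].
Proof.
apply: compact_set_type.
have cT := @tychonoff char (fun _ => C) (fun _ => _) (fun _ => @compact_complex_square R).
apply: (subclosed_compact _ cT); first exact: closed_closure.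
move=> x Ax chi; rewrite -(bohr_set_unit hsigma chi Ax).
by split; [exact: ge_Re_normc|exact: ge_Im_normc].
Qed.

Lemma bohr_group_hausdorff : hausdorff_space H.
Proof.
apply: (hausdorff_separating (f := @bohr_coord R G sigma hsigma)).
- exact: norm_hausdorff.
- exact: bohr_coord_continuous.
- exact: bohr_coord_inj.
Qed.

Lemma bohr_embed_continuous : continuous c.
Proof.
move=> t; apply: (@bohr_coord_cvg _ _ _ _ _ (nbhs t) (nbhs_filter t)) => chi.
have cE : (fun t => bohr_coord chi (c t)) = bohr_point sigma ^~ chi by [].
rewrite [bohr_coord _ (c t)]/(bohr_point sigma t chi) cE /bohr_point.
have [hchi|nchi] := pselect (sigma chi).
  rewrite (asboolT hchi); case: hsigma => /(_ _ hchi)[cchi _ _] _ _ _; exact: cchi.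
by rewrite (asboolF nchi); exact: cvg_cst.
Qed.

Lemma bohr_embed_compactification : group_compactification c.
Proof.
split.
- exact: bohr_group_compact.
- exact: bohr_group_hausdorff.
- exact: bohr_embed_continuous.
- move=> s t; apply: bohr_coord_inj => chi; exact: bohr_point_add.
- move=> O [x Ox] [W oW WO].
  have Wx : W (set_val x) by rewrite -WO in Ox.
  have [_ [[t _ <-] Wt]] := set_valP x _ (open_nbhs_nbhs (conj oW Wx)).
  by exists (c t); split; [rewrite -WO|exists t].
Qed.

Lemma bohr_coord_point_eq (chi psi : char) (x : H) : sigma chi -> sigma psi ->
  bohr_coord (fun t => chi t * psi t) x = bohr_coord chi x * bohr_coord psi x.
Proof.
move=> hchi hpsi; apply/eqP; rewrite -subr_eq0; apply/eqP.
pose p := fun x : prod_topology (fun _ : char => C) =>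
  x (fun t => chi t * psi t) - x chi * x psi : C.
have cp : continuous p.
  move=> y.
  have cc i : (fun x : prod_topology (fun _ : char => C) => x i) @ y --> y i.
    exact: prod_topology_coord.
  exact: (cvgB (cc _) (cvgM (cc _) (cc _))).
apply: (bohr_set_closed_eq cp _ (set_valP x)) => t.
rewrite /p /bohr_point !asboolT ?subrr//.
by case: hsigma => _ _ hM _; exact: hM.
Qed.

Lemma bohr_coord_trivial (chi : char) (x : H) : (sigma chi -> chi = (fun=> 1)) ->
  bohr_coord chi x = 1.
Proof.
move=> hchi; apply/eqP; rewrite -subr_eq0; apply/eqP.
pose p := fun x : prod_topology (fun _ : char => C) => x chi - 1 : C.
have cp : continuous p.
  move=> y.
  have cc : (fun x : prod_topology (fun _ : char => C) => x chi) @ y --> y chi.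
    exact: prod_topology_coord.
  exact: (cvgB cc (cvg_cst (1 : C))).
apply: (bohr_set_closed_eq cp _ (set_valP x)) => t.
by rewrite /p /bohr_point; case: ifPn => [/asboolP/hchi->|_]; rewrite subrr.
Qed.

(** Translation by [c t] multiplies the coordinate [chi] by the inverse of [chi t],
    so it is the conjugate coordinates that are eigenfunctions for [chi]. *)
Definition bohr_eigen (chi : char) (x : borel H) : C := ((bohr_coord chi (x : H))^*)%C.

Lemma bohr_eigen_continuous chi : continuous (bohr_eigen chi : H -> C).
Proof.
move=> x; apply: (@continuous_comp _ _ _ (bohr_coord chi) (fun z : C => ((z^*)%C : C))).
  exact: bohr_coord_continuous.
exact: conjc_continuous.
Qed.

Variables (m : probability (borel H) R) (hm : is_haar m).
Local Notation T := (fun t => L1translation hm (c t)).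

Lemma bohr_eigen_unit chi x : normc (bohr_eigen chi x) = 1.
Proof. by rewrite normc_conj bohr_coord_unit. Qed.

Lemma bohr_eigen_cint chi : cintegrable m (bohr_eigen chi).
Proof.
apply: (cint_bounded _ (M := 1)); last by move=> x; rewrite bohr_eigen_unit.
exact: continuous_cmeasurable (@bohr_eigen_continuous chi).
Qed.

Lemma bohr_eigen_rotation chi t : sigma chi ->
  T t (cls m (bohr_eigen chi)) = chi t *: cls m (bohr_eigen chi).
Proof.
move=> hchi; rewrite /= cls_translation; last exact: bohr_eigen_cint.
rewrite -clsZ; last exact: bohr_eigen_cint.
congr (cls _ _); apply/funext => x; rewrite /bohr_eigen /=.
have -> : bohr_coord chi (translation (c t) x : H) =
    ((bohr_coord chi (c t))^*)%C * bohr_coord chi (x : H) by [].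
have -> : chi t = bohr_coord chi (c t).
  by rewrite [RHS]/(bohr_point sigma t chi) /bohr_point (asboolT hchi).
rewrite -[in RHS](conjcK (bohr_coord chi (c t))); exact: rmorphM.
Qed.

Lemma character_subgroup_group_like : group_like sigma.
Proof. by case: hsigma. Qed.

Lemma character_subgroup_neq0 chi : sigma chi -> forall t, chi t != 0.
Proof. by case: hsigma => h _ _ _ /h/character_neq0. Qed.

Lemma character_subgroup_unit chi t : sigma chi -> normc (chi t) = 1.
Proof.
case: hsigma => h _ _ _ /h[_ _ chi1]; apply: complexI.
by rewrite -normr_normc chi1.
Qed.

Lemma bohr_unit_rep : unit_rep sigma m bohr_eigen.
Proof.
split.
- by move=> chi _; exact: continuous_cmeasurable (@bohr_eigen_continuous chi).
- by move=> chi x _; exact: bohr_eigen_unit.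
- move=> chi psi hchi hpsi; apply: aeW => x.
  by rewrite /bohr_eigen bohr_coord_point_eq// rmorphM.
move=> chi hchi; case: ifPn => /asboolP chi1.
  rewrite (_ : bohr_eigen chi = cst 1).
    by rewrite -L1one_cls cintegral1.
  by apply/funext => x; rewrite /bohr_eigen bohr_coord_trivial// rmorph1.
have [t /eqP t1] : exists t, chi t <> 1.
  apply: contra_notP chi1 => /forallNP h; apply/funext => t.
  by apply: contrapT; exact: h.
have := markov_cintegral (translation_markov hm (c t)) (cls m (bohr_eigen chi)).
rewrite bohr_eigen_rotation// cintegralZ => /eqP.
rewrite -subr_eq0 -{2}[cintegral _]mul1r -mulrBl mulf_eq0 subr_eq0 (negPf t1).
by move=> /eqP.
Qed.

(** Distinct points of [H] differ in a coordinate. *)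
Lemma bohr_dense : trig_dense sigma m bohr_eigen.
Proof.
apply: (trig_dense_haar hm bohr_group_compact bohr_group_hausdorff
  character_subgroup_group_like character_subgroup_neq0 bohr_unit_rep).
  by move=> chi _; exact: bohr_eigen_continuous.
move=> x y xy; apply: contrapT => /forall2NP h; apply: xy.
apply: bohr_coord_inj => chi; have [hchi|nchi] := pselect (sigma chi).
  apply: (can_inj (@conjcK R)); apply: contrapT => ne.
  by case: (h chi).
by rewrite !bohr_coord_trivial.
Qed.

Local Notation rot := (rotation c hm : system R G).

(** Continuity is clear for trigonometric polynomials, on which [T] acts through
    the continuous characters in [sigma], and passes to limits of isometries. *)
Lemma rotation_continuous (F : L1 m) : continuous (fun t => T t F).
Proof.
have mT t := translation_markov hm (c t).
suff cont p : trig_on sigma p -> forall t0 (e : R), 0 < e ->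
    \forall t \near t0, nrm (T t0 (trig_cls m bohr_eigen p) - T t (trig_cls m bohr_eigen p)) < e.
  move=> t0; apply/(@cvg_nrmP R (L1 m) G (nbhs t0) (nbhs_filter t0)) => e e0.
  have e30 : 0 < e / 3 by rewrite divr_gt0.
  have [p hp Fp] := bohr_dense F e30.
  apply: filterS (cont p hp t0 _ e30) => t tp.
  rewrite (le_lt_trans (nrm_triangle (T t0 (trig_cls m bohr_eigen p)) _ _))//.
  have h1 : nrm (T t0 F - T t0 (trig_cls m bohr_eigen p)) < e / 3.
    by rewrite -(markovB (mT t0)) (markov_nrm (mT t0)).
  have h2 : nrm (T t (trig_cls m bohr_eigen p) - T t F) < e / 3.
    by rewrite -(markovB (mT t)) (markov_nrm (mT t)) nrmBC.
  have := nrm_triangle (T t (trig_cls m bohr_eigen p)) (T t0 (trig_cls m bohr_eigen p)) (T t F).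
  lra.
elim: p => [_ t0 e e0|a p ih /trig_on_cons[ha hp] t0 e e0].
  apply: nearW => t; rewrite (trig_clsE bohr_unit_rep)// big_nil.
  by rewrite !(markov0 (mT _)) subrr nrm0.
have e20 : 0 < e / 2 by rewrite divr_gt0.
have b0 : 0 < normc a.1 + 1 by rewrite ltr_wpDl ?normc_ge0.
have eb0 : 0 < e / 2 / (normc a.1 + 1) by rewrite divr_gt0.
have : \forall t \near t0, nrm (a.2 t0 - a.2 t : C) < e / 2 / (normc a.1 + 1).
  have := hsigma; case=> /(_ _ ha)[ca _ _] _ _ _.
  exact: ((@cvg_nrmP R C G (nbhs t0) (nbhs_filter t0) _ _).1 (ca t0) _ eb0).
apply: filterS2 (ih hp t0 _ e20) => t h1 h2.
rewrite !(trig_clsE bohr_unit_rep) in h1 *; [|exact: trig_on_cons2|exact: hp].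
rewrite !big_cons !(markovD (mT _)) !(markovZ (mT _)) !bohr_eigen_rotation//.
rewrite opprD addrACA (le_lt_trans (nrmD _ _))// [e]splitr ler_ltD//.
rewrite -scalerBr -scalerBl nrmZ.
have n1 := nrm_unit bohr_unit_rep ha.
rewrite nrmZ (le_trans (ler_wpM2l (normc_ge0 _) (ler_wpM2l (normc_ge0 _) n1)))// mulr1.
rewrite (le_trans (ler_wpM2r (normc_ge0 _) (_ : normc a.1 <= normc a.1 + 1)))//.
  by rewrite lerDl.
by rewrite mulrC -ler_pdivlMr//; apply/ltW; move: h2; rewrite nrm_normc.
Qed.

Lemma rotation_measure_preserving : measure_preserving rot.
Proof.
split.
- by move=> t; exact: translation_markov.
- by move=> F /=; exact: translation1.
- move=> s t F /=; rewrite -translationM; congr (L1translation hm _ F).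
  by apply: bohr_coord_inj => chi; exact: bohr_point_add.
- exact: rotation_continuous.
Qed.

Lemma trig_cls_monomial p psi : trig_on sigma p -> (forall a, a \in p -> a.2 = psi) ->
  exists a, trig_cls m bohr_eigen p = a *: cls m (bohr_eigen psi).
Proof.
move=> hp pE; exists (\sum_(a <- p) a.1).
rewrite (trig_clsE bohr_unit_rep)// scaler_suml; apply: eq_big_seq => a /pE ->.
by [].
Qed.

(** An eigenfunction is a limit of polynomials with terms in its own character
    only. Applied to the trivial character this gives ergodicity, and to characters
    outside [sigma], where such polynomials vanish, it bounds the point spectrum. *)
Lemma rotation_eigen_approximation psi (F : L1 m) (e : R) : (forall t, normc (psi t) = 1) ->
  (forall t, T t F = psi t *: F) -> 0 < e ->
  exists q, [/\ trig_on sigma q, (forall a, a \in q -> a.2 = psi) &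
    nrm (F - trig_cls m bohr_eigen q) < e].
Proof.
move=> psi1 TF e0; have e20 : 0 < e / 2 by rewrite divr_gt0.
have [p hp Fp] := bohr_dense F e20.
have [q [? ? h]] := eigen_approximation bohr_unit_rep (fun t => translation_markov hm (c t))
  (fun chi t => @bohr_eigen_rotation chi t) (fun chi t => @character_subgroup_unit chi t)
  psi1 TF hp e20.
by exists q; split => //; lra.
Qed.

Lemma rotation_ergodic : ergodic rot.
Proof.
exists (L1one m).
  by apply/eqP => o0; have := nrm_one m; rewrite o0 nrm0 => /eqP; rewrite eq_sym oner_eq0.
apply/seteqP; split => [F TF|_ [a _ <-] t]; last first.
  by rewrite /= (markovZ (translation_markov hm _)); case: (translation_markov hm (c t)) => _ _ _ _ ->.
exists (cintegral F) => //=; apply/esym/nrm_le_eps => e e0.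
have e40 : 0 < e / 4 by rewrite divr_gt0.
have [|t|q [hq qE Fq]] := @rotation_eigen_approximation (fun=> 1) F _ _ _ e40.
- by move=> t; exact: normc1.
- by rewrite scale1r; exact: TF.
have [a qa] := trig_cls_monomial hq qE.
have s1 : cls m (bohr_eigen (fun=> 1)) = L1one m.
  rewrite L1one_cls; congr (cls _ _); apply/funext => x.
  by rewrite /bohr_eigen bohr_coord_trivial// rmorph1.
rewrite {}qa s1 in Fq.
have ca : normc (a - cintegral F) <= 2 * nrm (F - a *: L1one m).
  rewrite -normcN opprB -[a in X in normc X]mulr1 -(cintegral1 m) -cintegralZ -cintegralB.
  exact: normc_cintegral_le.
rewrite (le_trans (nrm_triangle (a *: L1one m) _ _))// -scalerBl nrmZ nrm_one mulr1.
lra.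
Qed.

Lemma rotation_point_spectrum : point_spectrum rot = sigma.
Proof.
apply/seteqP; split => [psi [[_ _ psi1] [F F0 TF]]|chi hchi]; last first.
  split; first by case: hsigma => h _ _ _; exact: h.
  exists (cls m (bohr_eigen chi)); last by move=> t; exact: bohr_eigen_rotation.
  apply/eqP => /(congr1 nrm); rewrite nrm0 nrm_cls; last exact: bohr_eigen_cint.
  under eq_Rintegral do rewrite bohr_eigen_unit.
  by rewrite Rintegral_cst//= probability_setT mulr1 => /eqP; rewrite oner_eq0.
apply: contrapT => npsi; move/eqP: F0; apply; apply: nrm_le_eps => e e0.
have psi1' t : normc (psi t) = 1 by apply: complexI; rewrite -normr_normc psi1.
have [q [hq qE Fq]] := rotation_eigen_approximation psi1' TF e0.
have q0 : q = [::].
  case: q hq qE {Fq} => // a q /trig_on_cons[ha _] qE.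
  by exfalso; apply: npsi; rewrite -(qE a)// mem_head.
by move: Fq; rewrite q0 (trig_clsE bohr_unit_rep)// big_nil => /ltW.
Qed.

Lemma rotation_discrete_spectrum : discrete_spectrum rot.
Proof.
apply/dense_nrmP => F e e0; have [p hp Fp] := bohr_dense F e0.
exists (trig_cls m bohr_eigen p) => //.
pose b (i : 'I_(size p)) : L1 m := cls m (bohr_eigen (tnth (in_tuple p) i).2).
exists [set \sum_(i < size p) a i *: b i | a in [set: 'I_(size p) -> R[i]]].
  split; first by exists (size p), b.
  move=> t _ [a _ <-]; exists (fun i => a i * (tnth (in_tuple p) i).2 t) => //.
  rewrite /= (markov_sum (translation_markov hm _)); apply: eq_bigr => i _.
  rewrite (markovZ (translation_markov hm _)) bohr_eigen_rotation ?scalerA//.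
  by apply: hp; exact: mem_tnth.
exists (fun i => (tnth (in_tuple p) i).1) => //.
by rewrite (trig_clsE bohr_unit_rep)// [RHS]big_tnth.
Qed.

End rotation.

Theorem theorem4p5 (R : realType) (G : topologicalZmodType) :
  [/\ (forall X1 X2 : system R G,
         measure_preserving X1 -> ergodic X1 -> discrete_spectrum X1 ->
         measure_preserving X2 -> ergodic X2 -> discrete_spectrum X2 ->
         (isomorphic X1 X2 <-> point_spectrum X1 = point_spectrum X2)),
      (forall sigma : set (G -> (R[i]^o)%type), character_subgroup sigma ->
         exists X : system R G,
           [/\ measure_preserving X, ergodic X, discrete_spectrum X
             & point_spectrum X = sigma])
    & (forall X : system R G,
         measure_preserving X -> ergodic X -> discrete_spectrum X ->
         exists (H : topologicalGroupType) (c : G -> H)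
                (m : probability (borel H) R) (hm : is_haar m),
           [/\ group_compactification c, measure_preserving (rotation c hm)
             & isomorphic X (rotation c hm)])].
Proof.
split.
- move=> X1 X2 m1 e1 d1 m2 e2 d2; split; first exact: isomorphic_point_spectrum.
  exact: isomorphic_of_point_spectrum.
- move=> sigma hsigma.
  have [m hm] := haar_measure_exists R (@bohr_group_compact _ _ _ hsigma)
    (@bohr_group_hausdorff _ _ _ hsigma).
  exists (rotation (bohr_embed hsigma : G -> (bohr_group hsigma : topologicalGroupType)) hm).
  split.
  + exact: rotation_measure_preserving.
  + exact: rotation_ergodic.
  + exact: rotation_discrete_spectrum.
  + exact: rotation_point_spectrum.
- move=> X mX eX dX; have hsigma := point_spectrum_subgroup mX eX.
  have [m hm] := haar_measure_exists R (@bohr_group_compact _ _ _ hsigma)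
    (@bohr_group_hausdorff _ _ _ hsigma).
  exists (bohr_group hsigma : topologicalGroupType), (bohr_embed hsigma), m, hm; split.
  + exact: bohr_embed_compactification.
  + exact: rotation_measure_preserving.
  + apply: isomorphic_of_point_spectrum => //.
    * exact: rotation_measure_preserving.
    * exact: rotation_ergodic.
    * exact: rotation_discrete_spectrum.
    * by rewrite rotation_point_spectrum.
Qed.
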